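(* Let $r\geqslant2$ and let $\mathcal L_2$ be the class of $r$th order linear ODEs in the Laguerre--Forsyth form $$x^{(r)}+a_{r-3}(t)x^{(r-3)}+\dots+a_1(t)x'+a_0(t)x=b(t)$$ with arbitrary smooth functions $a_{r-3},\dots,a_0,b$ of $t$ (for $r=2$ the class consists of the equations $x''=b(t)$). The equivalence group $G^\sim_2$ of $\mathcal L_2$ consists of the transformations whose projections to the variable space have the form $$\tilde t=\frac{\alpha t+\beta}{\gamma t+\delta},\quad \tilde x=\frac C{(\gamma t+\delta)^{r-1}}x+X_0(t),$$ where $\alpha$, $\beta$, $\gamma$, $\delta$ and $C$ are arbitrary constants with $\alpha\delta-\beta\gamma\ne0$ and $C\ne0$ that are defined up to obvious rescaling (so only four constants among them are essential), and $X_0$ is an arbitrary smooth function of $t$. In the case $r=2$ the class $\mathcal L_2$ is semi-normalized but not normalized. If $r\geqslant3$, then the group $G^\sim_2$ generates the equivalence groupoid of $\mathcal L_2$, i.e., the class $\mathcal L_2$ is normalized.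
   Context: The underlying field $\mathbb F$ is $\mathbb R$ or $\mathbb C$; all variables, functions and constants are real or complex, respectively. $x=x(t)$ is the unknown function, $x^{(k)}=d^kx/dt^k$. Everything is local: functions and transformations are smooth and considered on suitable open domains. A point transformation is a transformation $\tilde t=T(t,x)$, $\tilde x=X(t,x)$ with nonvanishing Jacobian $\partial(T,X)/\partial(t,x)$; it acts on ODEs via prolongation to derivatives. The arbitrary elements of a class of ODEs are the functions (coefficients, right-hand side) parameterizing it. An admissible transformation of a class is a triple $(\mathcal E,\tilde{\mathcal E},\mathcal T)$, where $\mathcal E$ and $\tilde{\mathcal E}$ are equations of the class and $\mathcal T$ (the transformational part) is a point transformation mapping $\mathcal E$ to $\tilde{\mathcal E}$. The equivalence groupoid of the class is the set of all its admissible transformations with composition. The (usual) equivalence (pseudo)group of the class consists of the point transformations in the joint space of $t$, $x$, the derivatives of $x$ and the arbitrary elements that are consistent with the contact structure (the components for derivatives are obtained by prolongation), are projectable to the variable space, i.e. the $(t,x)$-space (the components for $t$ and $x$ depend only on $(t,x)$), and map every equation of the class to an equation of the class. An equivalence transformation generates the admissible transformations $(\mathcal E,\tilde{\mathcal E},\mathcal T)$ in which $\mathcal T$ is its projection to the $(t,x)$-space, $\mathcal E$ is any equation of the class and $\tilde{\mathcal E}$ is the image of $\mathcal E$. A class is normalized if its equivalence group generates its entire equivalence groupoid. A class is semi-normalized if for every admissible transformation $(\mathcal E,\tilde{\mathcal E},\mathcal T)$, $\mathcal T$ is the composition of a point symmetry transformation of $\mathcal E$ followed by the projection of an equivalence transformation.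 *)

(* Defs.v *)
From HB Require Import structures.
From mathcomp Require Import all_boot all_order all_algebra.
From mathcomp Require Import complex.
From mathcomp Require Import all_classical all_reals all_analysis.
Set Implicit Arguments.
Unset Strict Implicit.
Unset Printing Implicit Defensive.
Import Order.TTheory GRing.Theory Num.Theory.
Import numFieldNormedType.Exports.
Local Open Scope classical_set_scope.
Local Open Scope ring_scope.

Variant ground_field := RealNumbers | ComplexNumbers.

Definition scalars (R : realType) (F : ground_field) : numFieldType :=
  match F with
  | RealNumbers => R
  | ComplexNumbers => R[i]
  end.

(* Derivatives are taken over the ground field itself, so that "smooth" means
   C^oo over the reals and infinitely complex-differentiable over the complex
   numbers. Functions are total; only their values on the stated open sets
   matter. *)
Section Smooth.
Variables (K : numFieldType) (V W : normedModType K).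

Fixpoint times_differentiable (n : nat) (U : set V) (f : V -> W) : Prop :=
  match n with
  | 0 => forall p, U p -> {for p, continuous f}
  | m.+1 => (forall p, U p -> differentiable f p) /\
            (forall v : V, times_differentiable m U (fun p => 'D_v f p))
  end.

Definition smooth (U : set V) (f : V -> W) : Prop :=
  forall n, times_differentiable n U f.

End Smooth.

Section LaguerreForsyth.
Variables (K : numFieldType) (r : nat).

(* The points (t, x) are pairs. An r-jet is a row vector (t, x_0, ..., x_r),
   where x_k stands for the k-th derivative of x. The values of the arbitrary
   elements form a row vector (a_0, ..., a_(r-3), b); for r = 2 it is (b). *)
Definition plane : normedModType K := (K * K)%type.
Definition jet := 'rV[K]_r.+2.
Definition arbval := 'rV[K]_((r - 2) + 1).
Definition joint := 'rV[K]_(r.+2 + ((r - 2) + 1)).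

Definition jt (z : jet) : K := z 0 ord0.
Definition jx (z : jet) (k : nat) : K := z 0 (inord k.+1).
Definition base (z : jet) : plane := (jt z, jx z 0).

Definition av_a (th : arbval) (k : 'I_(r - 2)) : K := th 0 (lshift 1 k).
Definition av_b (th : arbval) : K := th 0 (rshift (r - 2) ord0).

Definition joint_jet (w : joint) : jet := lsubmx w.
Definition joint_arb (w : joint) : arbval := rsubmx w.
Definition joint_pt (z : jet) (th : arbval) : joint := row_mx z th.

Record equation := Equation {
  dom : set K;
  coef : 'I_(r - 2) -> K -> K;
  rhs : K -> K;
  dom_open : open dom;
  coef_smooth : forall k, smooth dom (coef k);
  rhs_smooth : smooth dom rhs }.

Definition arb (E : equation) (t : K) : arbval :=
  row_mx (\row_k coef E k t) (const_mx (rhs E t)).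

Definition eq_holds (th : arbval) (z : jet) : Prop :=
  jx z r + \sum_(k < r - 2) av_a th k * jx z k = av_b th.

Definition on_equation (E : equation) (z : jet) : Prop :=
  eq_holds (arb E (jt z)) z.

(* Total derivative of a function of order less than r on the jet space. *)
Definition total_derivative (f : jet -> K) (z : jet) : K :=
  'D_(delta_mx 0 ord0 : jet) f z +
  \sum_(k < r) jx z k.+1 * 'D_(delta_mx 0 (inord k.+1) : jet) f z.

Section PointTransformations.
Variables (T X : plane -> K).

Definition DT : jet -> K := total_derivative (T \o base).

Fixpoint prolonged_derivative (k : nat) : jet -> K :=
  match k with
  | 0 => X \o base
  | m.+1 => fun z => total_derivative (prolonged_derivative m) z / DT z
  end.

(* Meaningful only where DT does not vanish. *)
Definition prolongation (z : jet) : jet :=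
  \row_(i < r.+2)
    match nat_of_ord i with
    | 0 => T (base z)
    | k.+1 => prolonged_derivative k z
    end.

Definition plane_jacobian (p : plane) : K :=
  'D_((1, 0) : plane) T p * 'D_((0, 1) : plane) X p -
  'D_((0, 1) : plane) T p * 'D_((1, 0) : plane) X p.

(* A domain in the (t, x)-plane has connected fibres over the t-axis: otherwise
   a function on it with zero x-derivative need not be a function of t. Such
   domains (e.g. products of intervals or discs) form a basis of the topology. *)
Definition suitable_domain (U : set plane) : Prop :=
  [/\ open U, U !=set0, connected U &
      forall t : K, connected [set x : K | U (t, x)]].

Definition point_transformation (U : set plane) : Prop :=
  [/\ suitable_domain U, smooth U T, smooth U X &
      forall p, U p -> plane_jacobian p != 0].

Definition maps_equation (U : set plane) (E E' : equation) : Prop :=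
  (forall p, U p -> dom E p.1 /\ dom E' (T p)) /\
  (forall z, U (base z) -> DT z != 0 ->
     (on_equation E z <-> on_equation E' (prolongation z))).

Definition admissible (U : set plane) (E E' : equation) : Prop :=
  point_transformation U /\ maps_equation U E E'.

(* Transformations of the joint space of t, x, the derivatives of x and the
   arbitrary elements, with components for t and x depending only on (t, x)
   and components for derivatives obtained by prolongation. *)
Section Joint.
Variables (Om : set joint) (Th : joint -> arbval).

Definition joint_map (w : joint) : joint :=
  joint_pt (prolongation (joint_jet w)) (Th w).

Definition plane_projection : set plane :=
  [set base (joint_jet w) | w in Om].

(* The equation E' is the image of E (where E meets the domain). *)
Definition generates (E E' : equation) : Prop :=
  forall z, dom E (jt z) -> Om (joint_pt z (arb E (jt z))) ->
  [/\ dom E' (T (base z)),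
      Th (joint_pt z (arb E (jt z))) = arb E' (T (base z)) &
      on_equation E z <-> on_equation E' (prolongation z)].

(* The next-to-last condition says that no equation of the class is missed:
   over every point (t, x) and for all values of the arbitrary elements, the
   domain contains points of the corresponding equation. *)
Definition equivalence_transformation : Prop :=
  [/\ open Om,
      point_transformation plane_projection,
      smooth Om Th /\
      (forall w, Om w ->
         DT (joint_jet w) != 0 /\ \det (jacobian joint_map w) != 0),
      (forall p (th : arbval), plane_projection p ->
         exists z, [/\ base z = p, Om (joint_pt z th) & eq_holds th z]) &
      forall E : equation, exists E' : equation, generates E E'].

End Joint.
End PointTransformations.

(* As everything is local, generation and composition are required near each
   point of the domain of the admissible transformation. *)
Definition normalized : Prop :=
  forall (E E' : equation) (U : set plane) (T X : plane -> K),
    admissible T X U E E' ->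
    forall p, U p ->
    exists (Om : set joint) (Th : joint -> arbval),
      [/\ plane_projection Om `<=` U, plane_projection Om p,
          equivalence_transformation T X Om Th &
          generates T X Om Th E E'].

Definition semi_normalized : Prop :=
  forall (E E' : equation) (U : set plane) (T X : plane -> K),
    admissible T X U E E' ->
    forall p, U p ->
    exists (V : set plane) (S Y : plane -> K)
           (Om : set joint) (T' X' : plane -> K) (Th : joint -> arbval),
      [/\ V `<=` U /\ V p,
          admissible S Y V E E,
          equivalence_transformation T' X' Om Th &
          forall q, V q ->
            [/\ plane_projection Om (S q, Y q),
                T q = T' (S q, Y q) & X q = X' (S q, Y q)]].

Record parameters := MoebiusData {
  alpha : K; beta : K; gamma : K; delta : K; C : K; X0 : K -> K }.

Definition t_projection (U : set plane) : set K := [set p.1 | p in U].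

Definition valid_parameters (U : set plane) (m : parameters) : Prop :=
  [/\ alpha m * delta m - beta m * gamma m != 0, C m != 0,
      smooth (t_projection U) (X0 m) &
      forall t, t_projection U t -> gamma m * t + delta m != 0].

Definition T_of (m : parameters) (p : plane) : K :=
  (alpha m * p.1 + beta m) / (gamma m * p.1 + delta m).

Definition X_of (m : parameters) (p : plane) : K :=
  C m / (gamma m * p.1 + delta m) ^+ r.-1 * p.2 + X0 m p.1.

(* All derivatives and all values of the arbitrary elements, over U. *)
Definition cylinder (U : set plane) : set joint :=
  [set w | U (base (joint_jet w))].

Definition rescaled (U : set plane) (m m' : parameters) : Prop :=
  exists2 l : K, l != 0 &
    [/\ alpha m' = l * alpha m /\ beta m' = l * beta m,
        gamma m' = l * gamma m /\ delta m' = l * delta m,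
        C m' = l ^+ r.-1 * C m &
        forall t, t_projection U t -> X0 m' t = X0 m t].

End LaguerreForsyth.

(* Main.v *)
(* A transformation in question first has T_x = 0. For an equivalence
   transformation, otherwise two of the equations x^(r) = e (t - t0) would be
   sent to equations forcing the component for the arbitrary elements to
   degenerate. For an admissible transformation with r >= 3, otherwise DT
   vanishes somewhere on the equation, where the r-th prolonged derivative blows
   up faster than the lower ones. With T = theta(t), comparing the coefficients
   of the highest derivatives gives X_xx = 0, and for X = m(t) x + X_0(t) the
   vanishing of the two subleading coefficients gives m' = (r - 1)/2 sigma m and
   sigma' = sigma^2/2 with sigma = theta''/theta', which integrates to the
   Moebius form. Conversely (Bol's lemma), for Moebius theta and
   m = C (gamma t + delta)^(1 - r) the r-th prolonged derivative is
   m theta'^(-r) x^(r) up to a function of t. For r = 2 two primitives of the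
   difference of the right-hand sides give an equivalence transformation between
   the equations, while the hodograph transformation has T_x <> 0. *)
Require Import Defs.
From HB Require Import structures.
From mathcomp Require Import all_boot all_order all_algebra.
From mathcomp Require Import complex.
From mathcomp Require Import all_classical all_reals all_analysis.
From mathcomp Require Import ring zify.
Set Implicit Arguments.
Unset Strict Implicit.
Unset Printing Implicit Defensive.
Import Order.TTheory GRing.Theory Num.Theory.
Import numFieldNormedType.Exports.
Local Open Scope classical_set_scope.
Local Open Scope ring_scope.

(** * Smooth functions *)

Section Calculus.
Variable K : numFieldType.
Implicit Types V W : normedModType K.

(** An equivalence transformation lives on an open set of the joint space that may be small in the
    derivatives, so once T_x = 0 is known every condition is extracted by a small move of a single
    jet along its equation. The normal form explains why this suffices: its terms of orders r - 1
    and r - 2 are absent, so a move of x_(r-2), x_(r-1) or x_r leaves all lower terms of the image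
    equation unchanged, and the transformed r-th derivative alone must stay constant. Both necessity
    statements then share one lemma, which asks for the forward implication near one jet over each
    point.

    The Moebius form alone does not give normalization: the induced map of the arbitrary elements
    must send those of [E] to those of [E']. This holds because the jets of an equation over an open
    set, at fixed t, determine its coefficients and right-hand side.

    Both ground fields are treated at once by reducing calculus over K to real calculus on segments:
    mean values of the two real coordinates give constancy, and real integrals give primitives, with
    no contour integration. *)

Lemma near_eq_differentiable V W (f g : V -> W) (p : V) :
  (\near p, f p = g p) -> differentiable f p -> differentiable g p.
Proof.
move=> fg df; have E : g \o shift p = cst (g p) + 'd f p +o_ 0 id.
  have /diff_locally/eqaddoP fo := df.
  apply/eqaddoP => e e0; have := fo e e0; apply: filter_app.
  have : \forall h \near 0, f (h + p) = g (h + p).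
    by move: fg; rewrite (near_shift 0 p) subr0.
  have fgp := nbhs_singleton fg.
  by apply: filter_app; near=> h => /= E; rewrite !fctE/= /shift/= E fgp.
apply/diff_locallyP; have -> : 'd g p = 'd f p :> (V -> W).
  by apply: diff_unique E; exact: diff_continuous.
by split=> //; exact: diff_continuous.
Unshelve. all: by end_near. Qed.

Lemma times_differentiableW V W n (U : set V) (f : V -> W) :
  times_differentiable n.+1 U f -> times_differentiable n U f.
Proof.
elim: n f => [|n IH] f [df Df].
  by move=> p Up; exact/differentiable_continuous/df.
by split=> // v; exact: IH.
Qed.

Lemma times_differentiable_sub V W n (U U' : set V) (f : V -> W) :
  U' `<=` U -> times_differentiable n U f -> times_differentiable n U' f.
Proof.
move=> UU; elim: n f => [|n IH] f /=; first by move=> cf p /UU; exact: cf.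
by move=> [df Df]; split=> [p /UU|v]; [exact: df|exact: IH].
Qed.

Lemma open_near V (U : set V) (P : V -> Prop) (p : V) :
  open U -> U p -> (forall q, U q -> P q) -> \forall q \near p, P q.
Proof. by move=> oU Up UP; apply: filterS UP _; exact: open_nbhs_nbhs. Qed.

Lemma times_differentiable_eq V W n (U : set V) (f g : V -> W) : open U ->
  (forall p, U p -> f p = g p) ->
  times_differentiable n U f -> times_differentiable n U g.
Proof.
move=> oU; elim: n f g => [|n IH] f g fg /=.
  move=> cf p Up; change (g @ p --> g p); rewrite -(fg p Up).
  apply: cvg_trans (cf p Up); apply: near_eq_cvg.
  exact: open_near Up _.
move=> [df Df]; split=> [p Up|v].
  by apply: near_eq_differentiable (df p Up); exact: open_near Up _.
apply: IH (Df v) => p Up; apply: near_eq_derive; exact: open_near Up _.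
Qed.

Lemma smooth_sub V W (U U' : set V) (f : V -> W) :
  U' `<=` U -> smooth U f -> smooth U' f.
Proof. by move=> UU sf n; exact: times_differentiable_sub (sf n). Qed.

Lemma smooth_eq V W (U : set V) (f g : V -> W) : open U ->
  (forall p, U p -> f p = g p) -> smooth U f -> smooth U g.
Proof. by move=> oU fg sf n; exact: times_differentiable_eq fg (sf n). Qed.

Lemma smooth_differentiable V W (U : set V) (f : V -> W) p :
  smooth U f -> U p -> differentiable f p.
Proof. by move=> /(_ 1%N)[df _]; exact: df. Qed.

Lemma smooth_continuous V W (U : set V) (f : V -> W) p :
  smooth U f -> U p -> {for p, continuous f}.
Proof. by move=> sf Up; exact: (sf 0%N). Qed.

Lemma smooth_derive V W (U : set V) (f : V -> W) v :
  smooth U f -> smooth U (fun p => 'D_v f p).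
Proof. by move=> sf n; have [_] := sf n.+1; exact. Qed.

Lemma smooth_local V W (U : set V) (f : V -> W) : open U ->
  (forall p, U p -> exists2 U', U' p /\ open U' & smooth U' f) -> smooth U f.
Proof.
move=> oU H n.
have {}H p : U p -> exists2 U', U' p /\ open U' & times_differentiable n U' f.
  by move=> /H[U' ? sf]; exists U'.
elim: n f H => [|n IH] f H /=.
  by move=> p /[dup] Up /H[U' [U'p _] cf]; exact: cf.
split; first by move=> p /[dup] Up /H[U' [U'p _] [df _]]; exact: df.
by move=> v; apply: IH => p /H[U' ? [_ Df]]; exists U' => //; exact: Df.
Qed.

Lemma derive_fD V W (f g : V -> W) p v : differentiable f p ->
  differentiable g p -> 'D_v (fun q => f q + g q) p = 'D_v f p + 'D_v g p.
Proof. by move=> df dg; apply: deriveD; exact: diff_derivable. Qed.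

(** Scaling is a continuous bilinear map, so its differential at [(f p, g p)] is composed with the
    differential of the pair. *)
Lemma derive_fZ V W (f : V -> K) (g : V -> W) p v : differentiable f p ->
  differentiable g p ->
  differentiable (fun q => f q *: g q) p /\
  'D_v (fun q => f q *: g q) p = 'D_v f p *: g p + f p *: 'D_v g p.
Proof.
move=> df dg.
have -> : (fun q => f q *: g q) =
    (fun p => p.1 *: p.2) \o (fun y => (f y, g y)) by [].
have dfg : differentiable (fun y => (f y, g y)) p by exact: differentiable_pair.
have sb : bilinear_for *:%R *:%R (fun (a : K) (w : W) => a *: w : W).
  split=> [w a x y|a x y z]; rewrite /= ?scalerDl ?scalerA//.
  by rewrite scalerDr !scalerA mulrC.
pose sM := bilinear_isBilinear.Build K K W W _ _ (fun (a : K) (w : W) => a *: w) sb.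
pose sB : {bilinear K -> W -> W} := HB.pack (fun (a : K) (w : W) => a *: w) sM.
have cs : continuous (fun p : K * W => sB p.1 p.2) by exact: scale_continuous.
have ds : differentiable (fun p : K * W => p.1 *: p.2) (f p, g p).
  exact: (@differentiable_bilin _ _ _ _ sB).
have dc := differentiable_comp dfg ds.
split=> //; rewrite deriveE// (diff_comp dfg ds)/= (@diff_bilin _ _ _ _ sB)//=.
by rewrite diff_pair//= !deriveE// addrC.
Qed.

Lemma derive_fM V (f g : V -> K) p v : differentiable f p ->
  differentiable g p ->
  'D_v (fun q => f q * g q) p = 'D_v f p * g p + f p * 'D_v g p.
Proof. by move=> df dg; have [_] := @derive_fZ V K f g p v df dg. Qed.

Lemma derive_fN V W (f : V -> W) p v : differentiable f p ->
  'D_v (fun q => - f q) p = - 'D_v f p.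
Proof. by move=> df; apply: deriveN; exact: diff_derivable. Qed.

Lemma derive_fV V (f : V -> K) p v : differentiable f p -> f p != 0 ->
  'D_v (fun q => (f q)^-1) p = - ('D_v f p / f p ^+ 2).
Proof.
move=> df f0; rewrite (deriveV f0 (diff_derivable df)).
by rewrite scaleNr; congr (- _); exact: mulrC.
Qed.

Lemma deriveDv V W (f : V -> W) p a u v : differentiable f p ->
  'D_(a *: u + v) f p = a *: 'D_u f p + 'D_v f p.
Proof. by move=> df; rewrite !deriveE// linearP. Qed.

Lemma smooth_cst V W (U : set V) (a : W) : open U -> smooth U (fun _ => a).
Proof.
move=> oU n; elim: n a => [|n IH] a /=; first by move=> p _; exact: cst_continuous.
split=> [p _|v]; first exact: differentiable_cst.
apply: times_differentiable_eq (IH 0) => // p _.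
by rewrite derive_cst.
Qed.

Lemma times_differentiableD V W n (U : set V) (f g : V -> W) : open U ->
  times_differentiable n U f -> times_differentiable n U g ->
  times_differentiable n U (fun p => f p + g p).
Proof.
move=> oU; elim: n f g => [|n IH] f g.
  by move=> sf sg p Up; exact: continuousD (sf p Up) (sg p Up).
move=> [df Df] [dg Dg]; split=> [p Up|v].
  exact: differentiableD (df p Up) (dg p Up).
apply: times_differentiable_eq (IH _ _ (Df v) (Dg v)) => // p Up.
by rewrite derive_fD//; [exact: df|exact: dg].
Qed.

Lemma times_differentiableZ V W n (U : set V) (f : V -> K) (g : V -> W) :
  open U -> times_differentiable n U f -> times_differentiable n U g ->
  times_differentiable n U (fun p => f p *: g p).
Proof.
move=> oU; elim: n f g => [|n IH] f g.
  by move=> sf sg p Up; exact: continuousZ (sf p Up) (sg p Up).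
move=> /[dup] /times_differentiableW sf [df Df].
move=> /[dup] /times_differentiableW sg [dg Dg]; split=> [p Up|v].
  exact: (derive_fZ 0 (df p Up) (dg p Up)).1.
apply: times_differentiable_eq
  (times_differentiableD oU (IH _ _ (Df v) sg) (IH _ _ sf (Dg v))) => //.
by move=> p Up; rewrite (derive_fZ v (df p Up) (dg p Up)).2.
Qed.

Lemma smoothD V W (U : set V) (f g : V -> W) : open U ->
  smooth U f -> smooth U g -> smooth U (fun p => f p + g p).
Proof. by move=> oU sf sg n; exact: times_differentiableD. Qed.

Lemma smoothZ V W (U : set V) (f : V -> K) (g : V -> W) : open U ->
  smooth U f -> smooth U g -> smooth U (fun p => f p *: g p).
Proof. by move=> oU sf sg n; exact: times_differentiableZ. Qed.

Lemma smoothM V (U : set V) (f g : V -> K) : open U ->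
  smooth U f -> smooth U g -> smooth U (fun p => f p * g p).
Proof. exact: (@smoothZ V K). Qed.

Lemma smoothN V W (U : set V) (f : V -> W) : open U ->
  smooth U f -> smooth U (fun p => - f p).
Proof.
move=> oU sf; have := smoothZ oU (@smooth_cst V K U (-1) oU) sf.
by apply: smooth_eq => // p Up; rewrite scaleN1r.
Qed.

Lemma smoothB V W (U : set V) (f g : V -> W) : open U ->
  smooth U f -> smooth U g -> smooth U (fun p => f p - g p).
Proof. by move=> oU sf sg; apply: smoothD => //; exact: smoothN. Qed.

Lemma smooth_sum V W (U : set V) I (s : seq I) (P : pred I) (f : I -> V -> W) :
  open U -> (forall i, smooth U (f i)) ->
  smooth U (fun p => \sum_(i <- s | P i) f i p).
Proof.
move=> oU sf; elim: s => [|i s IH].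
  by under eq_fun do rewrite big_nil; exact: smooth_cst.
under eq_fun do rewrite big_cons; case: (P i) => //.
exact: smoothD.
Qed.

Lemma smooth_prod V (U : set V) I (s : seq I) (P : pred I) (f : I -> V -> K) :
  open U -> (forall i, smooth U (f i)) ->
  smooth U (fun p => \prod_(i <- s | P i) f i p).
Proof.
move=> oU sf; elim: s => [|i s IH].
  by under eq_fun do rewrite big_nil; exact: smooth_cst.
under eq_fun do rewrite big_cons; case: (P i) => //.
exact: smoothM.
Qed.

Lemma smoothX V (U : set V) (f : V -> K) n : open U ->
  smooth U f -> smooth U (fun p => f p ^+ n).
Proof.
move=> oU sf; elim: n => [|n IH]; first exact: smooth_cst.
by under eq_fun do rewrite exprS; exact: smoothM.
Qed.

Lemma derive_linear V W (L : {linear V -> W}) (p v : V) :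
  continuous L -> 'D_v L p = L v.
Proof. by move=> cL; rewrite deriveE ?diff_lin//; exact: linear_differentiable. Qed.

Lemma smooth_lin V W (U : set V) (f : {linear V -> W}) :
  open U -> continuous f -> smooth U f.
Proof.
move=> oU cf [|n]; first by move=> p _; exact: cf.
split=> [p _|v]; first exact: linear_differentiable.
apply: times_differentiable_eq (smooth_cst (f v) oU n) => // p _.
by rewrite deriveE ?diff_lin//; exact: linear_differentiable.
Qed.

Lemma derive_comp1 V W (f : V -> K) (g : K -> W) p v : differentiable f p ->
  differentiable g (f p) ->
  'D_v (fun q => g (f q)) p = 'D_v f p *: 'D_1 g (f p).
Proof.
move=> dfp dgp; rewrite -[fun q => g (f q)]/(g \o f).
rewrite deriveE; last exact: differentiable_comp.
rewrite (diff_comp dfp dgp)/= (deriveE v dfp) (deriveE (1 : K) dgp).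
have E : 'd f p v = 'd f p v *: (1 : K) by rewrite /GRing.scale/= mulr1.
by rewrite [in LHS]E linearZ.
Qed.

Lemma derive_lin V W V' (f : {linear V' -> V}) (g : V -> W) p v :
  continuous f -> differentiable g (f p) ->
  'D_v (fun q => g (f q)) p = 'D_(f v) g (f p).
Proof.
move=> cf dg; rewrite -[fun q => g (f q)]/(g \o f).
have df : differentiable f p by exact: linear_differentiable.
rewrite deriveE; last exact: differentiable_comp.
by rewrite (diff_comp df dg)/= deriveE// diff_lin.
Qed.

Lemma smooth_precomp_lin V W V' (U : set V) (f : {linear V' -> V}) (g : V -> W) :
  open U -> continuous f -> smooth U g ->
  smooth (f @^-1` U) (fun p => g (f p)).
Proof.
move=> oU cf sg n; move: (sg n) => {sg}.
have oU' : open (f @^-1` U) by exact: open_comp.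
elim: n g => [|n IH] g.
  by move=> cg p Up; apply: continuous_comp; [exact: cf|exact: cg].
move=> [dg Dg]; split=> [p Up|v].
  by apply: differentiable_comp; [exact: linear_differentiable|exact: dg].
apply: times_differentiable_eq (IH _ (Dg (f v))) => // p Up.
by rewrite derive_lin//; exact: dg.
Qed.

(** The derivative of 1/f is (1/f)(1/f)(-f'), so each further order of differentiability of 1/f
    follows from the previous one for 1/f itself. *)
Lemma smoothV V (U : set V) (f : V -> K) : open U ->
  (forall p, U p -> f p != 0) -> smooth U f -> smooth U (fun p => (f p)^-1).
Proof.
move=> oU f0 sf n; elim: n => [|n IH].
  by move=> p Up; apply: continuousV; [exact: f0|exact: (sf 0%N)].
have df p : U p -> differentiable f p by exact: smooth_differentiable.
split=> [p Up|v].
  by apply: differentiableV; [exact: df|exact: f0].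
have := times_differentiableZ oU (times_differentiableZ oU IH IH)
  (smoothN oU (smooth_derive v sf) n).
apply: times_differentiable_eq => // p Up.
rewrite (derive_fV v (df p Up) (f0 p Up)).
by rewrite /GRing.scale/= -invfM -expr2 mulrN mulrC.
Qed.

Lemma smooth_comp1 V W (U : set V) (A : set K) (f : V -> K) (g : K -> W) :
  open U -> (forall p, U p -> A (f p)) ->
  smooth U f -> smooth A g -> smooth U (fun p => g (f p)).
Proof.
move=> oU UA sf sg n; move: (sg n) => {sg}; elim: n g => [|n IH] g.
  by move=> cg p Up; apply: continuous_comp; [exact: (sf 0%N)|exact/cg/UA].
move=> [dg Dg]; have df p : U p -> differentiable f p by exact: smooth_differentiable.
split=> [p Up|v].
  by apply: differentiable_comp; [exact: df|exact/dg/UA].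
apply: times_differentiable_eq 
  (times_differentiableZ oU (smooth_derive v sf n) (IH _ (Dg 1))) => //.
by move=> p Up; rewrite (derive_comp1 v (df p Up) (dg _ (UA p Up))).
Qed.

End Calculus.

(** * Connectedness and primitives *)

(* Covers both K = R, with iu = 0, and K = R[i], with iu = 'i. *)
Record coordinates (R : realType) (K : numFieldType) := Coordinates {
  ofR : {rmorphism R -> K};
  re : K -> R;
  im : K -> R;
  iu : K;
  coordE : forall z, z = ofR (re z) + iu * ofR (im z);
  reD : forall y z, re (y + z) = re y + re z;
  imD : forall y z, im (y + z) = im y + im z;
  reZ : forall s z, re (ofR s * z) = s * re z;
  imZ : forall s z, im (ofR s * z) = s * im z;
  re_comb : forall a b, re (ofR a + iu * ofR b) = a;
  im_comb : forall a b, im (ofR a + iu * ofR b) = im iu * b;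
  im_iu : forall z, im z = im iu * im z;
  le_ofR : forall a b, (ofR a <= ofR b) = (a <= b);
  norm_ofR : forall a, `|ofR a| = ofR `|a|;
  norm_re : forall z, ofR `|re z| <= `|z|;
  norm_im : forall z, ofR `|im z| <= `|z|;
  norm_iu : `|iu| <= 1;
  ge0_ofR : forall z, 0 <= z -> z = ofR (re z) }.

Section Coordinates.
Variables (R : realType) (K : numFieldType) (c : coordinates R K).
Local Notation i := (ofR c).
Local Notation re := (re c).
Local Notation im := (im c).

Lemma lt_ofR a b : (i a < i b) = (a < b).
Proof. by rewrite !lt_neqAle le_ofR (inj_eq (fmorph_inj _)). Qed.

Lemma gt0_ofR (e : K) : 0 < e -> 0 < re e /\ e = i (re e).
Proof. by move=> e0; split; [rewrite -lt_ofR rmorph0|]; rewrite -?(ge0_ofR c)// ltW. Qed.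

Lemma ofR_continuous : continuous (i : R -> K).
Proof.
move=> x; apply/(cvgrPdist_lt (FF := nbhs_filter x)) => e /gt0_ofR[re0 ->].
near=> y; rewrite -rmorphB norm_ofR lt_ofR; near: y.
by apply/nbhs_ballP; exists (re e).
Unshelve. all: by end_near. Qed.

Lemma reN z : re (- z) = - re z.
Proof. by have := reZ c (-1) z; rewrite rmorphN1 !mulN1r. Qed.

Lemma imN z : im (- z) = - im z.
Proof. by have := imZ c (-1) z; rewrite rmorphN1 !mulN1r. Qed.

Lemma re_continuous : continuous (re : K -> R).
Proof.
move=> x; apply/(cvgrPdist_lt (FF := nbhs_filter x)) => e e0; near=> y.
rewrite -lt_ofR -reN -reD; apply: le_lt_trans (norm_re c _) _; near: y.
by apply/nbhs_ballP; exists (i e) => //=; rewrite -(rmorph0 i) lt_ofR.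
Unshelve. all: by end_near. Qed.

Lemma im_continuous : continuous (im : K -> R).
Proof.
move=> x; apply/(cvgrPdist_lt (FF := nbhs_filter x)) => e e0; near=> y.
rewrite -lt_ofR -imN -imD; apply: le_lt_trans (norm_im c _) _; near: y.
by apply/nbhs_ballP; exists (i e) => //=; rewrite -(rmorph0 i) lt_ofR.
Unshelve. all: by end_near. Qed.

(* The derivative of a path in K, coordinate by coordinate; it makes sense
   although K is not a normed module over the reals. *)
Definition is_path_derive (s : R) (g : R -> K) (d : K) : Prop :=
  is_derive s (1 : R) (re \o g) (re d) /\ is_derive s (1 : R) (im \o g) (im d).

Lemma path_deriveB s g h d e : is_path_derive s g d -> is_path_derive s h e ->
  is_path_derive s (fun t => g t - h t) (d - e).
Proof.
move=> [g1 g2] [h1 h2]; split.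
  have -> : re \o (fun t => g t - h t) = (re \o g) - (re \o h).
    by apply/funext => t /=; rewrite reD reN.
  by rewrite reD reN; exact: is_deriveB.
have -> : im \o (fun t => g t - h t) = (im \o g) - (im \o h).
  by apply/funext => t /=; rewrite imD imN.
by rewrite imD imN; exact: is_deriveB.
Qed.

Lemma path_derive_continuous s g d : is_path_derive s g d ->
  {for s, continuous (re \o g)} /\ {for s, continuous (im \o g)}.
Proof.
by move=> [[dr _] [di _]]; split; apply: differentiable_continuous;
  exact/derivable1_diffP.
Qed.

(** The real mean value theorem is applied to the two coordinates separately, at unrelated
    intermediate points; hence the factor 2, which later estimates compensate. *)
Lemma path_mean_value (g d : R -> K) (M : R) :
  (forall s, s \in `[0, 1]%R -> is_path_derive s g (d s)) ->
  (forall s, s \in `[0, 1]%R -> `|d s| <= i M) ->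
  `|g 1 - g 0| <= i (2 * M).
Proof.
move=> gd dM.
have sub s : s \in `]0, 1[%R -> s \in `[0, 1]%R.
  exact: subset_itv_oo_cc.
have [a aI Ea] : exists2 a, a \in `[0, 1]%R & re (g 1) - re (g 0) = re (d a).
  have [|s /sub/gd[]//||a /sub aI E] := @MVT _ (re \o g) (re \o d) 0 1 => //.
    apply: continuous_in_subspaceT => s; rewrite inE => /gd.
    by move=> /path_derive_continuous[].
  by exists a => //; rewrite -[LHS]/((re \o g) 1 - (re \o g) 0) E subr0 mulr1.
have [b bI Eb] : exists2 b, b \in `[0, 1]%R & im (g 1) - im (g 0) = im (d b).
  have [|s /sub/gd[]//||b /sub bI E] := @MVT _ (im \o g) (im \o d) 0 1 => //.
    apply: continuous_in_subspaceT => s; rewrite inE => /gd.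
    by move=> /path_derive_continuous[].
  by exists b => //; rewrite -[LHS]/((im \o g) 1 - (im \o g) 0) E subr0 mulr1.
rewrite (coordE c (g 1 - g 0)) reD reN imD imN Ea Eb.
rewrite mulr_natl mulr2n rmorphD; apply: le_trans (ler_normD _ _) _; apply: lerD.
  by rewrite norm_ofR (le_trans (norm_re _ _))// dM.
rewrite normrM norm_ofR -[leRHS]mul1r ler_pM//; [by rewrite -(rmorph0 i) le_ofR|exact: norm_iu|].
by rewrite (le_trans (norm_im _ _))// dM.
Qed.

(** The difference quotient over K in the direction [w] is restricted to steps coming from R, and
    the continuous R-linear coordinates are then applied to its limit. *)
Lemma path_derive_segment (f : K -> K) (a w : K) (s : R) :
  differentiable f (a + i s * w) ->
  is_path_derive s (fun t => f (a + i t * w)) (w * 'D_1 f (a + i s * w)).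
Proof.
move=> df; set p := a + i s * w.
have Dw : (fun h => h^-1 *: (f (h *: w + p) - f p)) @ 0^' --> w * 'D_1 f p.
  have -> : w * 'D_1 f p = 'D_w f p.
    rewrite !deriveE//; have -> : 'd f p w = 'd f p (w *: (1 : K)).
      by rewrite /GRing.scale/= mulr1.
    by rewrite linearZ.
  exact: (@diff_derivable _ _ _ f p w df).
have i0 : (i : R -> K) @ 0^' --> (0 : K)^'.
  move=> A /nbhs_ballP[e e0 sA]; have [re0 Ee] := gt0_ofR e0.
  apply/nbhs_ballP; exists (re e) => // y.
  rewrite -ball_normE/= sub0r normrN => ye y0; apply: sA.
    by rewrite -ball_normE/= sub0r normrN norm_ofR Ee lt_ofR.
  by rewrite fmorph_eq0.
have {}Dw : (fun h : R => (i h)^-1 *: (f (i h *: w + p) - f p)) @ 0^' --> w * 'D_1 f p.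
  exact: cvg_comp i0 Dw.
have E (u : K -> R) : continuous u -> (forall s z, u (i s * z) = s * u z) ->
    (forall y z, u (y + z) = u y + u z) ->
    is_derive s (1 : R) (u \o (fun t => f (a + i t * w))) (u (w * 'D_1 f p)).
  move=> cu uZ uD.
  have uN z : u (- z) = - u z.
    by have := uZ (-1) z; rewrite rmorphN1 !mulN1r.
  suff L : (fun h : R => h^-1 *: ((u \o (fun t => f (a + i t * w))) (h *: 1 + s) -
     (u \o (fun t => f (a + i t * w))) s)) @ 0^' --> u (w * 'D_1 f p).
    by apply: DeriveDef; [apply/cvg_ex; exists (u (w * 'D_1 f p))|exact: cvg_lim].
  have := cvg_comp _ _ Dw (cu _); apply: cvg_trans.
  apply: near_eq_cvg; near=> h => /=.
  rewrite /GRing.scale/= -fmorphV uZ uD uN mulr1; congr (_ * (u (f _) - _)).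
  by rewrite /p rmorphD/= mulrDl addrCA addrC.
split; apply: E.
- exact: re_continuous.
- exact: reZ.
- exact: reD.
- exact: im_continuous.
- exact: imZ.
- exact: imD.
Unshelve. all: by end_near. Qed.

Lemma star_connected (V : normedModType K) (U : set V) (a : V) :
  (forall z s, U z -> s \in `[0, 1]%R -> U (a + i s *: (z - a))) ->
  connected U.
Proof.
move=> star; have [->|/set0P[z0 Uz0]] := eqVneq U set0; first exact: connected0.
pose S z := (fun s : R => a + i s *: (z - a)) @` `[0, 1].
have -> : U = \bigcup_(z in U) S z.
  apply/seteqP; split=> [z Uz|z [y Uy [s sI <-]]]; last exact: star.
  exists z => //; exists 1; last by rewrite rmorph1 scale1r addrC subrK.
  by rewrite /= in_itv/= lexx ler01.
apply: bigcup_connected => [|z Uz].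
  exists a => z Uz; exists 0; last by rewrite rmorph0 scale0r addr0.
  by rewrite /= in_itv/= lexx ler01.
apply: connected_continuous_connected; first exact: segment_connected.
apply: continuous_subspaceT => s.
apply: cvgD; first exact: cvg_cst.
by apply: cvgZr_tmp; exact: ofR_continuous.
Qed.

(** Every set defined by a condition on the value of f is open in A, so the level set of [f p] is
    both open and closed in A. *)
Lemma locally_constant_connected (T : topologicalType) (Y : Type) (A : set T)
    (f : T -> Y) : connected A -> open A ->
  (forall p, A p -> \forall q \near p, f q = f p) ->
  forall p q, A p -> A q -> f p = f q.
Proof.
move=> cA oA lf p q Ap Aq.
suff /seteqP[_ /(_ q Aq)[_ ->]] : A `&` [set z | f z = f p] = A by [].
have oE (P : set Y) : open (A `&` [set z | P (f z)]).
  rewrite openE => z [Az Pz]; apply: filterI; first exact: open_nbhs_nbhs.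
  by apply: filterS (lf z Az) => y /= ->.
apply: cA; first by exists p.
- by exists (A `&` [set z | f z = f p]); [exact: (oE [set y | y = f p])|rewrite setIA setIid].
- exists (~` (A `&` [set z | f z <> f p])).
    exact/open_closedC/(oE [set y | y <> f p]).
  apply/seteqP; split=> [z [Az fz]|z [Az H]]; split=> //; first by case.
  by apply: contrapT => nz; apply: H.
Qed.

Lemma ball_segment (z0 z : K) (e : K) (s : R) : ball z0 e z -> s \in `[0, 1]%R ->
  ball z0 e (z0 + i s * (z - z0)).
Proof.
rewrite -ball_normE/= in_itv/= => ze /andP[s0 s1].
have -> : z0 - (z0 + i s * (z - z0)) = i s * (z0 - z) by ring.
apply: le_lt_trans ze; rewrite normrM norm_ofR (ger0_norm s0).
rewrite -[leRHS]mul1r; apply: ler_wpM2r; rewrite ?normr_ge0//.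
by rewrite -(rmorph1 i) le_ofR.
Qed.

Lemma zero_derive_ball (f : K -> K) (z0 e : K) :
  (forall p, ball z0 e p -> differentiable f p /\ 'D_1 f p = 0) ->
  forall z, ball z0 e z -> f z = f z0.
Proof.
move=> df z ze; pose g s := f (z0 + i s * (z - z0)).
have : `|g 1 - g 0| <= i (2 * 0).
  apply: (@path_mean_value g (fun=> 0)) => [s sI|s sI]; last first.
    by rewrite normr0 rmorph0.
  have [dp Dp] := df _ (ball_segment ze sI).
  by have := path_derive_segment dp; rewrite Dp mulr0.
rewrite /g mulr0 !rmorph0 mul0r addr0 rmorph1 mul1r (addrC z0) subrK normr_le0.
by rewrite subr_eq0 => /eqP.
Qed.

Lemma zero_derive_constant (A : set K) (f : K -> K) : connected A -> open A ->
  (forall p, A p -> differentiable f p /\ 'D_1 f p = 0) ->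
  forall p q, A p -> A q -> f p = f q.
Proof.
move=> cA oA df; apply: locally_constant_connected => // p Ap.
have /nbhs_ballP[e e0 sA] : nbhs p A by exact: open_nbhs_nbhs.
near=> q; apply: (@zero_derive_ball f p e) => [r /sA /df//|].
by near: q; exact: nbhsx_ballx.
Unshelve. all: by end_near. Qed.

(** * Primitives over the real or complex field *)

Lemma continuous_antiderivative (u : R -> R) : continuous u ->
  exists P : R -> R, forall s : R, s \in `[0, 1]%R -> is_derive s (1 : R) P (u s).
Proof.
move=> cu; pose mu := @lebesgue_measure R.
(* Starting the integral at -1, and using 2 as the upper bound, makes 0 and 1 interior points, so
   the derivatives at the ends of the unit interval are two-sided. *)
exists (fun x => \int[mu]_(t in `[(-1)%R, x]) u t)%R => s; rewrite in_itv/= => /andP[s0 s1].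
have [||||dP DP] := @continuous_FTC1_closed R u (-1) s 2.
- by rewrite (le_lt_trans s1)// ltr1n.
- apply: continuous_compact_integrable; first exact: segment_compact.
  exact: continuous_subspaceT.
- by rewrite (lt_le_trans _ s0)// ltrN10.
- exact: cu.
by apply: DeriveDef => //; rewrite -derive1E.
Qed.

Lemma path_derive_ofRM s g d : is_path_derive s g d ->
  is_path_derive s (fun t => i t * g t) (i s * d + g s).
Proof.
have E (u : K -> R) : (forall s z, u (i s * z) = s * u z) ->
    (forall y z, u (y + z) = u y + u z) ->
    is_derive s (1 : R) (u \o g) (u d) ->
    is_derive s (1 : R) (u \o (fun t => i t * g t)) (u (i s * d + g s)).
  move=> uZ uD gd.
  have -> : u \o (fun t => i t * g t) = id * (u \o g).
    by apply/funext => t; rewrite /= uZ.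
  rewrite uD uZ; apply: is_derive_eq.
  by rewrite /GRing.scale/= mulr1.
move=> [gr gi]; split; apply: E => //.
- exact: reZ.
- exact: reD.
- exact: imZ.
- exact: imD.
Qed.

(** This is strict differentiability: the mean value bound is applied to v -> f v - v f'(u), whose
    derivative on the segment is small because f' is continuous. The estimates start from e/4
    because comparing two values through [u0] doubles the error, and the mean value bound doubles it
    again. *)
Lemma increment_bound (f : K -> K) (A : set K) (u0 : K) (e : R) : open A ->
  smooth A f -> A u0 -> 0 < e ->
  \forall u \near u0 & k \near (0 : K),
    `|f (u + k) - f u - k * 'D_1 f u| <= i e * `|k| /\
    `|f (u + k) - f u| <= i e.
Proof.
move=> oA sf Au0 e0.
have cf := smooth_continuous sf Au0.
have cDf := smooth_continuous (smooth_derive (1 : K) sf) Au0.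
have e40 : 0 < i (e / 4) by rewrite -(rmorph0 i) lt_ofR divr_gt0.
have N1 := cvgr_dist_lt (FF := nbhs_filter u0) _ _ cf _ e40.
have N2 := cvgr_dist_lt (FF := nbhs_filter u0) _ _ cDf _ e40.
have : \forall v \near u0, [/\ A v, `|f u0 - f v| < i (e / 4) &
    `|'D_1 f u0 - 'D_1 f v| < i (e / 4)].
  near=> v; split.
  - by near: v; exact: open_nbhs_nbhs.
  - by near: v; exact: N1.
  - by near: v; exact: N2.
move=> /nbhs_ballP[d d0 H].
have d20 : 0 < d / 2 by rewrite divr_gt0.
have close v : ball u0 d v -> [/\ A v, `|f u0 - f v| <= i (e / 4) &
    `|'D_1 f u0 - 'D_1 f v| <= i (e / 4)].
  by move=> /H[? /ltW ? /ltW ?].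
near=> u k.
have ud : `|u0 - u| < d / 2.
  by have : ball u0 (d / 2) u by near: u; exact: nbhsx_ballx.
have kd : `|k| < d / 2.
  have : ball 0 (d / 2) k by near: k; exact: nbhsx_ballx.
  by rewrite -ball_normE/= sub0r normrN.
have seg t : t \in `[0, 1]%R -> ball u0 d (u + i t * k).
  rewrite in_itv/= => /andP[t0 t1]; rewrite -ball_normE/= opprD addrA.
  rewrite (le_lt_trans (ler_normB _ _))// (splitr d) ltrD//.
  apply: le_lt_trans kd; rewrite normrM norm_ofR (ger0_norm t0).
  rewrite -[leRHS]mul1r; apply: ler_wpM2r; rewrite ?normr_ge0//.
  by rewrite -(rmorph1 i) le_ofR.
have I0 : (0 : R) \in `[0, 1]%R by rewrite in_itv/= lexx ler01.
have I1 : (1 : R) \in `[0, 1]%R by rewrite in_itv/= lexx ler01.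
have [Au fu Du] : [/\ A u, `|f u0 - f u| <= i (e / 4) &
    `|'D_1 f u0 - 'D_1 f u| <= i (e / 4)].
  by apply: close; have := seg 0 I0; rewrite rmorph0 mul0r addr0.
have [_ fuk _] : [/\ A (u + k), `|f u0 - f (u + k)| <= i (e / 4) &
    `|'D_1 f u0 - 'D_1 f (u + k)| <= i (e / 4)].
  by apply: close; have := seg 1 I1; rewrite rmorph1 mul1r.
have two (a b x : K) : `|x - a| <= i (e / 4) -> `|x - b| <= i (e / 4) ->
    `|b - a| <= i (e / 2).
  move=> xa xb; have -> : b - a = (x - a) - (x - b) by ring.
  rewrite (le_trans (ler_normB _ _))//.
  have -> : e / 2 = e / 4 + e / 4 by field.
  by rewrite rmorphD lerD.
split; last first.
  by apply: le_trans (two _ _ _ fu fuk) _; rewrite le_ofR ler_pdivrMr// ler_pMr// ler1n.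
pose phi v := f v - v * 'D_1 f u.
pose g (t : R) := phi (u + i t * k).
have Ek : `|k| = i (re `|k|) by apply: ge0_ofR; exact: normr_ge0.
have : `|g 1 - g 0| <= i (2 * (re `|k| * (e / 2))).
  apply: (@path_mean_value g
    (fun t => k * ('D_1 f (u + i t * k) - 'D_1 f u))) => t tI.
    have [At _ _] := close _ (seg t tI).
    have df := smooth_differentiable sf At.
    have dl : differentiable (fun v : K => v * 'D_1 f u) (u + i t * k).
      by apply: differentiableM => //; exact: differentiable_cst.
    have dphi : differentiable phi (u + i t * k) by exact: differentiableB.
    have -> : 'D_1 f (u + i t * k) - 'D_1 f u = 'D_1 phi (u + i t * k).
      rewrite /phi (derive_fD (1 : K) df); last exact: differentiableN.
      rewrite (derive_fN (1 : K) dl) derive_fM//.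
      by rewrite derive_id derive_cst mul1r mulr0 addr0.
    exact: path_derive_segment.
  have [_ _ Dt] := close _ (seg t tI).
  rewrite normrM {1}Ek rmorphM ler_wpM2l//; first by rewrite -Ek normr_ge0.
  exact: two Du Dt.
rewrite /g /phi rmorph0 mul0r addr0 rmorph1 mul1r.
have -> : f (u + k) - (u + k) * 'D_1 f u - (f u - u * 'D_1 f u) =
  f (u + k) - f u - k * 'D_1 f u by ring.
have -> : 2 * (re `|k| * (e / 2)) = e * re `|k| by field.
by rewrite rmorphM -Ek.
Unshelve. all: by end_near. Qed.

Lemma segment_antiderivative (f : K -> K) (z0 z rho : K) :
  smooth (ball z0 rho) f -> ball z0 rho z ->
  exists G : R -> K, forall s : R, s \in `[0, 1]%R ->
    is_path_derive s G (f (z0 + i s * (z - z0)) * (z - z0)).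
Proof.
move=> sf Bz; pose clip (s : R) : R := Num.max 0 (Num.min s 1).
have clipI s : clip s \in `[0, 1]%R.
  by rewrite in_itv/= /clip le_max lexx/= ge_max ler01 ge_min lexx orbT.
have clip_id s : s \in `[0, 1]%R -> clip s = s.
  by rewrite in_itv/= /clip => /andP[s0 s1]; rewrite (min_idPl s1) (max_idPr s0).
have cclip : continuous clip.
  have c0 (a : R) : continuous (cst a : R -> R^o) by move=> ?; exact: cst_continuous.
  have cid : continuous (id : R -> R^o) by move=> x; exact: cvg_id.
  by move=> s; exact: (continuous_max (c0 0 s) (continuous_min (cid s) (c0 1 s))).
pose g s := f (z0 + i (clip s) * (z - z0)) * (z - z0).
have cg : continuous g.
  move=> s; apply: cvgM; last exact: cvg_cst.
  apply: (@cvg_comp _ _ _ (fun s => z0 + i (clip s) * (z - z0)) f _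
    (nbhs (z0 + i (clip s) * (z - z0)))).
    apply: cvgD; first exact: cvg_cst.
    apply: cvgM; last exact: cvg_cst.
    apply: (@cvg_comp _ _ _ clip i _ (nbhs (clip s))); first exact: cclip.
    exact: ofR_continuous.
  exact: (smooth_continuous sf (ball_segment Bz (clipI s))).
have [|P HP] := @continuous_antiderivative (re \o g).
  by move=> s; apply: continuous_comp; [exact: cg|exact: re_continuous].
have [|Q HQ] := @continuous_antiderivative (im \o g).
  by move=> s; apply: continuous_comp; [exact: cg|exact: im_continuous].
exists (fun s => i (P s) + iu c * i (Q s)) => s sI.
have -> : f (z0 + i s * (z - z0)) * (z - z0) = g s by rewrite /g clip_id.
split.
  have -> : re \o (fun s => i (P s) + iu c * i (Q s)) = P.
    by apply/funext => t /=; rewrite re_comb.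
  exact: HP.
have -> : im \o (fun s => i (P s) + iu c * i (Q s)) = (fun t => im (iu c)) * Q.
  by apply/funext => t /=; rewrite im_comb.
have := HQ s sI => HQs.
(* The factor [im (iu c)] is 0 over R, where the imaginary part vanishes as well, and 1 over the
   complex numbers. *)
rewrite [im (g s)]im_iu; apply: is_derive_eq.
by rewrite /GRing.scale/= mulr0 addr0.
Qed.

(** Compactness of the unit interval turns the local [increment_bound] into one that is uniform
    along the segment from [z0] to [z]; the perturbed point runs over the segment from [z0] to
    [z + h]. *)
Lemma segment_increment_bound (f : K -> K) (z0 z rho : K) (e : R) :
  smooth (ball z0 rho) f -> ball z0 rho z -> 0 < e ->
  \forall h \near (0 : K), forall s : R, s \in `[0, 1]%R ->
    let u := z0 + i s * (z - z0) in
    `|f (u + i s * h) - f u - i s * h * 'D_1 f u| <= i e * `|i s * h| /\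
    `|f (u + i s * h) - f u| <= i e.
Proof.
move=> sf Bz e0; pose u (s : R) := z0 + i s * (z - z0).
have cu : continuous u.
  move=> s; apply: cvgD; first exact: cvg_cst.
  by apply: cvgM; [exact: ofR_continuous|exact: cvg_cst].
have [/(_ (@segment_compact _ (0 : R) 1)) cov _] :=
  compact_near_coveringP (`[0%R, 1%R] : set R).
have := cov K (nbhs (0 : K)) (fun h s =>
    `|f (u s + i s * h) - f (u s) - i s * h * 'D_1 f (u s)| <= i e * `|i s * h| /\
    `|f (u s + i s * h) - f (u s)| <= i e) _.
apply=> s sI.
have [[P Q] /= [nP nQ] PQ] :=
  increment_bound (ball_open _ _) sf (ball_segment Bz sI) e0.
have nP' : \forall t \near s, P (u t) by exact: cu.
have nQ' : \forall p \near (s, (0 : K)), Q (i p.1 * p.2).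
  have : (fun p : R * K => i p.1 * p.2) @ (s, (0 : K)) --> i s * (0 : K).
    apply: cvgM; last exact: cvg_snd.
    by apply: cvg_comp; [exact: cvg_fst|exact: ofR_continuous].
  by apply; rewrite mulr0.
have nPQ : \forall p \near (s, (0 : K)), P (u p.1) /\ Q (i p.1 * p.2).
  have c1 : (fun p : R * K => p.1) @ (s, (0 : K)) --> s by exact: cvg_fst.
  by apply: filterI => //; exact: c1 _ nP'.
apply: filterS nPQ => -[t h] /= [Pt Qh].
exact: (PQ (u t, i t * h)).
Qed.

(** The primitive is the integral of f over the segment from [z0]. With u(s) the point of the
    segment to z and w = z - z0, the function s h f(u(s)) has s-derivative h f(u(s)) + s h w
    f'(u(s)), which is exactly the first-order part in h of the difference of the integrands for z +
    h and z. Its increment is h f(z), so f(z) is the derivative; this replaces the integral theorem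
    for a triangle. *)
Lemma smooth_primitive (f : K -> K) (z0 rho : K) : smooth (ball z0 rho) f ->
  exists F : K -> K, smooth (ball z0 rho) F /\
    forall z, ball z0 rho z -> 'D_1 F z = f z.
Proof.
move=> sf.
have /choice[G HG] : forall z, exists G : R -> K, ball z0 rho z ->
    forall s : R, s \in `[0, 1]%R ->
    is_path_derive s G (f (z0 + i s * (z - z0)) * (z - z0)).
  move=> z; have [Bz|nB] := pselect (ball z0 rho z); last by exists (fun=> 0).
  by have [G GP] := segment_antiderivative sf Bz; exists G.
pose F z := G z 1 - G z 0.
suff D z : ball z0 rho z -> differentiable F z /\ 'D_1 F z = f z.
  exists F; split; last by move=> z /D[].
  case=> [|n]; first by move=> z /D[dF _]; exact: differentiable_continuous.
  split=> [z /D[]//|v].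
  have sv : smooth (ball z0 rho) (fun z => v * f z).
    by apply: smoothM => //; [exact: ball_open|apply: smooth_cst; exact: ball_open].
  apply: times_differentiable_eq (sv n); first exact: ball_open.
  move=> z /D[dF <-]; rewrite !deriveE//.
  have -> : 'd F z v = 'd F z (v *: (1 : K)) by rewrite /GRing.scale/= mulr1.
  by rewrite linearZ.
move=> Bz.
suff L : (fun h => h^-1 *: (F (h *: (1 : K) + z) - F z)) @ 0^' --> f z.
  have dF : derivable F z 1 by apply/cvg_ex; exists (f z).
  by split; [exact/derivable1_diffP|exact: cvg_lim].
apply/(@cvgrPdist_le _ _ _ _ (dnbhs_filter (0 : K))) => e' /gt0_ofR[].
set e := re e' => e0 ->.
pose w := z - z0; pose M := 1 + re `|w|.
have nre (x : K) : `|x| = i (re `|x|) by apply: ge0_ofR; exact: normr_ge0.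
have M0 : 0 < M by rewrite ltr_pwDl// -(le_ofR c) rmorph0 -nre.
(* The remaining integrand is at most d |h| (|w| + 1) = d |h| M, and the mean value bound doubles
   it; so d M = e/2 yields e |h|. *)
have [d d0 dM] : exists2 d, 0 < d & d * M = e / 2.
  by exists (e / 2 / M); [rewrite !divr_gt0|rewrite divfK// gt_eqF].
have Bn : \forall h \near (0 : K), ball z0 rho (h + z).
  have : (fun h : K => h + z) @ 0 --> 0 + z.
    have c0 : id @ nbhs (0 : K) --> (0 : K) by exact: cvg_id.
    exact: cvgD c0 (cvg_cst z).
  have nz : nbhs (0 + z) (ball z0 rho).
    by rewrite add0r; apply: open_nbhs_nbhs; split=> //; exact: ball_open.
  by move=> /(_ _ nz).
have := segment_increment_bound sf Bz d0 => Nb.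
near=> h.
have h0 : h != 0 by near: h; exact: nbhs_dnbhs_neq.
have Bh : ball z0 rho (h + z) by near: h; exact: nbhs_dnbhs.
have Hb : forall s : R, s \in `[0, 1]%R ->
    let u := z0 + i s * (z - z0) in
    `|f (u + i s * h) - f u - i s * h * 'D_1 f u| <= i d * `|i s * h| /\
    `|f (u + i s * h) - f u| <= i d.
  by near: h; exact: nbhs_dnbhs.
rewrite [h *: (1 : K)]mulr1.
have -> : f z - h^-1 *: (F (h + z) - F z) =
    - (h^-1 * (F (h + z) - F z - h * f z)).
  by rewrite /GRing.scale/=; field.
rewrite normrN normrM normfV mulrC ler_pdivrMr ?normr_gt0//.
pose u s := z0 + i s * w.
pose g s := (G (h + z) s - G z s) - i s * (h * f (u s)).
have -> : F (h + z) - F z - h * f z = g 1 - g 0.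
  (* At s = 0 the correction term vanishes, and at s = 1 the point u(1) is z. *)
  rewrite /g /F /u !rmorph0 !rmorph1 !mul0r !mul1r /w (addrC z0) subrK; ring.
have -> : i e * `|h| = i (2 * (re `|h| * (d * M))).
  by rewrite [X in _ * X = _]nre -rmorphM; congr (i _); rewrite dM; field.
apply: (@path_mean_value g (fun s => f (z0 + i s * (h + z - z0)) * (h + z - z0)
   - f (u s) * w - (i s * (w * (h * 'D_1 f (u s))) + h * f (u s)))) => s sI.
  apply: path_deriveB.
    by apply: path_deriveB; exact: HG.
  apply: (path_derive_ofRM (g := fun s => h * f (u s))).
  have df := smooth_differentiable sf (ball_segment Bz sI).
  have dc : differentiable (fun _ : K => h) (z0 + i s * (z - z0)).
    exact: differentiable_cst.
  have -> : h * 'D_1 f (u s) = 'D_1 (fun v => h * f v) (u s).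
    by rewrite derive_fM// derive_cst mul0r add0r.
  apply: (path_derive_segment (f := fun v => h * f v)).
  exact: differentiableM.
have [b1 b2] := Hb s sI.
have -> : f (z0 + i s * (h + z - z0)) * (h + z - z0) - f (u s) * w -
    (i s * (w * (h * 'D_1 f (u s))) + h * f (u s)) =
  (f (u s + i s * h) - f (u s) - i s * h * 'D_1 f (u s)) * w +
    h * (f (u s + i s * h) - f (u s)).
  have -> : z0 + i s * (h + z - z0) = u s + i s * h by rewrite /u /w; ring.
  by rewrite /w; ring.
apply: le_trans (ler_normD _ _) _; rewrite !normrM.
have -> : re `|h| * (d * M) = d * re `|h| * re `|w| + re `|h| * d.
  by rewrite /M; ring.
rewrite rmorphD !rmorphM -!nre; apply: lerD; last by apply: ler_wpM2l; [exact: normr_ge0|exact: b2].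
apply: ler_wpM2r; first exact: normr_ge0.
apply: le_trans b1 _; rewrite normrM.
move: sI; rewrite in_itv/= => /andP[s0 s1].
apply: ler_wpM2l; first by rewrite -(rmorph0 i) le_ofR ltW.
rewrite norm_ofR (ger0_norm s0) -[leRHS]mul1r; apply: ler_wpM2r; first exact: normr_ge0.
by rewrite -(rmorph1 i) le_ofR.
Unshelve. all: by end_near. Qed.

End Coordinates.

Definition real_coordinates (R : realType) : coordinates R R.
Proof.
refine (@Coordinates R R idfun id (fun=> 0) 0 _ _ _ _ _ _ _ _ _ _ _ _ _ _);
  rewrite /=.
- by move=> z; rewrite mul0r addr0.
- by [].
- by move=> y z; rewrite addr0.
- by [].
- by move=> s z; rewrite mulr0.
- by move=> a b; rewrite mul0r addr0.
- by move=> a b; rewrite mul0r.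
- by move=> z; rewrite mul0r.
- by [].
- by [].
- by [].
- by move=> z; rewrite normr0.
- by rewrite normr0.
- by [].
Defined.

Definition complex_coordinates (R : realType) :
  coordinates R (R[i] : numFieldType).
Proof.
have norm_coord (a b : R) : `|a| <= Num.sqrt (a ^+ 2 + b ^+ 2).
  by rewrite -sqrtr_sqr ler_sqrt ?lerDl ?sqr_ge0// addr_ge0 ?sqr_ge0.
refine (@Coordinates R R[i] (real_complex R) (@complex.Re R) (@complex.Im R)
  'i%C _ _ _ _ _ _ _ _ _ _ _ _ _ _).
- exact: complexE.
- by case=> ? ? [].
- by case=> ? ? [].
- by move=> s [a b] /=; rewrite mul0r subr0.
- by move=> s [a b] /=; rewrite mul0r addr0.
- by move=> a b /=; rewrite !mul0r !mul1r subr0 addr0.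
- by move=> a b /=; rewrite !mul0r !mul1r !add0r.
- by move=> z /=; rewrite mul1r.
- by move=> a b; rewrite lecR.
- by move=> a; rewrite normc_def /= expr0n addr0 sqrtr_sqr.
- by case=> a b; rewrite normc_def lecR.
- by case=> a b; rewrite normc_def lecR /= addrC.
- by rewrite normc_def /= expr0n expr1n add0r sqrtr1.
- by move=> z z0; apply/esym/RRe_real; rewrite ger0_real.
Defined.

Definition scalars_coordinates (R : realType) (F : ground_field) :
  coordinates R (scalars R F) :=
  match F with
  | RealNumbers => real_coordinates R
  | ComplexNumbers => complex_coordinates R
  end.

(** * Jets and prolongation *)

Section MatrixCoordinates.
Variable K : numFieldType.

Lemma coord_linear m n i j : linear (fun N : 'M[K]_(m, n) => N i j : K).
Proof. by move=> a u v; rewrite !mxE. Qed.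

Lemma smooth_coord m n (U : set 'M[K]_(m, n)) i j : open U ->
  smooth U (fun N : 'M[K]_(m, n) => N i j : K).
Proof.
move=> oU; pose M := GRing.isLinear.Build _ _ _ _ _ (@coord_linear m n i j).
pose L : {linear 'M[K]_(m, n) -> K} :=
  HB.pack (fun N : 'M[K]_(m, n) => N i j : K) M.
by apply: (@smooth_lin K _ _ U L) => //; exact: coord_continuous.
Qed.

Lemma derive_coord m n (p v : 'M[K]_(m, n)) i j :
  'D_v (fun N : 'M[K]_(m, n) => N i j : K) p = v i j.
Proof.
pose M := GRing.isLinear.Build _ _ _ _ _ (@coord_linear m n i j).
pose L : {linear 'M[K]_(m, n) -> K} :=
  HB.pack (fun N : 'M[K]_(m, n) => N i j : K) M.
by apply: (@derive_linear K _ _ L); exact: coord_continuous.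
Qed.

Lemma row_linear_continuous n (W : normedModType K) (f : {linear 'rV[K]_n -> W}) :
  continuous f.
Proof.
have -> : (f : 'rV[K]_n -> W) =
    fun v => \sum_j v 0 j *: f (delta_mx 0 j).
  apply/funext => v; rewrite {1}(row_sum_delta v) linear_sum.
  by under eq_bigr do rewrite linearZ.
move=> v; have sf : smooth (V := 'rV[K]_n) setT
    (fun v => \sum_j v 0 j *: f (delta_mx 0 j)).
  apply: smooth_sum => [|j]; first exact: openT.
  apply: smoothZ; [exact: openT|apply: smooth_coord; exact: openT|].
  by apply: smooth_cst; exact: openT.
exact: (smooth_continuous sf).
Qed.

Lemma row_smooth (V : normedModType K) n (U : set V) (f : V -> 'rV[K]_n) : open U ->
  (forall j, smooth U (fun p => f p 0 j)) -> smooth U f.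
Proof.
move=> oU sf.
have -> : f = fun p => \sum_j f p 0 j *: delta_mx 0 j.
  by apply/funext => v; rewrite -row_sum_delta.
apply: smooth_sum => // j; apply: smoothZ => //; exact: smooth_cst.
Qed.

End MatrixCoordinates.

Section Jets.
Variables (K : numFieldType) (r : nat).
Local Notation jet := (jet K r).
Local Notation plane := (plane K).
Implicit Types (z v : jet) (f g : jet -> K) (O : set jet).

Definition e_t : jet := delta_mx 0 ord0.
(** [inord] sends an index beyond r to the coordinate t, so the evaluation rules below carry bounds
    such as [k <= r]. *)
Definition e_x (k : nat) : jet := delta_mx 0 (inord k.+1).
Definition pt : plane := (1, 0).
Definition px : plane := (0, 1).

Lemma jt_e_t : jt e_t = 1. Proof. by rewrite /jt mxE !eqxx. Qed.

Lemma jx_e_t k : (k <= r)%N -> jx e_t k = 0.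
Proof.
by move=> kr; rewrite /jx mxE eqxx -val_eqE/= inordK//= ltnS.
Qed.

Lemma jt_e_x k : (k <= r)%N -> jt (e_x k) = 0.
Proof. by move=> kr; rewrite /jt mxE eqxx -val_eqE/= inordK//= ltnS. Qed.

Lemma jx_e_x j k : (j <= r)%N -> (k <= r)%N -> jx (e_x k) j = (j == k)%:R.
Proof. by move=> jr kr; rewrite /jx mxE eqxx -val_eqE/= !inordK//= ltnS. Qed.

Lemma jtD z v : jt (z + v) = jt z + jt v. Proof. by rewrite /jt mxE. Qed.
Lemma jtZ a z : jt (a *: z) = a * jt z. Proof. by rewrite /jt mxE. Qed.
Lemma jxD z v k : jx (z + v) k = jx z k + jx v k. Proof. by rewrite /jx mxE. Qed.
Lemma jxZ a z k : jx (a *: z) k = a * jx z k. Proof. by rewrite /jx mxE. Qed.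

Lemma jetP z v : jt z = jt v -> (forall k, (k <= r)%N -> jx z k = jx v k) -> z = v.
Proof.
move=> E H; apply/rowP => i; case: (unliftP ord0 i) => [j ->|->//].
have := H j; rewrite -ltnS ltn_ord /jx => /(_ isT).
by have -> : inord j.+1 = lift ord0 j by apply/val_inj; rewrite /= inordK// ltnS ltn_ord.
Qed.

Lemma base_linear : linear (@base K r).
Proof. by move=> a u v; rewrite /base jtD jtZ jxD jxZ. Qed.

Definition baseL : {linear jet -> plane} :=
  HB.pack (@base K r) (GRing.isLinear.Build _ _ _ _ _ base_linear).

Lemma base_continuous : continuous (@base K r).
Proof. exact: (@row_linear_continuous K _ _ baseL). Qed.

Definition over (U : set plane) : set jet := @base K r @^-1` U.

Lemma open_over U : open U -> open (over U).
Proof. by move=> oU; apply: open_comp => // z _; exact: base_continuous. Qed.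

Lemma smooth_jt O : open O -> smooth O (@jt K r).
Proof. exact: smooth_coord. Qed.

Lemma smooth_jx O k : open O -> smooth O (fun z => jx z k).
Proof. exact: smooth_coord. Qed.

Lemma smooth_base U (T : plane -> K) : open U -> smooth U T ->
  smooth (over U) (fun z => T (base z)).
Proof.
by move=> oU sT; exact: (@smooth_precomp_lin K _ _ _ U baseL T oU base_continuous sT).
Qed.

Lemma differentiable_base (T : plane -> K) z : differentiable T (base z) ->
  differentiable (fun z => T (base z)) z.
Proof.
move=> dT; apply: (differentiable_comp _ dT).
exact: (@linear_differentiable _ _ _ baseL z base_continuous).
Qed.

Lemma derive_base (T : plane -> K) z v : differentiable T (base z) ->
  'D_v (fun z => T (base z)) z = 'D_(base v) T (base z).
Proof. exact: (@derive_lin K _ _ _ baseL T z v base_continuous). Qed.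

(** At each jet the total derivative is the directional derivative along this vector, whose
    x_r-component is zero; the Leibniz and chain rules are thereby inherited from directional
    derivatives. *)
Definition vD z : jet := e_t + \sum_(k < r) jx z k.+1 *: e_x k.

Lemma tdE f z : differentiable f z -> total_derivative f z = 'D_(vD z) f z.
Proof.
move=> df; rewrite /total_derivative /vD !deriveE// linearD linear_sum.
by congr (_ + _); apply: eq_bigr => k _; rewrite linearZ deriveE.
Qed.

Lemma smooth_td O f : open O -> smooth O f -> smooth O (total_derivative f).
Proof.
move=> oO sf; rewrite /total_derivative; apply: smoothD => //.
  exact: smooth_derive.
apply: smooth_sum => // k; apply: smoothM => //; first exact: smooth_jx.
exact: smooth_derive.
Qed.

Lemma td_eq O f g z : open O -> O z -> (forall y, O y -> f y = g y) ->
  total_derivative f z = total_derivative g z.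
Proof.
move=> oO Oz fg; rewrite /total_derivative.
have N : \forall y \near z, f y = g y by exact: open_near Oz _.
congr (_ + _); first exact: near_eq_derive.
by apply: eq_bigr => k _; congr (_ * _); exact: near_eq_derive.
Qed.

Lemma tdD f g z : differentiable f z -> differentiable g z ->
  total_derivative (fun y => f y + g y) z =
  total_derivative f z + total_derivative g z.
Proof.
by move=> df dg; rewrite !tdE ?derive_fD//; exact: differentiableD.
Qed.

Lemma tdM f g z : differentiable f z -> differentiable g z ->
  total_derivative (fun y => f y * g y) z =
  total_derivative f z * g z + f z * total_derivative g z.
Proof.
by move=> df dg; rewrite !tdE ?derive_fM//; exact: differentiableM.
Qed.

Lemma tdN f z : differentiable f z ->
  total_derivative (fun y => - f y) z = - total_derivative f z.
Proof. by move=> df; rewrite !tdE ?derive_fN//; exact: differentiableN. Qed.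

Lemma tdV f z : differentiable f z -> f z != 0 ->
  total_derivative (fun y => (f y)^-1) z = - (total_derivative f z / f z ^+ 2).
Proof.
by move=> df f0; rewrite !tdE ?derive_fV//; exact: differentiableV.
Qed.

Lemma td_cst (a : K) z : total_derivative (fun _ => a) z = 0.
Proof. by rewrite tdE ?derive_cst//; exact: differentiable_cst. Qed.

Lemma differentiable_fsum (V : normedModType K) n (f : 'I_n -> V -> K) (z : V) :
  (forall k, differentiable (f k) z) ->
  differentiable (fun y => \sum_(k < n) f k y) z.
Proof.
move=> df; have -> : (fun y => \sum_(k < n) f k y) = \sum_(k < n) f k.
  by apply/funext => y; rewrite fct_sumE.
exact: differentiable_sum.
Qed.

Lemma td_sum n (f : 'I_n -> jet -> K) z : (forall k, differentiable (f k) z) ->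
  total_derivative (fun y => \sum_(k < n) f k y) z =
  \sum_(k < n) total_derivative (f k) z.
Proof.
move=> df; elim: n f df => [|n IH] f df.
  by rewrite big_ord0; under eq_fun do rewrite big_ord0; exact: td_cst.
under eq_fun do rewrite big_ord_recr/=.
rewrite tdD//; last exact: differentiable_fsum.
by rewrite IH// big_ord_recr.
Qed.

(** The unit t-component is what makes the total derivative of a function of t its ordinary
    derivative. *)
Lemma jt_vD z : jt (vD z) = 1.
Proof.
rewrite /vD jtD jt_e_t.
rewrite /jt summxE big1 ?addr0// => k _.
by rewrite mxE -[e_x k 0 ord0]/(jt _) jt_e_x ?mulr0// ltnW.
Qed.

Lemma jx_vD z k : (k < r)%N -> jx (vD z) k = jx z k.+1.
Proof.
move=> kr; rewrite /vD jxD jx_e_t ?add0r; last exact: ltnW.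
rewrite /jx summxE (bigD1 (Ordinal kr))//= big1 => [|j jk].
  by rewrite mxE -/(jx _ k) jx_e_x ?eqxx ?mulr1 ?addr0// ltnW.
rewrite mxE -/(jx _ k) jx_e_x; [|exact: ltnW|exact: ltnW (ltn_ord j)].
by move: jk; rewrite -val_eqE/= eq_sym => /negPf ->; rewrite mulr0.
Qed.

Lemma differentiable_jx z k : differentiable (fun z => jx z k) z.
Proof. exact: differentiable_coord. Qed.

Lemma td_jx z k : (k < r)%N -> total_derivative (fun z => jx z k) z = jx z k.+1.
Proof.
move=> kr; rewrite tdE; last exact: differentiable_jx.
by rewrite derive_coord -[LHS]/(jx (vD z) k) jx_vD.
Qed.

Lemma base_vD z : (0 < r)%N -> base (vD z) = (1, jx z 1).
Proof. by move=> r0; rewrite /base jt_vD jx_vD. Qed.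

Lemma td_base (T : plane -> K) z : (0 < r)%N -> differentiable T (base z) ->
  total_derivative (fun z => T (base z)) z =
  'D_pt T (base z) + jx z 1 * 'D_px T (base z).
Proof.
move=> r0 dT; rewrite tdE; last exact: differentiable_base.
rewrite derive_base// base_vD//.
have -> : (1, jx z 1) = jx z 1 *: px + pt :> plane.
  by congr (_, _); rewrite /= /GRing.scale/= ?mulr0 ?mulr1 ?add0r ?addr0.
by rewrite deriveDv// addrC.
Qed.

Lemma differentiable_jt (f : K -> K) z : differentiable f (jt z) ->
  differentiable (fun z => f (jt z)) z.
Proof.
by move=> df; apply: (differentiable_comp _ df); exact: differentiable_coord.
Qed.

Lemma td_jt (f : K -> K) z : differentiable f (jt z) ->
  total_derivative (fun z => f (jt z)) z = 'D_1 f (jt z).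
Proof.
move=> df; rewrite tdE; last exact: differentiable_jt.
rewrite (derive_comp1 _ _ df); last exact: differentiable_coord.
by rewrite /jt derive_coord -/(jt _) jt_vD scale1r.
Qed.

End Jets.

(** * Prolonged derivatives and their numerators *)

Section Prolongation.
Variables (K : numFieldType) (r : nat).
Local Notation jet := (jet K r).
Local Notation plane := (plane K).
Implicit Types (z v : jet) (U : set plane).

Definition mkjet (t : K) (x : nat -> K) : jet :=
  \row_(i < r.+2) (if nat_of_ord i is k.+1 then x k else t).

Lemma jt_mkjet t x : jt (mkjet t x) = t.
Proof. by rewrite /jt mxE. Qed.

Lemma jx_mkjet t x k : (k <= r)%N -> jx (mkjet t x) k = x k.
Proof. by move=> kr; rewrite /jx mxE inordK// ltnS. Qed.

Lemma jt_prolongation T X z : jt (prolongation T X z) = T (base z).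
Proof. by rewrite /jt mxE. Qed.

Lemma jx_prolongation T X z k : (k <= r)%N ->
  jx (prolongation T X z) k = prolonged_derivative T X k z.
Proof. by move=> kr; rewrite /jx mxE inordK// ltnS. Qed.

Lemma prolonged_derivativeS T X k z : prolonged_derivative T X k.+1 z =
  total_derivative (prolonged_derivative T X k) z / DT T z.
Proof. reflexivity. Qed.

Section Smoothness.
Variables (U : set plane) (T X : plane -> K).
Hypotheses (r0 : (0 < r)%N) (oU : open U) (sT : smooth U T) (sX : smooth U X).

Lemma smooth_DT : smooth (over U) (DT T : jet -> K).
Proof. by apply: smooth_td; [exact: open_over|exact: smooth_base]. Qed.

Lemma DTE z : U (base z) ->
  DT T z = 'D_(pt K) T (base z) + jx z 1 * 'D_(px K) T (base z).
Proof. by move=> Uz; apply: td_base => //; exact: smooth_differentiable sT Uz. Qed.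

Definition regular : set jet := over U `&` [set z | DT T z != 0].

Lemma open_neq0 (V : normedModType K) (O : set V) (f : V -> K) :
  open O -> smooth O f -> open (O `&` [set z | f z != 0]).
Proof.
move=> oO sf; rewrite openE => z [Oz fz]; apply: filterI; first exact: open_nbhs_nbhs.
have cf := smooth_continuous sf Oz.
have : \forall y \near f z, y != 0.
  apply/nbhs_ballP; exists `|f z|; first by rewrite /= normr_gt0.
  by move=> y; rewrite -ball_normE/=; apply: contraTneq => ->; rewrite subr0 ltxx.
by move/cf.
Qed.

Lemma open_regular : open regular.
Proof. by apply: open_neq0; [exact: open_over|exact: smooth_DT]. Qed.

Lemma smooth_prolonged_derivative k :
  smooth regular (prolonged_derivative T X k).
Proof.
have oR := open_regular.
have sub : regular `<=` over U by move=> z [].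
elim: k => [|k IH]; first by apply: (smooth_sub sub); exact: smooth_base oU sX.
apply: smoothM => //; first exact: smooth_td.
by apply: smoothV => //; [move=> z []|exact: smooth_sub sub smooth_DT].
Qed.

Lemma smooth_prolongation : smooth regular (prolongation T X).
Proof.
have oR := open_regular.
apply: row_smooth => // j; rewrite /prolongation.
under eq_fun do rewrite mxE.
case: (nat_of_ord j) => [|k]; last exact: smooth_prolonged_derivative.
have sub : regular `<=` over U by move=> z [].
by apply: (smooth_sub sub); exact: smooth_base oU sT.
Qed.

Lemma tdX (f : jet -> K) n z : differentiable f z ->
  total_derivative (fun y => f y ^+ n) z = n%:R * f z ^+ n.-1 * total_derivative f z.
Proof.
move=> df; have dX m : differentiable (fun y => f y ^+ m) z.
  elim: m => [|m IH]; first exact: differentiable_cst.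
  by under eq_fun do rewrite exprS; exact: differentiableM.
elim: n => [|n IH]; first by rewrite !mul0r; exact: td_cst.
under eq_fun do rewrite exprS.
rewrite tdM// IH; case: n {IH} => [|n] /=; first by rewrite !expr0; ring.
by rewrite !exprS (_ : n.+2%:R = 1 + n.+1%:R) ?natr1// 1?addrC ?natr1//; ring.
Qed.

(** The (k+1)-th prolonged derivative is this function over [DT] to the power 2k + 1: the quotient
    rule and the further division by [DT] raise the exponent by two. Unlike the derivatives, the
    numerators remain smooth where [DT] vanishes. *)
Fixpoint numerator k : jet -> K :=
  match k with
  | 0 => total_derivative (fun z => X (base z))
  | m.+1 => fun z => total_derivative (numerator m) z * DT T z -
      m.*2.+1%:R * numerator m z * total_derivative (DT T) z
  end.

Lemma smooth_numerator k : smooth (over U) (numerator k).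
Proof.
have oO := @open_over K r _ oU; have sD := smooth_DT.
elim: k => [|k IH] /=; first by apply: smooth_td => //; exact: smooth_base.
apply: smoothB => //; apply: smoothM => //; try exact: smooth_td.
by apply: smoothM => //; exact: smooth_cst.
Qed.

Lemma prolonged_derivative_numerator k z : regular z ->
  prolonged_derivative T X k.+1 z = numerator k z / DT T z ^+ k.*2.+1.
Proof.
elim: k z => [|k IH] z Rz; first by rewrite expr1.
have [Uz D0] := Rz.
have dn := smooth_differentiable (smooth_numerator k) Uz.
have dD := smooth_differentiable smooth_DT Uz.
have dDX : differentiable (fun y => DT T y ^+ k.*2.+1) z.
  exact: smooth_differentiable (smoothX _ (open_over oU) smooth_DT) Uz.
have DX0 : DT T z ^+ k.*2.+1 != 0 by rewrite expf_neq0.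
rewrite prolonged_derivativeS.
rewrite (@td_eq _ _ regular _ (fun y => numerator k y * (DT T y ^+ k.*2.+1)^-1))//;
  [|exact: open_regular].
rewrite tdM//; last exact: differentiableV.
rewrite tdV// tdX//= doubleS.
rewrite !exprS; field; rewrite D0 /=; by rewrite expf_neq0.
Qed.

(** Where [DT] vanishes only the second term of the recursion survives, so the numerators are
    explicit there and can be shown to be nonzero. *)
Lemma numerator_at_zero k z : over U z -> DT T z = 0 ->
  numerator k z = \prod_(j < k) (- j.*2.+1%:R) *
    numerator 0 z * total_derivative (DT T) z ^+ k.
Proof.
move=> Uz D0; elim: k => [|k IH]; first by rewrite big_ord0 mul1r expr0 mulr1.
rewrite big_ord_recr/= D0 mulr0 add0r [numerator k z]IH exprS/=; ring.
Qed.

End Smoothness.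
End Prolongation.

(** * Preservation of the fibres t = const *)

Section Equations.
Variables (K : numFieldType) (r : nat).
Local Notation jet := (jet K r).
Local Notation plane := (plane K).
Implicit Types (z v : jet) (th : arbval K r) (E : equation K r).

Definition linear_part th z : K :=
  jx z r + \sum_(k < r - 2) av_a th k * jx z k.

Lemma linear_partD th z v :
  linear_part th (z + v) = linear_part th z + linear_part th v.
Proof.
rewrite /linear_part jxD; under eq_bigr do rewrite jxD mulrDr.
by rewrite big_split/= addrACA.
Qed.

Lemma linear_partZ th a z : linear_part th (a *: z) = a * linear_part th z.
Proof.
rewrite /linear_part jxZ; under eq_bigr do rewrite jxZ mulrCA.
by rewrite -mulr_sumr -mulrDr.
Qed.

Lemma linear_part_e_x th (j : nat) : (r - 2 <= j)%N -> (j <= r)%N ->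
  linear_part th (e_x K r j) = (r == j)%:R.
Proof.
move=> rj jr; rewrite /linear_part jx_e_x// big1 ?addr0// => k _.
have kj : (k < j)%N by exact: leq_trans rj.
by rewrite jx_e_x// ?(ltn_eqF kj) ?mulr0//; exact: leq_trans (ltnW kj) jr.
Qed.

Lemma linear_part_e_top th : linear_part th (e_x K r r) = 1.
Proof. by rewrite linear_part_e_x ?eqxx// leq_subr. Qed.

(** Correcting x_r alone leaves t and all lower coordinates free to be prescribed. *)
Definition onto_equation th z : jet :=
  z + (av_b th - linear_part th z) *: e_x K r r.

Lemma onto_equationP th z : Defs.eq_holds th (onto_equation th z).
Proof.
rewrite /Defs.eq_holds -/(linear_part th _) linear_partD linear_partZ.
by rewrite linear_part_e_top mulr1 addrC subrK.
Qed.

Lemma jt_onto_equation th z : jt (onto_equation th z) = jt z.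
Proof. by rewrite jtD jtZ jt_e_x// mulr0 addr0. Qed.

Lemma jx_onto_equation th z j : (j < r)%N ->
  jx (onto_equation th z) j = jx z j.
Proof.
move=> jr; rewrite jxD jxZ jx_e_x ?(ltn_eqF jr)//; last exact: ltnW.
by rewrite mulr0 addr0.
Qed.

(** The x_r-component is corrected so that the linear part of the equation vanishes on the vector;
    moving along it keeps a jet on the equation, as long as t is fixed. *)
Definition tangent th v : jet := v - linear_part th v *: e_x K r r.

Lemma tangentP th z v s : Defs.eq_holds th z -> Defs.eq_holds th (z + s *: tangent th v).
Proof.
rewrite /Defs.eq_holds -!/(linear_part th _) => Ez.
rewrite linear_partD linear_partZ linear_partD -scaleNr linear_partZ.
by rewrite linear_part_e_top mulr1 subrr mulr0 addr0.
Qed.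

Lemma jt_tangent th v : jt (tangent th v) = jt v.
Proof. by rewrite /tangent -scaleNr jtD jtZ jt_e_x// mulr0 addr0. Qed.

Lemma jx_tangent th v j : (j < r)%N -> jx (tangent th v) j = jx v j.
Proof.
move=> jr; rewrite /tangent -scaleNr jxD jxZ jx_e_x ?(ltn_eqF jr)//; last exact: ltnW.
by rewrite mulr0 addr0.
Qed.

Lemma av_a_arb E t k : av_a (arb E t) k = coef E k t.
Proof. by rewrite /av_a /arb row_mxEl mxE. Qed.

Lemma av_b_arb E t : av_b (arb E t) = rhs E t.
Proof. by rewrite /av_b /arb row_mxEr mxE. Qed.

Lemma jet_line_continuous z v : continuous (fun s : K => z + s *: v).
Proof.
move=> s; have cv : (fun s : K => s *: v) @ s --> s *: v.
  exact: scalel_continuous.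
exact: cvgD (cvg_cst z) cv.
Qed.

Lemma jt_line z v s : jt v = 0 -> jt (z + s *: v) = jt z.
Proof. by move=> v0; rewrite jtD jtZ v0 mulr0 addr0. Qed.

Lemma base_line z v s : jt v = 0 -> jx v 0 = 0 -> base (z + s *: v) = base z.
Proof.
by move=> v0 w0; rewrite /base jt_line// jxD jxZ w0 mulr0 addr0.
Qed.

End Equations.

Section Fibre.
Variables (K : numFieldType) (r : nat).
Hypothesis r3 : (3 <= r)%N.
Variables (U : set (plane K)) (T X : plane K -> K) (E E' : equation K r).
Local Notation jet := (jet K r).

(* Otherwise some x_1 makes DT vanish over p. As r >= 3, the coordinate x_2 is
   free and can be chosen so that D(DT) = 1. Clearing the denominators in the
   image equation and approaching this point leaves only the numerator of the
   r-th derivative, which is nonzero there. *)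
Lemma admissible_derive_x : admissible T X U E E' ->
  forall p, U p -> 'D_(px K) T p = 0.
Proof.
move=> [[[oU _ _ _] sT sX J0] [domU eqU]] p Up; apply/eqP/negPn/negP => Tx0.
have r0 : (0 < r)%N by exact: leq_trans r3.
have r1 : (1 < r)%N by exact: leq_trans r3.
pose A := 'D_(pt K) T; pose B := 'D_(px K) T.
have sA : smooth U A by exact: smooth_derive.
have sB : smooth U B by exact: smooth_derive.
have Bp0 : B p != 0 by [].
pose th := arb E p.1.
pose x1 := - A p / B p.
(* [x1] is the root of T_t + x_1 T_x, and [c2] collects the terms of D(DT) that are free of x_2.
   Since D(DT) = c2 + x_2 T_x, the value of x_2 below makes it 1. *)
pose c2 := ('D_(pt K) A p + x1 * 'D_(px K) A p) +
  x1 * ('D_(pt K) B p + x1 * 'D_(px K) B p).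
pose x (k : nat) : K := match k with
  | 0 => p.2 | 1 => x1 | 2 => (1 - c2) / B p | _ => 0 end.
pose z0 : jet := onto_equation th (mkjet r p.1 x).
have tz0 : jt z0 = p.1 by rewrite jt_onto_equation jt_mkjet.
have xz0 k : (k < r)%N -> jx z0 k = x k.
  by move=> kr; rewrite jx_onto_equation// jx_mkjet// ltnW.
have bz0 : base z0 = p by rewrite [RHS]surjective_pairing /base tz0 xz0.
have Oz0 : over U z0 by rewrite /over/= bz0.
have Dz0 : DT T z0 = 0.
  have -> : DT T z0 = A p + x1 * B p by rewrite (DTE r0 sT)// bz0 xz0.
  by rewrite /x1 mulNr mulNr divfK// subrr.
have DDz0 : total_derivative (DT T) z0 = 1.
  have oO := @open_over K r _ oU.
  rewrite (@td_eq _ _ (over U) _ (fun z => A (base z) + jx z 1 * B (base z)))//;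
    last by move=> y Uy; rewrite (DTE r0 sT).
  have dA := smooth_differentiable sA Up; have dB := smooth_differentiable sB Up.
  have dAz : differentiable (fun z : jet => A (base z)) z0.
    by apply: differentiable_base; rewrite bz0.
  have dBz : differentiable (fun z : jet => B (base z)) z0.
    by apply: differentiable_base; rewrite bz0.
  have dx := @differentiable_jx K r z0 1.
  rewrite tdD//; last exact: differentiableM.
  rewrite tdM// td_jx// !td_base// ?bz0// !xz0//.
  transitivity (c2 + (1 - c2) / B p * B p); last by rewrite divfK// addrC subrK.
  have sw (a b d : K) : a + (b + d) = a + d + b by ring.
  exact: sw.
(* Moving x_1 along the equation keeps the base point and gives [DT] the value s T_x, nonzero for s
   other than 0; the transformed equation is then available arbitrarily close to [z0]. *)
pose v : jet := tangent th (e_x K r 1).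
have tv : jt v = 0 by rewrite jt_tangent jt_e_x.
have xv k : (k < r)%N -> jx v k = (k == 1%N)%:R.
  by move=> kr; rewrite jx_tangent// jx_e_x// ltnW.
pose w s : jet := z0 + s *: v.
have bw s : base (w s) = p by rewrite base_line// xv.
have tw s : jt (w s) = p.1 by rewrite jt_line.
have Dw s : DT T (w s) = s * B p.
  have -> : DT T (w s) = A p + (x1 + s * 1) * B p.
    by rewrite (DTE r0 sT) bw// /w jxD jxZ xv// xz0.
  by rewrite mulr1 mulrDl /x1 mulNr mulNr divfK// addrA subrr add0r.
(* [q k] is the k-th prolonged derivative multiplied by [DT] to the power 2r - 1, the denominator of
   the r-th one. For k < r it still contains a positive power of [DT]. *)
pose q (k : nat) (z : jet) : K := if k is m.+1
  then numerator T X m z * DT T z ^+ (r - k).*2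
  else X (base z) * DT T z ^+ r.-1.*2.+1.
pose th' := arb E' (T p).
pose G z := numerator T X r.-1 z + \sum_(k < r - 2) av_a th' k * q k z -
  av_b th' * DT T z ^+ r.-1.*2.+1.
have oO := @open_over K r _ oU.
have sD := smooth_DT r oU sT.
have sG : smooth (over U) G.
  apply: smoothB => //; last first.
    by apply: smoothM => //; [exact: smooth_cst|exact: smoothX].
  apply: smoothD => //; first exact: smooth_numerator.
  apply: smooth_sum => // k; apply: smoothM => //; first exact: smooth_cst.
  rewrite /q; case: (nat_of_ord k) => [|m]; apply: smoothM => //.
  - exact: smooth_base.
  - exact: smoothX.
  - exact: smooth_numerator.
  - exact: smoothX.
have Gw s : s != 0 -> G (w s) = 0.
  move=> s0; have D0 : DT T (w s) != 0 by rewrite Dw mulf_neq0.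
  have Rw : regular U T (w s) by split=> //; rewrite /over/= bw.
  have /eqU : U (base (w s)) by rewrite bw.
  move=> /(_ D0)[+ _]; rewrite /on_equation tw => /(_ (tangentP _ _ (onto_equationP _ _))).
  rewrite jt_prolongation bw /Defs.eq_holds -/th' jx_prolongation//.
  under eq_bigr => k _ do rewrite jx_prolongation ?(leq_trans (ltnW (ltn_ord k)) (leq_subr _ _))//.
  move=> /(congr1 (fun y => y * DT T (w s) ^+ r.-1.*2.+1)).
  have := prolonged_derivative_numerator oU sT sX r.-1 Rw.
  rewrite (prednK r0) => ->; rewrite mulrDl divfK ?expf_neq0//.
  move=> /eqP; rewrite -subr_eq0 => /eqP <-; congr (_ + _ - _).
  rewrite mulr_suml; apply: eq_bigr => k _; rewrite -mulrA; congr (_ * _).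
  rewrite /q; case: (nat_of_ord k) (ltn_ord k) => [|m] mr; first by rewrite /= bw.
  rewrite (prolonged_derivative_numerator oU sT sX _ Rw) mulrAC -mulrA; congr (_ * _).
  have -> : r.-1.*2.+1 = ((r - m.+1).*2 + m.*2.+1)%N by lia.
  by rewrite exprD mulfK// expf_neq0.
have G0 : G z0 = 0.
  have w0 : w 0 = z0 by rewrite /w scale0r addr0.
  have cG : (G \o w) @ nbhs (0 : K) --> G z0.
    apply: (@cvg_comp _ _ _ w G _ (nbhs z0)); last exact: smooth_continuous sG Oz0.
    have cw := @jet_line_continuous K r z0 v 0.
    by move: cw; rewrite /continuous_at -/(w 0) w0.
  have c1 : (G \o w) @ (0 : K)^' --> G z0 by exact: cvg_trans (cvg_app _ (@nbhs_dnbhs _ _)) cG.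
  have c2' : (G \o w) @ (0 : K)^' --> (0 : K).
    apply: cvg_near_cst; near=> s; apply: Gw; near: s; exact: nbhs_dnbhs_neq.
  exact: (cvg_unique (@norm_hausdorff _ _) c1 c2').
move: G0; rewrite /G Dz0 expr0n/= mulr0 subr0 big1 ?addr0 => [|k _]; last first.
  rewrite /q; case: (nat_of_ord k) (ltn_ord k) => [|m] mr.
    by rewrite Dz0 expr0n/= !mulr0.
  by rewrite Dz0 expr0n [((r - m.+1).*2 == 0)%N](_ : _ = false) ?mulr0//; lia.
rewrite (numerator_at_zero X _ Oz0 Dz0) DDz0 expr1n mulr1 => /eqP; apply/negP.
rewrite mulf_neq0//.
  by apply/prodf_neq0 => j _; rewrite oppr_eq0 pnatr_eq0.
(* At x_1 = -T_t/T_x the expression X_t + x_1 X_x is minus the Jacobian divided by T_x. *)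
rewrite /= td_base//; last by rewrite bz0; exact: smooth_differentiable sX Up.
rewrite bz0 xz0//=; have := J0 p Up; rewrite /plane_jacobian -!/(pt K) -!/(px K).
rewrite -/(A p) -/(B p); apply: contra => /eqP E0; apply/eqP.
rewrite -[RHS](mulr0 (- B p)) -E0 /x1; field.
exact: Tx0.
Unshelve. all: by end_near. Qed.

End Fibre.

(** * Degeneracy of equivalence transformations with nonzero T_x *)

Section Equivalence.
Variables (K : numFieldType) (r : nat).
Local Notation jet := (jet K r).
Local Notation plane := (plane K).
Local Notation arbval := (arbval K r).
Local Notation joint := (joint K r).

Lemma derive_row_coord (V : normedModType K) n (f : V -> 'rV[K]_n) p v j :
  differentiable f p -> 'D_v (fun q => f q 0 j) p = 'D_v f p 0 j.
Proof.
move=> df.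
have dc : differentiable (fun N : 'rV[K]_n => N 0 j : K) (f p).
  exact: differentiable_coord.
have -> : (fun q => f q 0 j) = (fun N : 'rV[K]_n => N 0 j : K) \o f by [].
rewrite deriveE; last exact: differentiable_comp.
by rewrite (diff_comp df dc)/= -!deriveE// derive_coord.
Qed.

Lemma joint_jet_continuous : continuous (@joint_jet K r).
Proof. exact: continuous_lsubmx. Qed.

Lemma joint_ptK z (th : arbval) : joint_jet (joint_pt z th) = z.
Proof. by rewrite /joint_jet row_mxKl. Qed.

Lemma smooth_joint_jet (W : normedModType K) (O : set jet) (f : jet -> W) :
  open O -> smooth O f ->
  smooth (@joint_jet K r @^-1` O) (fun w => f (joint_jet w)).
Proof.
move=> oO sf; apply: (@smooth_precomp_lin K _ _ _ O (@lsubmx K 1 r.+2 ((r - 2) + 1))) => //.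
exact: continuous_lsubmx.
Qed.

Lemma smooth_arb (E : equation K r) : smooth (dom E) (arb E).
Proof.
have oE := @dom_open _ _ E.
apply: row_smooth => // j; rewrite /arb.
case: (split_ordP j) => k ->.
  by under eq_fun do rewrite row_mxEl mxE; exact: coef_smooth.
by under eq_fun do rewrite row_mxEr mxE; exact: rhs_smooth.
Qed.

Section JointMap.
Variables (U : set plane) (Om : set joint) (T X : plane -> K) (Th : joint -> arbval).
Hypotheses (oU : open U) (sT : smooth U T) (sX : smooth U X) (oOm : open Om).
Hypothesis OmU : forall w, Om w -> regular U T (joint_jet w).
Hypothesis sTh : smooth Om Th.

Lemma smooth_joint_map : smooth Om (joint_map T X Th).
Proof.
apply: row_smooth => // j; rewrite /joint_map /joint_pt.
case: (split_ordP j) => k ->.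
  under eq_fun do rewrite row_mxEl.
  have sP : smooth (regular U T) (fun z => prolongation T X z 0 k).
    have oR := @open_regular K r U T oU sT.
    rewrite /prolongation; under eq_fun do rewrite mxE.
    case: (nat_of_ord k) => [|m]; last exact: smooth_prolonged_derivative.
    have sub : regular U T `<=` @over K r U by move=> z [].
    by apply: (smooth_sub sub); exact: smooth_base.
  by apply: smooth_sub (smooth_joint_jet (@open_regular K r U T oU sT) sP).
under eq_fun do rewrite row_mxEr.
have -> : (fun w => Th w 0 k) = fun w => (fun N : arbval => N 0 k : K) (Th w) by [].
move=> n; have := sTh n; elim: n (Th) => [|n IH] f.
  move=> cf w Ow.
  apply: (@continuous_comp _ _ _ f (fun N : arbval => N 0 k : K) w (cf w Ow)).
  exact: (@coord_continuous K _ _ 0 k).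
move=> [df Df]; split=> [w Ow|v].
  have dc : differentiable (fun N : arbval => N 0 k : K) (f w).
    exact: differentiable_coord.
  exact: (differentiable_comp (df w Ow) dc).
apply: times_differentiable_eq (IH _ (Df v)) => // w Ow.
by rewrite (derive_row_coord v k (df w Ow)).
Qed.

(* The prolongation does not see the arbitrary elements, so a direction in
   which Th is stationary is in the kernel of the Jacobian of the joint map. *)
Lemma joint_map_degenerate w (b : arbval) : Om w -> b != 0 ->
  'D_(joint_pt 0 b) Th w = 0 -> \det (jacobian (joint_map T X Th) w) = 0.
Proof.
move=> Ow b0 DTh; apply/eqP/negPn/negP => det0.
set J := jacobian _ _ in det0.
have uJ : J \in unitmx by rewrite unitmxE unitfE.
have dJ := smooth_differentiable smooth_joint_map Ow.
suff vJ : (joint_pt 0 b : joint) *m J = 0.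
  have : (joint_pt 0 b : joint) = 0 by rewrite -(mulmxK uJ (joint_pt 0 b)) vJ mul0mx.
  move=> /(congr1 (@rsubmx _ _ _ _)); rewrite row_mxKr linear0 => /eqP.
  exact/negP.
rewrite -deriveEjacobian//; apply/rowP => j; rewrite -derive_row_coord// [RHS]mxE.
have dTh := smooth_differentiable sTh Ow.
rewrite /joint_map /joint_pt; case: (split_ordP j) => k ->.
  have -> : (fun w => row_mx (prolongation T X (joint_jet w)) (Th w) 0
      (lshift (r - 2 + 1) k)) = (fun w => prolongation T X (joint_jet w) 0 k).
    by apply/funext => w'; rewrite row_mxEl.
  have sP := smooth_prolongation r oU sT sX.
  have dP := smooth_differentiable sP (OmU Ow).
  have dPk : differentiable (fun z => prolongation T X z 0 k) (joint_jet w).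
    have dc : differentiable (fun N : jet => N 0 k : K)
        (prolongation T X (joint_jet w)) by exact: differentiable_coord.
    exact: (differentiable_comp dP dc).
  rewrite (@derive_lin K _ _ _ (@lsubmx K 1 r.+2 ((r - 2) + 1))
    (fun z => prolongation T X z 0 k) w (row_mx 0 b))//; last exact: continuous_lsubmx.
  by rewrite /= row_mxKl derive0.
have -> : (fun w => row_mx (prolongation T X (joint_jet w)) (Th w) 0
    (rshift r.+2 k)) = (fun w => Th w 0 k).
  by apply/funext => w'; rewrite row_mxEr.
by rewrite derive_row_coord// DTh mxE.
Qed.

End JointMap.
End Equivalence.

Section EquivalenceFibre.
Variables (K : numFieldType) (r : nat).
Hypothesis r0 : (0 < r)%N.
Local Notation jet := (jet K r).
Local Notation plane := (plane K).
Local Notation arbval := (arbval K r).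
Local Notation joint := (joint K r).

Lemma smooth_fst (U : set plane) : open U -> smooth U (fun q : plane => q.1).
Proof.
move=> oU; apply: (@smooth_lin K plane K U fst) => //.
by move=> q; exact: cvg_fst.
Qed.

Lemma smooth_snd (U : set plane) : open U -> smooth U (fun q : plane => q.2).
Proof.
move=> oU; apply: (@smooth_lin K plane K U snd) => //.
by move=> q; exact: cvg_snd.
Qed.

(** The right-hand side vanishes at [t0] for every e, so all these equations give the same values of
    the arbitrary elements there and differ only in their first derivatives. *)
Definition slope_rhs (t0 e t : K) : K := e * (t - t0).

Lemma smooth_slope t0 e : smooth setT (slope_rhs t0 e).
Proof.
have oT : open [set: K] by exact: openT.
apply: smoothM => //; first exact: smooth_cst.
apply: smoothB => //; last exact: smooth_cst.
by apply: (@smooth_lin K K K _ idfun) => // x; exact: cvg_id.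
Qed.

Lemma smooth_zero_coef (k : 'I_(r - 2)) : smooth setT (fun _ : K => 0 : K).
Proof. by apply: smooth_cst; exact: openT. Qed.

Definition slope_equation t0 e : equation K r :=
  @Equation K r setT (fun _ _ => 0) (slope_rhs t0 e) openT
    smooth_zero_coef (smooth_slope t0 e).

Definition e_b : arbval := row_mx 0 (const_mx 1).

Lemma e_b_neq0 : e_b != 0.
Proof.
apply/eqP => /(congr1 (fun N : arbval => N 0 (rshift (r - 2) ord0))).
by rewrite row_mxEr !mxE => /eqP; rewrite oner_eq0.
Qed.

Lemma arb_slope t0 e t : arb (slope_equation t0 e) t = (e * (t - t0)) *: e_b.
Proof.
rewrite /arb /e_b scale_row_mx scaler0; congr row_mx.
  by apply/rowP => k; rewrite !mxE.
by apply/rowP => k; rewrite !mxE mulr1.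
Qed.

Lemma joint_ptD z v (th th' : arbval) :
  joint_pt (z + v) (th + th') = joint_pt z th + joint_pt v th' :> joint.
Proof. by rewrite /joint_pt add_row_mx. Qed.

Lemma joint_ptZ a z (th : arbval) :
  joint_pt (a *: z) (a *: th) = a *: joint_pt z th :> joint.
Proof. by rewrite /joint_pt scale_row_mx. Qed.

Lemma equivalence_regular T X Om (Th : joint -> arbval) w :
  equivalence_transformation T X Om Th -> Om w ->
  regular (plane_projection Om) T (joint_jet w).
Proof.
move=> [_ _ [_ H] _ _] Ow; split; last by have [] := H w Ow.
by exists w.
Qed.

(* Along the level curve of T through p, the values of Th on the equations
   x^(r) = e (t - t0) are stationary for each e: they depend on T only. Comparing
   e = 0 and e = 1, Th is stationary in the direction of the right-hand side. *)
Lemma equivalence_derive_x T X Om (Th : joint -> arbval) :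
  equivalence_transformation T X Om Th ->
  forall p, plane_projection Om p -> 'D_(px K) T p = 0.
Proof.
move=> eqT p Up; apply/eqP/negPn/negP => Tx0.
have [oOm [[oU _ _ _] sT sX _] [sTh H] cov gen] := eqT.
have [z0 [bz0 Oz0 _]] := cov p 0 Up.
set U := plane_projection Om in oU sT sX Up.
pose t0 := p.1; pose w0 : joint := joint_pt z0 0.
pose Tt := 'D_(pt K) T p; pose Tx := 'D_(px K) T p.
(* Tangent to the level curve of T through p. *)
pose v : plane := Tx *: pt K + (- Tt) *: px K.
have dT := smooth_differentiable sT Up.
have DvT : 'D_v T p = 0.
  rewrite /v deriveDv//.
  have -> : (- Tt) *: px K = (- Tt) *: px K + 0 by rewrite addr0.
  rewrite deriveDv// derive0 addr0 -/Tt -/Tx.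
  by rewrite /GRing.scale/= mulNr mulrC subrr.
have dTh := smooth_differentiable sTh Oz0.
(* This is the velocity of the lift of [v] along the equation of slope e, with x_1, ..., x_r frozen.
   Only its last component depends on e, so [L 1 - L 0] is T_x times the direction of the right-hand
   side. *)
pose L e : joint := joint_pt (Tx *: e_t K r + (- Tt) *: e_x K r 0) ((e * Tx) *: e_b).
have DL e : 'D_(L e) Th w0 = 0.
  have [E' gE'] := gen (slope_equation t0 e).
  pose phi (q : plane) : joint :=
    joint_pt (z0 + ((q.1 - p.1) *: e_t K r + (q.2 - p.2) *: e_x K r 0))
             (arb (slope_equation t0 e) q.1).
  have phip : phi p = w0.
    rewrite /phi !subrr !scale0r !addr0 arb_slope /t0 subrr mulr0 scale0r//.
  have bphi q : base (joint_jet (phi q)) = q.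
    rewrite joint_ptK /base jtD jtD !jtZ jt_e_t jt_e_x// mulr0 mulr1 addr0.
    rewrite jxD jxD !jxZ jx_e_t// jx_e_x// mulr0 mulr1 add0r.
    have [-> ->] : jt z0 = p.1 /\ jx z0 0 = p.2 by rewrite -bz0.
    by rewrite !(addrC _ (_ - _)) !subrK -surjective_pairing.
  have line h : phi (h *: v + p) = h *: L e + w0.
    have -> : h *: v + p = (h * Tx + p.1, - (h * Tt) + p.2).
      rewrite /v [in LHS](surjective_pairing p).
      congr (_, _); rewrite /= /GRing.scale/= /GRing.scale/=; ring.
    rewrite /phi /= !addrK arb_slope addrK /L /w0 -joint_ptZ -joint_ptD addr0.
    congr joint_pt; last by rewrite scalerA mulrCA.
    by rewrite scalerDr !scalerA mulrN addrC.
  have cphi : phi @ p --> w0.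
    have sphi : smooth setT phi.
      have oT : open [set: plane] by exact: openT.
      have -> : phi = fun q => w0 + ((q.1 - p.1) *: joint_pt (e_t K r) (e *: e_b) +
          (q.2 - p.2) *: joint_pt (e_x K r 0) 0).
        apply/funext => q; rewrite -!joint_ptZ -!joint_ptD /phi arb_slope.
        by rewrite scaler0 add0r addr0 scalerA mulrC.
      have s1 : smooth setT (fun q : plane => q.1 - p.1).
        by apply: smoothB => //; [exact: smooth_fst|exact: smooth_cst].
      have s2 : smooth setT (fun q : plane => q.2 - p.2).
        by apply: smoothB => //; [exact: smooth_snd|exact: smooth_cst].
      apply: smoothD => //; first exact: smooth_cst.
      by apply: smoothD => //; apply: smoothZ => //; exact: smooth_cst.
    by rewrite -phip; exact: (smooth_continuous sphi (I : setT p)).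
  have nOm : \forall q \near p, Om (phi q).
    by apply: cphi; exact: open_nbhs_nbhs.
  have HE q : Om (phi q) -> dom E' (T q) /\ Th (phi q) = arb E' (T q).
    have jq : jt (z0 + ((q.1 - p.1) *: e_t K r + (q.2 - p.2) *: e_x K r 0)) = q.1.
      by have := congr1 fst (bphi q); rewrite joint_ptK.
    have bq : base (z0 + ((q.1 - p.1) *: e_t K r + (q.2 - p.2) *: e_x K r 0)) = q.
      by have := bphi q; rewrite joint_ptK.
    move=> Oq; have := gE' (z0 + ((q.1 - p.1) *: e_t K r + (q.2 - p.2) *: e_x K r 0)).
    by rewrite jq bq; case.
  have [dE' _] : dom E' (T p) /\ Th (phi p) = arb E' (T p).
    by apply: HE; rewrite phip.
  have -> : 'D_(L e) Th w0 = 'D_v (fun q => Th (phi q)) p.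
    rewrite /derive.
    suff -> : (fun h => h^-1 *: ((Th \o shift w0) (h *: L e) - Th w0)) =
      (fun h => h^-1 *: (((fun q => Th (phi q)) \o shift p) (h *: v) - Th (phi p))) by [].
    by apply/funext => h /=; rewrite line phip.
  have -> : 'D_v (fun q => Th (phi q)) p = 'D_v (fun q => arb E' (T q)) p.
    by apply: near_eq_derive; apply: filterS nOm => q /HE[].
  rewrite (derive_comp1 v dT (smooth_differentiable (@smooth_arb _ _ E') dE')).
  by rewrite DvT scale0r.
have Db : 'D_(joint_pt 0 e_b) Th w0 = 0.
  have E : L 1 = Tx *: joint_pt 0 e_b + L 0.
    rewrite /L -joint_ptZ -joint_ptD scaler0 add0r mul1r mul0r scale0r addr0//.
  have := DL 1; rewrite E deriveDv// DL addr0 => /eqP.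
  by rewrite scaler_eq0 (negPf Tx0) => /eqP.
have [_ /eqP[]] := H _ Oz0.
apply: (joint_map_degenerate oU sT sX oOm _ sTh Oz0 e_b_neq0 Db) => w Ow.
exact: (equivalence_regular eqT Ow).
Qed.

End EquivalenceFibre.

(** * Affine dependence on x *)

Section Sections.
Variable K : numFieldType.
Local Notation plane := (plane K).

Lemma derive_affine (V W V' : normedModType K) (L : {linear V' -> V}) (b : V)
    (g : V -> W) p v : continuous L -> differentiable g (L p + b) ->
  differentiable (fun q => g (L q + b)) p /\
  'D_v (fun q => g (L q + b)) p = 'D_(L v) g (L p + b).
Proof.
move=> cL dg; have dL : differentiable (fun q => L q + b) p.
  by apply: differentiableD; [exact: linear_differentiable|exact: differentiable_cst].
have dc := differentiable_comp dL dg.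
split=> //; rewrite deriveE// (diff_comp dL dg)/= deriveE//; congr ('d g _ _).
have -> : (fun q => L q + b) = (L : V' -> V) + cst b by [].
rewrite diffD; [|exact: linear_differentiable|exact: differentiable_cst].
by rewrite /= diff_lin// diff_cst addr0.
Qed.

Lemma affine_continuous (V V' : normedModType K) (L : {linear V' -> V}) (b : V) :
  continuous L -> continuous (fun p => L p + b).
Proof. by move=> cL p; apply: cvgD; [exact: cL|exact: cvg_cst]. Qed.

Lemma smooth_precomp_affine (V W V' : normedModType K) (L : {linear V' -> V})
    (b : V) (U : set V) (g : V -> W) : open U -> continuous L -> smooth U g ->
  smooth [set p | U (L p + b)] (fun p => g (L p + b)).
Proof.
move=> oU cL sg n; move: (sg n) => {sg}.
have cA := (affine_continuous (b := b) cL).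
have oU' : open [set p | U (L p + b)] by exact: (open_comp (fun p _ => cA p) oU).
elim: n g => [|n IH] g.
  move=> cg p Up; apply: (@continuous_comp _ _ _ (fun p => L p + b) g); first exact: cA.
  exact: cg.
move=> [dg Dg]; split=> [p Up|v].
  by have [] := derive_affine 0 cL (dg _ Up).
apply: times_differentiable_eq (IH _ (Dg (L v))) => // p Up.
by have [_ ->] := derive_affine v cL (dg _ Up).
Qed.

Lemma vertical_linear : linear (fun x : K => (0, x) : plane).
Proof. by move=> a u v; congr (_, _); rewrite /= scaler0 addr0. Qed.

Definition verticalL : {linear K -> plane} :=
  HB.pack (fun x : K => (0, x) : plane)
    (GRing.isLinear.Build _ _ _ _ _ vertical_linear).

Lemma horizontal_linear : linear (fun t : K => (t, 0) : plane).
Proof. by move=> a u v; congr (_, _); rewrite /= scaler0 addr0. Qed.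

Definition horizontalL : {linear K -> plane} :=
  HB.pack (fun t : K => (t, 0) : plane)
    (GRing.isLinear.Build _ _ _ _ _ horizontal_linear).

Lemma vertical_continuous : continuous verticalL.
Proof.
have -> : (verticalL : K -> plane) = fun x => x *: px K.
  by apply/funext => x; congr (_, _); rewrite /= /GRing.scale/= ?mulr0 ?mulr1.
exact: scalel_continuous.
Qed.

Lemma horizontal_continuous : continuous horizontalL.
Proof.
have -> : (horizontalL : K -> plane) = fun x => x *: pt K.
  by apply/funext => x; congr (_, _); rewrite /= /GRing.scale/= ?mulr0 ?mulr1.
exact: scalel_continuous.
Qed.

Lemma verticalE (t x : K) : verticalL x + (t, 0) = (t, x).
Proof. by congr (_, _); rewrite /= ?add0r ?addr0. Qed.

Lemma horizontalE (t x : K) : horizontalL t + (0, x) = (t, x).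
Proof. by congr (_, _); rewrite /= ?add0r ?addr0. Qed.

Lemma derive_vertical (f : plane -> K) (t x : K) : differentiable f (t, x) ->
  differentiable (fun y => f (t, y)) x /\
  'D_(1 : K) (fun y => f (t, y)) x = 'D_(px K) f (t, x).
Proof.
move=> df; have E : (fun y => f (t, y)) = fun y => f (verticalL y + (t, 0)).
  by apply/funext => y; rewrite verticalE.
have df' : differentiable f (verticalL x + (t, 0)) by rewrite verticalE.
by have [] := derive_affine (1 : K) vertical_continuous df'; rewrite -E verticalE.
Qed.

Lemma smooth_horizontal (U : set plane) (f : plane -> K) (x : K) : open U ->
  smooth U f -> smooth [set t | U (t, x)] (fun t => f (t, x)).
Proof.
move=> oU sf.
have := smooth_precomp_affine (0, x) oU horizontal_continuous sf.
have -> : [set p | U (horizontalL p + (0, x))] = [set t | U (t, x)].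
  by apply/funext => t; exact: (congr1 U (horizontalE t x)).
have -> // : (fun t => f (horizontalL t + (0, x))) = fun t => f (t, x).
by apply/funext => t; exact: (congr1 f (horizontalE t x)).
Qed.

Lemma open_section_t (U : set plane) (x : K) : open U -> open [set t | U (t, x)].
Proof.
move=> oU; have -> : [set t | U (t, x)] = (fun t => horizontalL t + (0, x)) @^-1` U.
  by apply/funext => t; exact: (congr1 U (esym (horizontalE t x))).
apply: open_comp => // t _; exact: (affine_continuous horizontal_continuous).
Qed.

Lemma open_section_x (U : set plane) (t : K) : open U -> open [set x | U (t, x)].
Proof.
move=> oU; have -> : [set x | U (t, x)] = (fun x => verticalL x + (t, 0)) @^-1` U.
  by apply/funext => x; exact: (congr1 U (esym (verticalE t x))).
apply: open_comp => // x _; exact: (affine_continuous vertical_continuous).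
Qed.

Lemma open_t_projection (U : set plane) : open U -> open (t_projection U).
Proof.
move=> oU; have -> : t_projection U = \bigcup_x [set t | U (t, x)].
  by apply/seteqP; split=> [_ [[t x] Up <-]|t [x _ Utx]]; [exists x|exists (t, x)].
by apply: bigcup_open => x _; exact: open_section_t.
Qed.

Lemma connected_t_projection (U : set plane) : connected U ->
  connected (t_projection U).
Proof.
move=> cU; apply: connected_continuous_connected => //.
by apply: continuous_subspaceT => q; exact: cvg_fst.
Qed.

Lemma smooth_t_projection (U : set plane) (g : K -> K) : open U ->
  smooth (t_projection U) g -> smooth U (fun p => g p.1).
Proof.
move=> oU sg; apply: (smooth_comp1 oU _ (smooth_fst oU) sg).
by move=> p Up; exists p.
Qed.

Lemma derive_fst (g : K -> K) (p v : plane) : differentiable g p.1 ->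
  'D_v (fun q : plane => g q.1) p = 'D_(v.1) g p.1.
Proof.
move=> dg; apply: (@derive_lin K _ _ _ fst g p v) => //.
by move=> q; exact: cvg_fst.
Qed.

Variables (R : realType) (c : coordinates R K).

(** A point is chosen on each fibre. The choice [sel] need not be continuous, but near t the
    resulting function agrees with s -> f(s, sel t), where the second argument is frozen, and this
    one is smooth. *)
Lemma fibre_constant (U : set plane) (f : plane -> K) : suitable_domain U ->
  smooth U f -> (forall p, U p -> 'D_(px K) f p = 0) ->
  exists2 g : K -> K, smooth (t_projection U) g & forall p, U p -> f p = g p.1.
Proof.
move=> [oU _ _ fibU] sf f0.
have /choice[sel Hsel] : forall t, exists x, t_projection U t -> U (t, x).
  move=> t; have [[[s x] Up <-]|n] := pselect (t_projection U t); first by exists x.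
  by exists 0.
have eq_fib t x y : U (t, x) -> U (t, y) -> f (t, x) = f (t, y).
  move=> Ux Uy.
  have zd : forall z, [set x | U (t, x)] z ->
      differentiable (fun x => f (t, x)) z /\ 'D_(1 : K) (fun x => f (t, x)) z = 0.
    move=> z Uz.
    have [d1 d2] := derive_vertical (smooth_differentiable sf Uz).
    by rewrite d2 f0.
  exact: (@zero_derive_constant R K c [set x | U (t, x)] (fun x => f (t, x))
    (fibU t) (@open_section_x U t oU) zd x y Ux Uy).
exists (fun t => f (t, sel t)); last first.
  move=> [t x] Up /=; apply: eq_fib => //; apply: Hsel; by exists (t, x).
apply: smooth_local; first exact: open_t_projection.
move=> t It; exists [set s | U (s, sel t)].
  by split; [exact: Hsel|exact: open_section_t].
apply: smooth_eq (@smooth_horizontal U f (sel t) oU sf); first exact: open_section_t.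
move=> s /= Us; apply: eq_fib => //; apply: Hsel; by exists (s, sel t).
Qed.

Lemma derive_fibre_constant (U : set plane) (f : plane -> K) (g : K -> K) p :
  open U -> smooth (t_projection U) g -> (forall p, U p -> f p = g p.1) ->
  U p -> 'D_(px K) f p = 0 /\ 'D_(pt K) f p = 'D_1 g p.1.
Proof.
move=> oU sg fg Up; have Ip : t_projection U p.1 by exists p.
have dg := smooth_differentiable sg Ip.
have N : \forall q \near p, f q = g q.1 by exact: open_near Up fg.
by split; rewrite (near_eq_derive _ N) derive_fst// derive0.
Qed.

End Sections.

(** * Fibre-preserving transformations and their leading terms *)

Section Speed.
Variables (K : numFieldType) (theta : K -> K).

Definition speed (t : K) : K := 'D_1 theta t.
Definition log_speed (t : K) : K := 'D_1 speed t / speed t.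

(* The powers of theta' remove the denominators of the prolonged derivatives. *)
Definition scaled_derivative (T X : plane K -> K) (r k : nat) (z : jet K r) : K :=
  speed (jt z) ^+ k * prolonged_derivative T X k z.

End Speed.

Section Fibred.
Variables (K : numFieldType) (r : nat).
Local Notation jet := (jet K r).
Local Notation plane := (plane K).
Variables (U : set plane) (theta : K -> K) (T X : plane -> K).
Hypotheses (r1 : (1 < r)%N) (oU : open U).
Hypothesis T_theta : forall p, U p -> T p = theta p.1.
Hypothesis sth : smooth (t_projection U) theta.
Hypothesis tau0 : forall t, t_projection U t -> 'D_1 theta t != 0.
Hypothesis sX : smooth U X.
Implicit Types (z v : jet) (f g : jet -> K).

Local Notation O := (@over K r U).
Local Notation tau := (speed theta).
Local Notation sigma := (log_speed theta).
Local Notation S := (@scaled_derivative K theta T X r).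

Let oI : open (t_projection U) := open_t_projection oU.
Let oO : open O := open_over oU.
Let r0 : (0 < r)%N := ltnW r1.

Lemma over_t z : O z -> t_projection U (jt z).
Proof. by move=> Oz; exists (base z). Qed.

Lemma smooth_tau : smooth (t_projection U) tau.
Proof. exact: smooth_derive. Qed.

Lemma smooth_sigma : smooth (t_projection U) sigma.
Proof.
have st := smooth_tau; apply: smoothM => //; first exact: smooth_derive.
by apply: smoothV => // t; exact: tau0.
Qed.

Lemma smooth_over_jt (g : K -> K) : smooth (t_projection U) g ->
  smooth O (fun z => g (jt z)).
Proof.
by move=> sg; apply: (smooth_comp1 oO _ (smooth_jt oO) sg); exact: over_t.
Qed.

Lemma smooth_over_base (g : plane -> K) : smooth U g ->
  smooth O (fun z => g (base z)).
Proof. exact: smooth_base. Qed.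

Lemma DT_tau z : O z -> DT T z = tau (jt z).
Proof.
move=> Oz; rewrite /DT (@td_eq _ _ O _ (fun y => theta (jt y)))//.
  by rewrite td_jt//; exact: smooth_differentiable sth (over_t Oz).
by move=> y Oy; rewrite /= T_theta.
Qed.

Lemma smooth_fibredT : smooth U T.
Proof.
apply: (smooth_eq oU _ (smooth_t_projection oU sth)) => p Up.
by rewrite T_theta.
Qed.

Lemma regular_over z : O z -> regular U T z.
Proof. by move=> Oz; split=> //=; rewrite DT_tau//; exact/tau0/over_t. Qed.

Lemma smooth_S k : smooth O (S k).
Proof.
apply: smoothM => //.
  by apply: smoothX => //; apply: smooth_over_jt; exact: smooth_tau.
apply: smooth_sub (smooth_prolonged_derivative r oU smooth_fibredT sX k).
exact: regular_over.
Qed.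

(** With [DT] equal to theta', the product theta'^(k+1) P_(k+1) is theta'^k D P_k for the prolonged
    derivatives P_k; differentiating the factor theta'^k accounts for the correction by k sigma. *)
Lemma S_rec k z : O z ->
  S k.+1 z = total_derivative (S k) z - k%:R * sigma (jt z) * S k z.
Proof.
move=> Oz; have It := over_t Oz; have t0 : tau (jt z) != 0 by exact: tau0.
have dt := smooth_differentiable smooth_tau It.
have dtz : differentiable (fun z => tau (jt z)) z by exact: differentiable_jt.
have stk : smooth O (fun z => tau (jt z) ^+ k).
  by apply: smoothX => //; apply: smooth_over_jt; exact: smooth_tau.
have dp : differentiable (prolonged_derivative T X k) z.
  exact: (smooth_differentiable (smooth_prolonged_derivative r oU smooth_fibredT sX k)
    (regular_over Oz)).
rewrite /scaled_derivative prolonged_derivativeS DT_tau//.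
rewrite tdM//; last exact: smooth_differentiable stk Oz.
rewrite tdX// td_jt// /log_speed.
move: (total_derivative _ z) (prolonged_derivative _ _ _ z) => P Q.
case: k {stk dp} => [|k] /=; first by rewrite !expr0 expr1; field.
by rewrite !exprS; field.
Qed.

Definition truncate (j : nat) z : jet :=
  mkjet r (jt z) (fun k => if (k <= j)%N then jx z k else 0).

Lemma jt_truncate j z : jt (truncate j z) = jt z.
Proof. exact: jt_mkjet. Qed.

Lemma jx_truncate j z k : (k <= r)%N ->
  jx (truncate j z) k = if (k <= j)%N then jx z k else 0.
Proof. by move=> kr; rewrite jx_mkjet. Qed.

Lemma base_truncate j z : base (truncate j z) = base z.
Proof. by rewrite /base jt_truncate jx_truncate. Qed.

Lemma truncate_truncate i j z : (i <= j)%N ->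
  truncate i (truncate j z) = truncate i z.
Proof.
move=> ij; apply: jetP => [|k kr]; first by rewrite !jt_truncate.
rewrite !jx_truncate//; case: leqP => // ki.
by rewrite (leq_trans ki ij).
Qed.

Lemma truncate_linear j : linear (truncate j).
Proof.
move=> a u v; apply: jetP => [|k kr].
  by rewrite jtD jtZ !jt_truncate jtD jtZ.
rewrite jxD jxZ !jx_truncate// jxD jxZ.
by case: ifP => // _; rewrite mulr0 addr0.
Qed.

Definition truncateL j : {linear jet -> jet} :=
  HB.pack (truncate j) (GRing.isLinear.Build _ _ _ _ _ (truncate_linear j)).

Lemma truncate_continuous j : continuous (truncate j).
Proof. exact: (@row_linear_continuous K _ _ (truncateL j)). Qed.

(** Dependence on t, x_0, ..., x_j only is expressed through the linear map [truncate], so that the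
    chain rule tells how the total derivative raises the order. *)
Definition has_order (j : nat) f : Prop :=
  smooth O f /\ forall z, O z -> f z = f (truncate j z).

Lemma over_truncate j z : O z -> O (truncate j z).
Proof. by rewrite /over/= base_truncate. Qed.

Lemma orderW i j f : (i <= j)%N -> has_order i f -> has_order j f.
Proof.
move=> ij [sf fi]; split=> // z Oz.
by rewrite [RHS]fi ?truncate_truncate -?fi//; exact: over_truncate.
Qed.

Lemma orderD j f g : has_order j f -> has_order j g ->
  has_order j (fun z => f z + g z).
Proof.
by move=> [sf fi] [sg gi]; split=> [|z Oz]; [exact: smoothD|rewrite -fi// -gi].
Qed.

Lemma orderM j f g : has_order j f -> has_order j g ->
  has_order j (fun z => f z * g z).
Proof.
by move=> [sf fi] [sg gi]; split=> [|z Oz]; [exact: smoothM|rewrite -fi// -gi].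
Qed.

Lemma orderN j f : has_order j f -> has_order j (fun z => - f z).
Proof.
by move=> [sf fi]; split=> [|z Oz]; [exact: smoothN|rewrite -fi].
Qed.

Lemma order_cst j (a : K) : has_order j (fun _ => a).
Proof. by split=> //; exact: smooth_cst. Qed.

Lemma order_base j (F : plane -> K) : smooth U F -> has_order j (fun z => F (base z)).
Proof.
by move=> sF; split=> [|z Oz]; [exact: smooth_over_base|rewrite base_truncate].
Qed.

Lemma order_jt j (g : K -> K) : smooth (t_projection U) g ->
  has_order j (fun z => g (jt z)).
Proof.
by move=> sg; split=> [|z Oz]; [exact: smooth_over_jt|rewrite jt_truncate].
Qed.

Lemma order_jx k j : (k <= j)%N -> (k <= r)%N -> has_order j (fun z => jx z k).
Proof.
by move=> kj kr; split=> [|z Oz]; [exact: smooth_jx|rewrite jx_truncate// kj].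
Qed.

(** Since f agrees near each jet with its composition with [truncate j], its total derivative sees
    the vector [vD] only through its components up to x_j, and these involve coordinates up to
    x_(j+1). *)
Lemma order_td j f : (j < r)%N -> has_order j f -> has_order j.+1 (total_derivative f).
Proof.
move=> jr [sf fj]; split=> [|z Oz]; first exact: smooth_td.
have E y : O y -> total_derivative f y = 'D_(truncate j (vD y)) f (truncate j y).
  move=> Oy; rewrite (tdE (smooth_differentiable sf Oy)).
  have N : \forall x \near y, f x = f (truncate j x) by exact: open_near Oy fj.
  rewrite (near_eq_derive _ N).
  apply: (@derive_lin K _ _ _ (truncateL j)); first exact: truncate_continuous.
  exact: smooth_differentiable sf (over_truncate j Oy).
rewrite E// E; last exact: over_truncate.
rewrite (truncate_truncate z (leqnSn j)).
suff -> : truncate j (vD z) = truncate j (vD (truncate j.+1 z)) by [].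
apply: jetP => [|k kr]; first by rewrite !jt_truncate !jt_vD.
rewrite !jx_truncate//; case: leqP => // kj.
have kr' : (k < r)%N by exact: leq_ltn_trans kj jr.
by rewrite !jx_vD// jx_truncate// ltnS kj.
Qed.

Lemma order_S k : (k <= r)%N -> has_order k (S k).
Proof.
elim: k => [|k IH] kr.
  split; first exact: smooth_S.
  by move=> z Oz; rewrite /scaled_derivative !expr0 /= base_truncate.
have Hk := IH (ltnW kr).
have ord : has_order k.+1
    (fun z => total_derivative (S k) z - k%:R * sigma (jt z) * S k z).
  apply: orderD; first exact: order_td.
  apply/orderN/orderM; last exact: orderW Hk.
  apply: orderM; first exact: order_cst.
  by apply: order_jt; exact: smooth_sigma.
split; first exact: smooth_S.
move=> z Oz; rewrite S_rec// [RHS]S_rec; last exact: over_truncate.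
by have [_ ->] := ord.
Qed.

Lemma smooth_tdD f g z : smooth O f -> smooth O g -> O z ->
  total_derivative (fun y => f y + g y) z =
  total_derivative f z + total_derivative g z.
Proof.
by move=> sf sg Oz; rewrite tdD//; exact: smooth_differentiable Oz.
Qed.

Lemma smooth_tdM f g z : smooth O f -> smooth O g -> O z ->
  total_derivative (fun y => f y * g y) z =
  total_derivative f z * g z + f z * total_derivative g z.
Proof.
by move=> sf sg Oz; rewrite tdM//; exact: smooth_differentiable Oz.
Qed.

Lemma smooth_td_base (F : plane -> K) z : smooth U F -> O z ->
  total_derivative (fun y => F (base y)) z =
  'D_(pt K) F (base z) + jx z 1 * 'D_(px K) F (base z).
Proof.
by move=> sF Oz; apply: td_base => //; exact: smooth_differentiable sF Oz.
Qed.

Lemma td_base_ex (F : plane -> K) : smooth U F ->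
  exists Ft Fx : plane -> K, [/\ smooth U Ft, smooth U Fx &
    forall z, O z -> total_derivative (fun y => F (base y)) z =
      Ft (base z) + jx z 1 * Fx (base z)].
Proof.
move=> sF; exists (fun p => 'D_(pt K) F p); exists (fun p => 'D_(px K) F p).
by split=> [||z]; [exact: smooth_derive|exact: smooth_derive|exact: smooth_td_base].
Qed.

Lemma S1E z : O z ->
  S 1 z = 'D_(pt K) X (base z) + jx z 1 * 'D_(px K) X (base z).
Proof.
move=> Oz; rewrite S_rec// mul0r mul0r subr0.
rewrite (@td_eq _ _ O _ (fun z => X (base z)))//; first exact: smooth_td_base.
by move=> y _; rewrite /scaled_derivative expr0 mul1r.
Qed.

Let ssigma : smooth U (fun p => sigma p.1).
Proof. by apply: smooth_t_projection => //; exact: smooth_sigma. Qed.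

(* Y, A, At and B stand for the derivatives X_t, X_x, X_tx and X_xx; keeping
   them as variables spares the unifier from comparing iterated derivatives. *)
Section Top.
Variables (Y A At B : plane -> K).
Hypotheses (sY : smooth U Y) (sA : smooth U A) (sAt : smooth U At) (sB : smooth U B).
Hypothesis S1A : forall z, O z -> S 1 z = Y (base z) + jx z 1 * A (base z).
Hypothesis tdA : forall z, O z ->
  total_derivative (fun y => A (base y)) z = At (base z) + jx z 1 * B (base z).

(** Treated apart because x_1^2 X_xx occurs here with coefficient 1, while the pattern of [S_top]
    would give 2 for k = 2. *)
Lemma S2E : exists L Q : plane -> K, [/\ smooth U L, smooth U Q &
  forall z, O z -> S 2 z = jx z 2 * A (base z) + jx z 1 ^+ 2 * B (base z) +
    jx z 1 * L (base z) + Q (base z)].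
Proof.
have [Yt [Yx [sYt sYx tdY]]] := td_base_ex sY.
exists (fun p => Yx p + At p - sigma p.1 * A p).
exists (fun p => Yt p - sigma p.1 * Y p).
split.
- by apply: smoothB => //; [exact: smoothD|exact: smoothM].
- by apply: smoothB => //; exact: smoothM.
move=> z Oz; rewrite (S_rec 1 Oz) (@td_eq _ _ O _ _ _ oO Oz S1A) (S1A Oz).
have sx := @smooth_jx K r O 1 oO.
have bt := smooth_over_base sY; have bx := smooth_over_base sA.
rewrite (smooth_tdD bt (smoothM oO sx bx) Oz) (smooth_tdM sx bx Oz).
rewrite tdY// tdA// (td_jx z r1) -[(base z).1]/(jt z).
move: (Yt _) (Yx _) (At _) (B _) (A _) (Y _) (sigma _) => a1 a2 a3 a4 a5 a6 a7.
ring.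
Qed.

(** The coefficient of x_(k-1) x_1 X_xx is 3 for k = 3: two from the derivative of x_1^2 and one
    from D(X_x). Each later step adds one more, because differentiating x_k X_x produces x_k
    D(X_x). *)
Lemma S_top k : (3 <= k)%N -> (k <= r)%N ->
  exists (L : plane -> K) (Q : jet -> K), [/\ smooth U L, has_order (k - 2) Q &
  forall z, O z -> S k z = jx z k * A (base z) +
    jx z k.-1 * (k%:R * (jx z 1 * B (base z)) + L (base z)) + Q z].
Proof.
have sx k := @smooth_jx K r O k oO.
have sb (F : plane -> K) : smooth U F -> smooth O (fun z => F (base z)) by move=> sF; exact: smooth_over_base sF.
have sjt : smooth O (fun z => sigma (jt z)).
  by apply: smooth_over_jt; exact: smooth_sigma.
elim: k => // -[|[|[|k]]] IH // _ kr.
  have [L [Q [sL sQ E2]]] := S2E.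
  have [Bt [Bx [sBt sBx tdB]]] := td_base_ex sB.
  have [Lt [Lx [sLt sLx tdL]]] := td_base_ex sL.
  have [Qt [Qx [sQt sQx tdQ]]] := td_base_ex sQ.
  exists (fun p => At p + L p - 2 * (sigma p.1 * A p)).
  pose N z := jx z 1 ^+ 2 * (Bt (base z) + jx z 1 * Bx (base z)) +
      jx z 1 * (Lt (base z) + jx z 1 * Lx (base z)) +
      (Qt (base z) + jx z 1 * Qx (base z)) -
      2 * sigma (jt z) * (jx z 1 ^+ 2 * B (base z) + jx z 1 * L (base z) + Q (base z)).
  exists N; split.
  - apply: smoothB => //; first exact: smoothD.
    by apply: smoothM => //; [exact: smooth_cst|exact: smoothM].
  - have o1 : has_order 1 (fun z => jx z 1) by apply: order_jx.
    have ob (F : plane -> K) : smooth U F -> has_order 1 (fun z => F (base z)) by exact: order_base.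
    have oD (F G : plane -> K) : smooth U F -> smooth U G -> has_order 1
        (fun z => F (base z) + jx z 1 * G (base z)).
      by move=> sF sG; apply: orderD; [exact: ob|apply: orderM => //; exact: ob].
    have o2 : has_order 1 (fun z => jx z 1 ^+ 2).
      by under eq_fun do rewrite expr2; exact: orderM.
    rewrite /N; apply: orderD.
      apply: orderD; last exact: oD.
      by apply: orderD; apply: orderM => //; exact: oD.
    apply/orderN/orderM; last first.
      by apply: orderD; [apply: orderD; apply: orderM => //|]; exact: ob.
    apply: orderM; first exact: order_cst.
    by apply: order_jt; exact: smooth_sigma.
  move=> z Oz; rewrite (S_rec 2 Oz) (@td_eq _ _ O _ _ _ oO Oz E2) (E2 z Oz).
  have s2 : smooth O (fun z => jx z 1 ^+ 2) by exact: smoothX.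
  have mA : smooth O (fun z => jx z 2 * A (base z)) by apply: smoothM => //; exact: sb.
  have mB : smooth O (fun z => jx z 1 ^+ 2 * B (base z)) by apply: smoothM => //; exact: sb.
  have mL : smooth O (fun z => jx z 1 * L (base z)) by apply: smoothM => //; exact: sb.
  rewrite (smooth_tdD (smoothD oO (smoothD oO mA mB) mL) (sb _ sQ) Oz).
  rewrite (smooth_tdD (smoothD oO mA mB) mL Oz) (smooth_tdD mA mB Oz).
  rewrite (smooth_tdM (sx 2) (sb _ sA) Oz) (smooth_tdM s2 (sb _ sB) Oz).
  rewrite (smooth_tdM (sx 1) (sb _ sL) Oz).
  have -> : total_derivative (fun z => jx z 1 ^+ 2) z = 2 * jx z 1 * jx z 2.
    rewrite tdX; last exact: differentiable_jx.
    by rewrite td_jx// expr1.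
  rewrite !td_jx// tdA// tdB// tdL// tdQ// /N -[(base z).1]/(jt z) -[3.-1]/2%N.
  move: (At _) (A _) (Bt _) (Bx _) (B _) (Lt _) (Lx _) (L _) (Qt _) (Qx _) (Q _) (sigma _).
  by move=> *; ring.
have [//|L [Q [sL oQ Ek]]] := IH _ (ltnW kr).
exists (fun p => At p + L p - k.+3%:R * (sigma p.1 * A p)).
pose M z := k.+3%:R * (jx z 1 * B (base z)) + L (base z).
have oM : has_order 1 M.
  apply: orderD; last exact: order_base.
  apply: orderM; first exact: order_cst.
  by apply: orderM; [exact: order_jx|exact: order_base].
exists (fun z => jx z k.+2 * total_derivative M z + total_derivative Q z -
  k.+3%:R * sigma (jt z) * (jx z k.+2 * M z + Q z)).
split.
- apply: smoothB => //; first exact: smoothD.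
  by apply: smoothM => //; [exact: smooth_cst|exact: smoothM].
- have ox : has_order k.+2 (fun z => jx z k.+2).
    by apply: order_jx => //; lia.
  have oQ1 : has_order k.+2 (total_derivative Q).
    by apply: (@orderW (k.+3 - 2).+1); [lia|apply: order_td => //; lia].
  have oM1 : has_order k.+2 (total_derivative M).
    by apply: (@orderW 2); [lia|apply: order_td => //; lia].
  have oM2 : has_order k.+2 M by apply: orderW oM.
  have oQ2 : has_order k.+2 Q by apply: orderW oQ; lia.
  rewrite (_ : (k.+4 - 2 = k.+2)%N); last by lia.
  apply: orderD; first by apply: orderD => //; exact: orderM.
  apply/orderN/orderM; last by apply: orderD => //; exact: orderM.
  apply: orderM; first exact: order_cst.
  by apply: order_jt; exact: smooth_sigma.
move=> z Oz; rewrite (S_rec _ Oz) (@td_eq _ _ O _ _ _ oO Oz Ek) (Ek z Oz).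
have sM := oM.1; have sQ := oQ.1.
have mA : smooth O (fun z => jx z k.+3 * A (base z)) by apply: smoothM => //; exact: sb.
have mM : smooth O (fun z => jx z k.+2 * M z) by exact: smoothM.
rewrite (smooth_tdD (smoothD oO mA mM) sQ Oz) (smooth_tdD mA mM Oz).
rewrite (smooth_tdM (sx k.+2) sM Oz) (smooth_tdM (sx k.+3) (sb _ sA) Oz).
rewrite (td_jx z kr) (td_jx z (ltnW kr)) tdA// -[(base z).1]/(jt z).
rewrite -[k.+3.-1]/k.+2 -[k.+4.-1]/k.+3 /M.
move: (total_derivative _ z) (total_derivative Q z) => m q.
rewrite -(natr1 k.+3).
move: (At _) (A _) (B _) (L _) (Q _) (sigma _) (k.+3%:R : K) => a1 a2 a3 a4 a5 a6 a7.
ring.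
Qed.

End Top.
End Fibred.

(** * Vanishing of X_xx *)

Section FibredEquation.
Variables (K : numFieldType) (r : nat).
Local Notation jet := (jet K r).
Local Notation plane := (plane K).
Variables (U : set plane) (theta : K -> K) (T X : plane -> K).
Hypotheses (r1 : (1 < r)%N) (oU : open U).
Hypothesis T_theta : forall p, U p -> T p = theta p.1.
Hypothesis sth : smooth (t_projection U) theta.
Hypothesis tau0 : forall t, t_projection U t -> 'D_1 theta t != 0.
Hypothesis sX : smooth U X.
Implicit Types (z v : jet).
Local Notation O := (@over K r U).
Local Notation S := (@scaled_derivative K theta T X r).
Variables (E E' : equation K r).

(** The forward implication near one jet is what both kinds of transformations supply, including
    equivalence transformations whose domain is small in the derivatives. *)
Definition maps_near z : Prop :=
  \forall y \near z, on_equation E y -> on_equation E' (prolongation T X y).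

Let oO : open O := open_over oU.

Lemma line_near (P : jet -> Prop) z v : (\forall y \near z, P y) ->
  \forall s \near (0 : K), P (z + s *: v).
Proof.
move=> Pz; have := @jet_line_continuous K r z v 0.
by rewrite /continuous_at scale0r addr0 => /(_ _ Pz).
Qed.

Lemma line_point (P : jet -> Prop) z v : (\forall y \near z, P y) ->
  exists2 s : K, s != 0 & P (z + s *: v).
Proof.
move=> Pz; have N := line_near v Pz.
near (0 : K)^' => s; exists s; first by near: s; exact: nbhs_dnbhs_neq.
by near: s; exact: nbhs_dnbhs.
Unshelve. all: by end_near. Qed.

(** The image equation is multiplied by theta'^r, which leaves only nonnegative powers of theta'. *)
Lemma equation_relation z : O z -> on_equation E' (prolongation T X z) ->
  S r z + \sum_(k < r - 2) coef E' k (theta (jt z)) * speed theta (jt z) ^+ (r - k) * S k z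
  = speed theta (jt z) ^+ r * rhs E' (theta (jt z)).
Proof.
move=> Oz; rewrite /on_equation jt_prolongation T_theta// /Defs.eq_holds av_b_arb => <-.
rewrite mulrDr jx_prolongation//; congr (_ + _).
rewrite mulr_sumr; apply: eq_bigr => k _; rewrite av_a_arb.
have kr : (k <= r)%N by exact: leq_trans (ltnW (ltn_ord k)) (leq_subr _ _).
have Er : speed theta (jt z) ^+ r =
    speed theta (jt z) ^+ (r - k) * speed theta (jt z) ^+ k.
  by rewrite -exprD subnK.
rewrite jx_prolongation// Er /scaled_derivative.
by move: (prolonged_derivative _ _ _ _) => P; rewrite -[(base z).1]/(jt z); ring.
Qed.

(** The image equation has no terms of orders r - 1 and r - 2, and each remaining lower term has
    order below r - 2; so a change of the coordinates from x_(r-2) upwards can affect only the r-th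
    derivative. *)
Lemma top_invariant z v : O z ->
  jt v = 0 -> (forall k, (k < r - 2)%N -> jx v k = 0) -> O (z + v) ->
  on_equation E' (prolongation T X z) ->
  on_equation E' (prolongation T X (z + v)) -> S r (z + v) = S r z.
Proof.
move=> Oz tv lowv Ov /(equation_relation Oz) R1 /(equation_relation Ov).
have tz : jt (z + v) = jt z by rewrite jtD tv addr0.
rewrite tz -R1 => /eqP; rewrite -subr_eq0 opprD addrACA -sumrB big1 ?addr0.
  by rewrite subr_eq0 => /eqP.
move=> k _; apply/eqP; rewrite subr_eq0; apply/eqP; congr (_ * _).
have kr : (k <= r)%N by exact: leq_trans (ltnW (ltn_ord k)) (leq_subr _ _).
have [_ Sk] := order_S oU T_theta sth tau0 sX kr.
rewrite Sk// [RHS]Sk//; congr (S k _).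
apply: jetP => [|j jr]; first by rewrite !jt_truncate.
rewrite !jx_truncate//; case: leqP => // jk.
by rewrite jxD lowv ?addr0//; exact: leq_ltn_trans jk (ltn_ord k).
Qed.

Lemma on_equation_line z v s : on_equation E z -> jt v = 0 ->
  linear_part (arb E (jt z)) v = 0 -> on_equation E (z + s *: v).
Proof.
rewrite /on_equation /Defs.eq_holds -!/(linear_part _ _) => Ez tv lv.
by rewrite jt_line// linear_partD linear_partZ lv mulr0 addr0.
Qed.

Lemma over_line z v s : O z -> jt v = 0 -> jx v 0 = 0 -> O (z + s *: v).
Proof. by move=> Oz tv xv; rewrite /over/= base_line//; exact: Oz. Qed.

Lemma maps_near_at z : maps_near z -> on_equation E z ->
  on_equation E' (prolongation T X z).
Proof. by move=> Mz; exact: (nbhs_singleton Mz). Qed.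

Section SecondDerivative.
Variables (A At B Y : plane -> K).
Hypotheses (sY : smooth U Y) (sA : smooth U A) (sAt : smooth U At) (sB : smooth U B).
Hypothesis S1A : forall z, O z -> S 1 z = Y (base z) + jx z 1 * A (base z).
Hypothesis tdA : forall z, O z ->
  total_derivative (fun y => A (base y)) z = At (base z) + jx z 1 * B (base z).

(** For r = 2 a change of x_1 by s along the equation gives a quadratic polynomial in s with leading
    coefficient X_xx that vanishes near 0. For r at least 3 a change of x_(r-1) gives r x_1 X_xx + L
    = 0, and comparing this relation at two values of x_1 isolates X_xx. *)
Lemma second_derivative_zero z0 : O z0 -> on_equation E z0 -> maps_near z0 ->
  B (base z0) = 0.
Proof.
move=> Oz0 Ez0 Mz0; have r0 : (0 < r)%N := ltnW r1.
set th := arb E (jt z0).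
pose v1 : jet := tangent th (e_x K r 1).
have tv1 : jt v1 = 0 by rewrite jt_tangent jt_e_x.
have xv1 k : (k < r)%N -> jx v1 k = (k == 1%N)%:R.
  by move=> kr; rewrite jx_tangent// jx_e_x//; exact: ltnW.
have lv1 : linear_part th v1 = 0.
  rewrite /v1 /tangent -scaleNr linear_partD linear_partZ linear_part_e_top.
  by rewrite mulr1 subrr.
have xv10 : jx v1 0 = 0 by rewrite xv1// ltnW.
have E1 s : on_equation E (z0 + s *: v1) by exact: on_equation_line.
have O1 s : O (z0 + s *: v1) by exact: over_line.
have b1 s : base (z0 + s *: v1) = base z0 by exact: base_line.
have Mz : \forall y \near z0, maps_near y.
  by have := nbhs_interior Mz0.
have [r2|r3] := leqP r 2.
  have Er : r = 2%N by apply/eqP; rewrite eqn_leq r2.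
  have [L [Q [_ _ S2]]] := S2E r1 oU T_theta sth tau0 sX sY sA sAt S1A tdA.
  have H s : on_equation E' (prolongation T X (z0 + s *: v1)) ->
      s ^+ 2 * B (base z0) + s * (2 * jx z0 1 * B (base z0) + L (base z0)) = 0.
    move=> Hs.
    have lowv k : (k < r - 2)%N -> jx (s *: v1) k = 0 by lia.
    have tsv : jt (s *: v1) = 0 by rewrite jtZ tv1 mulr0.
    have := top_invariant Oz0 tsv lowv (O1 s) (maps_near_at Mz0 Ez0) Hs.
    have x2 : jx v1 2 = 0.
      have : linear_part th v1 = jx v1 2.
        rewrite /linear_part big1 ?addr0 => [|k _]; first by congr (jx v1 _).
        by exfalso; have := ltn_ord k; lia.
      by rewrite lv1.
    have Sr z : O z -> S r z = S 2 z by move=> _; congr (S _ z).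
    rewrite !Sr// !S2// b1 !jxD !jxZ x2 xv1// eqxx mulr0 addr0 mulr1 => /eqP.
    rewrite -subr_eq0 => /eqP <-; ring.
  have Hn : \forall s \near (0 : K)^', s != 0 /\
      s ^+ 2 * B (base z0) + s * (2 * jx z0 1 * B (base z0) + L (base z0)) = 0.
    near=> s; split; first by near: s; exact: nbhs_dnbhs_neq.
    apply: H; apply: maps_near_at (E1 s).
    by near: s; apply: nbhs_dnbhs; exact: line_near.
  move: Hn => /nbhs_ballP[e e0 He].
  (* After division by s an affine function of s is left; its values at e/2 and e/4 already
     determine the slope. *)
  have He' d : 0 < d -> d < e -> d * B (base z0) +
      (2 * jx z0 1 * B (base z0) + L (base z0)) = 0.
    move=> d0 de; have [|//|_ Hd] := He d; last first.
      apply: (mulfI (lt0r_neq0 d0)); rewrite mulr0 -Hd; ring.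
      exact: lt0r_neq0.
    by rewrite -ball_normE/= sub0r normrN gtr0_norm.
  have e2 : 0 < e / 2 by rewrite divr_gt0.
  have e4 : 0 < e / 2 / 2 by rewrite divr_gt0.
  have le2 : e / 2 < e by rewrite ltr_pdivrMr// ltr_pMr// ltr1n.
  have le4 : e / 2 / 2 < e.
    by rewrite (lt_trans _ le2)// ltr_pdivrMr// ltr_pMr// ltr1n.
  have H2 := He' _ e2 le2; have H4 := He' _ e4 le4.
  apply: (mulfI (lt0r_neq0 e4)); rewrite mulr0 -[RHS](subrr 0) -{1}H2 -H4.
  by field.
have r1r : (r.-1 < r)%N by rewrite ltn_predL; exact: ltnW.
pose v2 : jet := e_x K r r.-1.
have tv2 : jt v2 = 0 by rewrite jt_e_x// ltnW.
have xv2 k : (k <= r)%N -> jx v2 k = (k == r.-1)%:R.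
  by move=> kr; rewrite jx_e_x// ltnW.
have lv2 t : linear_part (arb E t) v2 = 0.
  rewrite linear_part_e_x//; [|lia|exact: ltnW].
  by rewrite (_ : (r == r.-1) = false)//; lia.
have [L [Q [_ oQ Sr]]] :=
  S_top r1 oU T_theta sth tau0 sX sY sA sAt sB S1A tdA r3 (leqnn r).
have H z : O z -> on_equation E z -> maps_near z ->
    r%:R * (jx z 1 * B (base z)) + L (base z) = 0.
  move=> Oz Ez Hz; have [u u0 Hu] := line_point v2 (nbhs_interior Hz).
  have x20 : jx v2 0 = 0 by rewrite xv2// (_ : (0 == r.-1)%N = false)//; lia.
  have Ou : O (z + u *: v2) by exact: over_line.
  have Eu := on_equation_line u Ez tv2 (lv2 _).
  have lowv k : (k < r - 2)%N -> jx (u *: v2) k = 0.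
    move=> kr; rewrite jxZ xv2; last by lia.
    by rewrite (_ : (k == r.-1)%N = false) ?mulr0//; lia.
  have tuv : jt (u *: v2) = 0 by rewrite jtZ tv2 mulr0.
  have := top_invariant Oz tuv lowv Ou (maps_near_at Hz Ez) (maps_near_at Hu Eu).
  rewrite !Sr// base_line// !jxD !jxZ !xv2//; [|by lia..].
  rewrite (_ : (r == r.-1)%N = false); last by lia.
  rewrite (_ : (1 == r.-1)%N = false); last by lia.
  rewrite eqxx !mulr0 !addr0 mulr1.
  have -> : Q (z + u *: v2) = Q z.
    rewrite oQ.2// [RHS]oQ.2//; congr Q; apply: jetP => [|j jr].
      by rewrite !jt_truncate jt_line.
    rewrite !jx_truncate//; case: leqP => // jk.
    rewrite jxD jxZ xv2// (_ : (j == r.-1)%N = false) ?mulr0 ?addr0//; lia.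
  move: (r%:R * _ + _) (jx z r * _) (Q z) => a b d /eqP.
  rewrite -subr_eq0 => /eqP Ha; apply: (mulfI u0); rewrite mulr0 -Ha; ring.
(* The relation is used again at a jet with another x_1, where the base point, and hence X_xx and L,
   are unchanged. *)
have [s s0 Hs] := line_point v1 Mz.
have H0 := H z0 Oz0 Ez0 Mz0; have := H _ (O1 s) (E1 s) Hs.
rewrite b1 jxD jxZ xv1// eqxx mulr1 => H1; move: H1 H0.
move: (B _) (L _) (jx z0 1) => b l x H1 H0; apply/eqP.
have : r%:R * s * b = 0.
  by rewrite -[RHS](subrr 0) -{1}H1 -H0; ring.
move/eqP; rewrite !mulf_eq0 (negPf s0) pnatr_eq0 orbF.
by rewrite -leqn0 leqNgt (ltnW r1).
Unshelve. all: by end_near. Qed.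

End SecondDerivative.
End FibredEquation.

(** * Integration to the Moebius form *)

Section OneVariable.
Variables (K : numFieldType) (I : set K).
Hypothesis oI : open I.
Implicit Types (f g : K -> K) (t : K).

Lemma smooth_id : smooth I (fun t => t).
Proof. by apply: (@smooth_lin K K K I idfun) => // x; exact: cvg_id. Qed.

Lemma smooth_deriveD f g t : smooth I f -> smooth I g -> I t ->
  'D_1 (fun s => f s + g s) t = 'D_1 f t + 'D_1 g t.
Proof. by move=> sf sg It; apply: derive_fD; exact: smooth_differentiable It. Qed.

Lemma smooth_deriveM f g t : smooth I f -> smooth I g -> I t ->
  'D_1 (fun s => f s * g s) t = 'D_1 f t * g t + f t * 'D_1 g t.
Proof. by move=> sf sg It; apply: derive_fM; exact: smooth_differentiable It. Qed.

Lemma smooth_deriveN f t : smooth I f -> I t ->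
  'D_1 (fun s => - f s) t = - 'D_1 f t.
Proof. by move=> sf It; apply: derive_fN; exact: smooth_differentiable It. Qed.

Lemma smooth_deriveV f t : smooth I f -> f t != 0 -> I t ->
  'D_1 (fun s => (f s)^-1) t = - ('D_1 f t / f t ^+ 2).
Proof. by move=> sf f0 It; apply: derive_fV => //; exact: smooth_differentiable It. Qed.

Lemma smooth_deriveX f n t : smooth I f -> I t ->
  'D_1 (fun s => f s ^+ n) t = n%:R * f t ^+ n.-1 * 'D_1 f t.
Proof.
move=> sf It; elim: n => [|n IH]; first by rewrite !mul0r derive_cst.
under eq_fun do rewrite exprS.
rewrite smooth_deriveM// ?IH; last exact: smoothX.
case: n {IH} => [|n] /=; first by rewrite !expr0; ring.
by rewrite -(natr1 n.+1) !exprS; ring.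
Qed.

Lemma derive_eq_on f g t : (forall s, I s -> f s = g s) -> I t ->
  'D_1 f t = 'D_1 g t.
Proof. by move=> fg It; apply: near_eq_derive; exact: open_near It fg. Qed.

Lemma derive_affine1 (a b t : K) : 'D_1 (fun s : K => a * s + b) t = a.
Proof.
have d1 : differentiable (fun s : K => a * s) t.
  by apply: differentiableM => //; exact: differentiable_cst.
rewrite (derive_fD (1 : K) d1 (differentiable_cst b t)) derive_cst addr0.
by rewrite derive_fM// ?derive_cst ?derive_id ?mul0r ?add0r ?mulr1.
Qed.

Lemma smooth_affine1 (a b : K) : smooth I (fun s => a * s + b).
Proof.
apply: smoothD => //; last exact: smooth_cst.
by apply: smoothM => //; [exact: smooth_cst|exact: smooth_id].
Qed.

End OneVariable.

(** * Transformations affine in x *)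

Section AffineCoefficients.
Variables (K : numFieldType) (theta m n0 : K -> K).
Local Notation sigma := (log_speed theta).

(** For X = m x + n0 the scaled k-th derivative is the sum of [coefs k j] x_j over j, plus
    [offset k]. The recursion is that of [S_rec]; the shifted term arises because D sends x_i to
    x_(i+1). *)
Fixpoint coefs (k : nat) : nat -> K -> K :=
  match k with
  | 0 => fun j t => if j is 0 then m t else 0
  | l.+1 => fun j t => 'D_1 (coefs l j) t +
      (if j is i.+1 then coefs l i t else 0) - l%:R * sigma t * coefs l j t
  end.

Fixpoint offset (k : nat) : K -> K :=
  match k with
  | 0 => n0
  | l.+1 => fun t => 'D_1 (offset l) t - l%:R * sigma t * offset l t
  end.

Lemma coefs_gt k j t : (k < j)%N -> coefs k j t = 0.
Proof.
elim: k j t => [|k IH] [|j]//= t kj.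
have -> : coefs k j.+1 = fun _ => 0.
  by apply/funext => s; rewrite IH//; exact: ltnW.
by rewrite derive_cst IH// mulr0 subr0 addr0.
Qed.

Lemma derive_coefs_gt k j t : (k < j)%N -> 'D_1 (coefs k j) t = 0.
Proof.
move=> kj; have -> : coefs k j = fun _ => 0.
  by apply/funext => s; rewrite coefs_gt.
exact: derive_cst.
Qed.

Lemma coefs_diag k t : coefs k k t = m t.
Proof.
elim: k => [|k IH] //=; rewrite derive_coefs_gt// (coefs_gt _ (ltnSn k)).
by rewrite mulr0 subr0 add0r.
Qed.

End AffineCoefficients.

Section Affine.
Variables (K : numFieldType) (r : nat).
Local Notation jet := (jet K r).
Local Notation plane := (plane K).
Variables (U : set plane) (theta m n0 : K -> K) (T X : plane -> K).
Hypotheses (r1 : (1 < r)%N) (oU : open U).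
Hypothesis T_theta : forall p, U p -> T p = theta p.1.
Hypothesis sth : smooth (t_projection U) theta.
Hypothesis tau0 : forall t, t_projection U t -> 'D_1 theta t != 0.
Hypotheses (sm : smooth (t_projection U) m) (sn : smooth (t_projection U) n0).
Hypothesis X_affine : forall p, U p -> X p = m p.1 * p.2 + n0 p.1.
Implicit Types (z v : jet).
Local Notation O := (@over K r U).
Local Notation I := (t_projection U).
Local Notation S := (@scaled_derivative K theta T X r).
Local Notation sigma := (log_speed theta).
Local Notation c := (coefs theta m).
Local Notation n := (offset theta n0).

Let oI : open I := open_t_projection oU.
Let oO : open O := open_over oU.

Lemma smooth_affineX : smooth U X.
Proof.
have oU' := oU; apply: (smooth_eq oU (f := fun p => m p.1 * p.2 + n0 p.1)).
  by move=> p /X_affine.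
apply: smoothD => //; last exact: smooth_t_projection.
by apply: smoothM => //; [exact: smooth_t_projection|exact: smooth_snd].
Qed.

Let ssig : smooth I sigma := smooth_sigma oU sth tau0.

Lemma smooth_coefs k j : smooth I (c k j).
Proof.
elim: k j => [|k IH] j; first by case: j => [|j] //=; exact: smooth_cst.
apply: smoothB => //.
  apply: smoothD => //; first exact: smooth_derive.
  by case: j => [|j] //; exact: smooth_cst.
by apply: smoothM => //; apply: smoothM => //; exact: smooth_cst.
Qed.

Lemma smooth_offset k : smooth I (n k).
Proof.
elim: k => [|k IH] //=; apply: smoothB => //; first exact: smooth_derive.
by apply: smoothM => //; apply: smoothM => //; exact: smooth_cst.
Qed.

Lemma S_affine k z : (k <= r)%N -> O z ->
  S k z = \sum_(j < k.+1) c k j (jt z) * jx z j + n k (jt z).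
Proof.
elim: k z => [|k IH] z kr Oz.
  rewrite big_ord_recl big_ord0 addr0 /scaled_derivative expr0 mul1r /=.
  exact: X_affine.
have It := over_t Oz.
rewrite (S_rec oU T_theta sth tau0 smooth_affineX k Oz).
have E : forall y, O y -> S k y = \sum_(j < k.+1) c k j (jt y) * jx y j + n k (jt y).
  by move=> y; apply: IH; exact: ltnW.
have dc j : differentiable (c k j) (jt z).
  exact: smooth_differentiable (smooth_coefs k j) It.
have dn := smooth_differentiable (smooth_offset k) It.
have dcz j : differentiable (fun y => c k j (jt y)) z by exact: differentiable_jt.
have dx j := @differentiable_jx K r z j.
have dcx (j : 'I_k.+1) : differentiable (fun y => c k j (jt y) * jx y j) z.
  exact: differentiableM.
rewrite (@td_eq _ _ O _ _ _ oO Oz E) (E z Oz) tdD; last 2 first.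
- exact: differentiable_fsum.
- exact: differentiable_jt.
rewrite td_sum// td_jt//.
under eq_bigr => j _.
  rewrite tdM// td_jt// td_jx; last by apply: leq_trans kr; exact: ltn_ord.
  over.
rewrite big_split/= mulrDr opprD.
have -> : \sum_(j < k.+2) ('D_1 (c k j) (jt z) +
    (if j : nat is i.+1 then c k i (jt z) else 0) -
    k%:R * sigma (jt z) * c k j (jt z)) * jx z j =
  \sum_(j < k.+1) 'D_1 (c k j) (jt z) * jx z j +
  \sum_(j < k.+1) c k j (jt z) * jx z j.+1 -
  k%:R * sigma (jt z) * \sum_(j < k.+1) c k j (jt z) * jx z j.
  rewrite mulr_sumr -sumrN.
  under eq_bigr do rewrite mulrBl mulrDl -mulrA -mulNr.
  rewrite !big_split/=; congr (_ + _ + _).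
  - rewrite big_ord_recr/= [X in _ + X](_ : _ = 0) ?addr0//.
    by rewrite derive_coefs_gt// mul0r.
  - rewrite big_ord_recl; have -> : (if (ord0 : 'I_k.+2) : nat is i.+1
        then c k i (jt z) else 0) * jx z (ord0 : 'I_k.+2) = 0 by exact: mul0r.
    by rewrite add0r; apply: eq_bigr => j _.
  - rewrite big_ord_recr/= coefs_gt// !mulr0 oppr0 mul0r addr0.
    by apply: eq_bigr => j _; ring.
by move: ('D_1 (n k) _) (n k _) => a b; ring.
Qed.

End Affine.

Section Moebius.
Variables (K : numFieldType) (r : nat).
Local Notation jet := (jet K r).
Local Notation plane := (plane K).
Variables (U : set plane) (theta m n0 : K -> K) (T X : plane -> K).
Hypotheses (r1 : (1 < r)%N) (oU : open U).
Hypothesis T_theta : forall p, U p -> T p = theta p.1.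
Hypothesis sth : smooth (t_projection U) theta.
Hypothesis tau0 : forall t, t_projection U t -> 'D_1 theta t != 0.
Hypotheses (sm : smooth (t_projection U) m) (sn : smooth (t_projection U) n0).
Hypothesis X_affine : forall p, U p -> X p = m p.1 * p.2 + n0 p.1.
Implicit Types (z v : jet).
Local Notation O := (@over K r U).
Local Notation I := (t_projection U).
Local Notation S := (@scaled_derivative K theta T X r).
Local Notation tau := (speed theta).
Local Notation sigma := (log_speed theta).
Local Notation c := (coefs theta m).

Let oI : open I := open_t_projection oU.
Let oO : open O := open_over oU.
Let sX : smooth U X := smooth_affineX oU sm sn X_affine.
Let ssig : smooth I sigma := smooth_sigma oU sth tau0.
Let stau : smooth I tau := smooth_tau sth.

(** A change of x_(r-1) or x_(r-2) stays on E, which lacks these terms, and must leave the scaled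
    r-th derivative unchanged; this change is s times the coefficient. *)
Lemma coefs_top_zero E E' z j : O z -> on_equation E z ->
  maps_near T X E E' z -> (r - 2 <= j)%N -> (j < r)%N -> c r j (jt z) = 0.
Proof.
move=> Oz Ez Mz rj jr; pose v : jet := e_x K r j.
have tv : jt v = 0 by rewrite jt_e_x//; exact: ltnW.
have lv : linear_part (arb E (jt z)) v = 0.
  rewrite linear_part_e_x//; last exact: ltnW.
  by rewrite eqn_leq [(r <= j)%N]leqNgt jr.
(* For r = 2 and j = 0 the move changes x itself, so staying over U has to be secured together with
   the mapping property. *)
have N : \forall y \near z, O y /\ (on_equation E y -> on_equation E' (prolongation T X y)).
  by apply: filterI => //; exact: open_nbhs_nbhs.
have [s s0 [Os Ms]] := line_point v N.
have Es := on_equation_line s Ez tv lv.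
have lowv k : (k < r - 2)%N -> jx (s *: v) k = 0.
  move=> kr; rewrite jxZ jx_e_x; [|lia|lia].
  by rewrite (_ : (k == j) = false) ?mulr0//; lia.
have tsv : jt (s *: v) = 0 by rewrite jtZ tv mulr0.
have := top_invariant oU T_theta sth tau0 sX Oz tsv lowv Os (maps_near_at Mz Ez) (Ms Es).
rewrite (S_affine oU T_theta sth tau0 sm sn X_affine (leqnn r) Os).
rewrite (S_affine oU T_theta sth tau0 sm sn X_affine (leqnn r) Oz).
rewrite jt_line// => /addIr.
under eq_bigr do rewrite jxD mulrDr.
rewrite big_split/= -[RHS]addr0 => /addrI.
rewrite (bigD1 (Ordinal (leqW jr)))//= big1 => [|k kj]; last first.
  rewrite jxZ jx_e_x; [|exact: (ltn_ord k)|exact: ltnW].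
  by move: kj; rewrite -val_eqE /= => /negPf ->; rewrite !mulr0.
rewrite addr0 jxZ jx_e_x ?eqxx ?mulr1; [|exact: ltnW..].
by move/eqP; rewrite mulf_eq0 (negPf s0) orbF => /eqP.
Qed.

(** Each step adds m' and subtracts a multiple of sigma m; the multiples 0, 1, ..., k sum to
    k(k+1)/2. *)
Lemma coefs_diag1 k t : I t ->
  c k.+1 k t = k.+1%:R * 'D_1 m t - k.+1%:R * k%:R / 2 * sigma t * m t.
Proof.
elim: k t => [|k IH] t It.
  by rewrite /= mul0r mul0r addr0 !mulr0 !mul0r !subr0 mul1r.
rewrite -[c k.+2 k.+1 t]/('D_1 (c k.+1 k.+1) t + c k.+1 k t -
  k.+1%:R * sigma t * c k.+1 k.+1 t).
rewrite IH// coefs_diag// (derive_eq_on oI (fun s _ => coefs_diag theta m k.+1 s) It).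
by rewrite -(natr1 k.+1) -(natr1 k); field.
Qed.

Hypothesis top1 : forall t, I t -> c r r.-1 t = 0.
Hypothesis top2 : forall t, I t -> c r r.-2 t = 0.

Lemma derive_multiplier t : I t -> 'D_1 m t = (r%:R - 1) / 2 * sigma t * m t.
Proof.
move=> It; have := top1 It.
have Er : r = r.-1.+1 by rewrite prednK// ltnW.
have -> : c r r.-1 t = c r.-1.+1 r.-1 t by rewrite -Er.
rewrite coefs_diag1// -Er.
have -> : (r.-1%:R : K) = r%:R - 1 by rewrite {2}Er -natr1 addrK.
have rn0 : (r%:R : K) != 0 by rewrite pnatr_eq0 -lt0n ltnW.
move: ('D_1 m t) (sigma t) (m t) rn0 => d s mt rn0 H.
apply: (mulfI rn0); apply/eqP; rewrite -subr_eq0 -[X in _ == X]H; apply/eqP; by field.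
Qed.

Lemma coefs_diag1E k t : I t ->
  c k.+1 k t = k.+1%:R * (r%:R - k.+1%:R) / 2 * (sigma t * m t).
Proof.
move=> It; by rewrite coefs_diag1// derive_multiplier// -(natr1 k); field.
Qed.

Lemma derive_sigma_m t : I t ->
  'D_(1 : K) (fun s => sigma s * m s) t =
  m t * ('D_1 sigma t + (r%:R - 1) / 2 * sigma t ^+ 2).
Proof.
move=> It; rewrite (smooth_deriveM ssig sm It) derive_multiplier//.
by move: ('D_1 sigma t) => a; ring.
Qed.

(* The coefficients of m sigma' and m sigma^2 in c k (k - 2), obtained by solving
   the recursion for c. *)
Definition schw1 (n : K) : K :=
  r%:R * n * (n - 1) / 4 - (n - 1) * n * (2 * n - 1) / 12.
Definition schw2 (n : K) : K :=
  (r%:R - 1) / 2 * schw1 n - r%:R * (n - 1) * n * (2 * n - 1) / 12 +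
  (n * (n - 1)) ^+ 2 / 8.

Lemma derive_coefs_diag1 k t : I t ->
  'D_1 (c k.+1 k) t = k.+1%:R * (r%:R - k.+1%:R) / 2 *
    (m t * ('D_1 sigma t + (r%:R - 1) / 2 * sigma t ^+ 2)).
Proof.
move=> It; rewrite (derive_eq_on oI (@coefs_diag1E k) It).
rewrite (smooth_deriveM (smooth_cst _ oI) (smoothM oI ssig sm) It).
by rewrite derive_cst mul0r add0r derive_sigma_m.
Qed.

(** With n = k + 2, the recursion adds for each j < n the derivative of j(r-j)/2 sigma m and
    subtracts j sigma times the same function. Thus [schw1 n] is the sum of j(r-j)/2, and [schw2 n]
    is (r-1)/2 times it minus the sum of j^2(r-j)/2. *)
Lemma coefs_diag2 k t : I t ->
  c k.+2 k t = m t * (schw1 k.+2%:R * 'D_1 sigma t + schw2 k.+2%:R * sigma t ^+ 2).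
Proof.
elim: k t => [|k IH] t It.
  rewrite -[c 2 0 t]/('D_1 (c 1 0) t + 0 - 1%:R * sigma t * c 1 0 t).
  rewrite derive_coefs_diag1// coefs_diag1E// /schw2 /schw1.
  by move: ('D_1 sigma t) (sigma t) (m t) => a b d; field.
rewrite -[c k.+3 k.+1 t]/('D_1 (c k.+2 k.+1) t + c k.+2 k t -
  k.+2%:R * sigma t * c k.+2 k.+1 t).
rewrite IH// derive_coefs_diag1// coefs_diag1E// /schw2 /schw1 -(natr1 k.+2).
by move: ('D_1 sigma t) (sigma t) (m t) (k.+2%:R : K) => a b d e; field.
Qed.

Hypothesis m_neq0 : forall t, I t -> m t != 0.

(** At n = r the closed forms become r(r^2-1)/12 and minus one half of it, so the condition is the
    vanishing of sigma' - sigma^2/2, the Schwarzian derivative of theta. *)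
Lemma schwarzian_zero t : I t -> 'D_1 sigma t = sigma t ^+ 2 / 2.
Proof.
move=> It; have := top2 It.
have [k Er] : exists k, r = k.+2 by exists r.-2; lia.
have -> : c r r.-2 t = c k.+2 k t by rewrite Er.
rewrite coefs_diag2// -Er => /eqP.
rewrite mulf_eq0 (negPf (m_neq0 It))/= => /eqP H.
have a0 : (r%:R * (r%:R - 1) * (r%:R + 1) : K) != 0.
  have nr : (r%:R : K) != 0 by rewrite pnatr_eq0 Er.
  have nr1 : (r%:R - 1 : K) != 0 by rewrite Er -natr1 addrK pnatr_eq0.
  have nr2 : (r%:R + 1 : K) != 0 by rewrite natr1 pnatr_eq0.
  by rewrite mulf_neq0// mulf_neq0.
apply: (mulfI a0); apply/eqP; rewrite -subr_eq0.
rewrite (_ : _ - _ = 12 * (schw1 r%:R * 'D_1 sigma t + schw2 r%:R * sigma t ^+ 2)).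
  by rewrite H mulr0.
rewrite /schw2 /schw1; move: ('D_1 sigma t) (sigma t) (r%:R : K) => a b d.
by field.
Qed.

End Moebius.

(** * Solving the equations for theta and m *)

Section Integration.
Variables (R : realType) (K : numFieldType) (crd : coordinates R K).
Variables (I : set K) (theta m : K -> K) (r : nat).
Hypotheses (oI : open I) (cI : connected I).
Hypotheses (sth : smooth I theta) (sm : smooth I m).
Hypothesis tau0 : forall t, I t -> 'D_1 theta t != 0.
Local Notation tau := (speed theta).
Local Notation sigma := (log_speed theta).
Hypothesis Dm : forall t, I t -> 'D_1 m t = (r%:R - 1) / 2 * sigma t * m t.
Hypothesis Dsigma : forall t, I t -> 'D_1 sigma t = sigma t ^+ 2 / 2.

Lemma zero_derive_eq (f : K -> K) t0 t : smooth I f ->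
  (forall s, I s -> 'D_1 f s = 0) -> I t0 -> I t -> f t = f t0.
Proof.
move=> sf f0 It0 It; apply: (zero_derive_constant crd cI oI) => // s Is.
by split; [exact: smooth_differentiable Is|exact: f0].
Qed.

(* With w linear, w(t0) = 1 and w' = - sigma(t0)/2, the function
   q = sigma w - sigma(t0) satisfies q' = sigma q / 2, so q^2/theta' is constant,
   hence zero; then theta' w^2 and m w^(r-1) are constant. *)
Lemma moebius_integration t0 : (0 < r)%N -> I t0 ->
  exists a b g d C : K, [/\ a * d - b * g != 0, C = m t0,
    forall t, I t -> g * t + d != 0 &
    forall t, I t -> theta t = (a * t + b) / (g * t + d) /\
      m t = C / (g * t + d) ^+ r.-1].
Proof.
move=> r0 It0.
pose s0 := sigma t0; pose g := - s0 / 2; pose d := 1 + s0 / 2 * t0.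
pose w (t : K) := g * t + d.
have w0 : w t0 = 1 by rewrite /w /g /d; field.
have stau : smooth I tau by exact: smooth_derive.
have ssig : smooth I sigma.
  by apply: smoothM => //; [exact: smooth_derive|exact: smoothV].
have Dtau t : I t -> 'D_1 tau t = sigma t * tau t.
  by move=> It; rewrite /log_speed divfK//; exact: tau0.
have sw : smooth I w by exact: smooth_affine1.
have Dw t : 'D_1 w t = g by exact: derive_affine1.
have iV (f : K -> K) : smooth I f -> (forall t, I t -> f t != 0) -> smooth I (fun t => (f t)^-1).
  by move=> sf f0; exact: smoothV.
pose q t := sigma t * w t - s0.
have sq : smooth I q by apply: smoothB => //; [exact: smoothM|exact: smooth_cst].
have Dq t : I t -> 'D_1 q t = sigma t / 2 * q t.
  move=> It; rewrite /q (smooth_deriveD (smoothM oI ssig sw) (smooth_cst (- s0) oI) It).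
  rewrite derive_cst addr0 (smooth_deriveM ssig sw It) Dw Dsigma// /g.
  by field.
have q0 t : I t -> q t = 0.
  (* Squaring q avoids a square root of theta'. *)
  have sq2 : smooth I (fun t => q t ^+ 2) by exact: smoothX.
  have sV : smooth I (fun t => (tau t)^-1) by exact: iV.
  move=> It; have : q t ^+ 2 * (tau t)^-1 = q t0 ^+ 2 * (tau t0)^-1.
    apply: (zero_derive_eq (f := fun t => q t ^+ 2 * (tau t)^-1)) => //.
      exact: smoothM.
    move=> s Is; rewrite (smooth_deriveM sq2 sV Is).
    rewrite (smooth_deriveX oI 2 sq Is) (smooth_deriveV stau (tau0 Is) Is) Dq// Dtau//=.
    have := tau0 Is; rewrite -/(tau s).
    move: (q s) (sigma s) (tau s) => x y z z0; by field.
  rewrite {2}/q w0 mulr1 subrr expr0n/= mul0r => /eqP.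
  by rewrite mulf_eq0 invr_eq0 (negPf (tau0 It)) orbF expf_eq0/= => /eqP.
have sigw t : I t -> sigma t * w t = s0.
  by move=> It; apply/eqP; rewrite -subr_eq0 -/(q t) q0.
pose tau_0 := tau t0.
have tauw t : I t -> tau t * w t ^+ 2 = tau_0.
  have sw2 : smooth I (fun t => w t ^+ 2) by exact: smoothX.
  move=> It; have -> : tau_0 = tau t0 * w t0 ^+ 2 by rewrite w0 expr1n mulr1.
  apply: (zero_derive_eq (f := fun t => tau t * w t ^+ 2)) => //; first exact: smoothM.
  move=> s Is; rewrite (smooth_deriveM stau sw2 Is) (smooth_deriveX oI 2 sw Is) Dw Dtau//=.
  rewrite /g -(sigw s Is) expr1; move: (sigma s) (tau s) (w s) => x y z; by field.
have wn0 t : I t -> w t != 0.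
  move=> It; have : tau t * w t ^+ 2 != 0 by rewrite tauw//; exact: tau0.
  by rewrite mulf_eq0 negb_or => /andP[_]; rewrite expf_eq0/=.
pose T0 := theta t0.
(* Chosen so that a t + b = T0 w(t) + tau_0 (t - t0): the quotient by w has the value of theta at
   [t0], and the determinant is [tau_0]. *)
pose a := T0 * g + tau_0; pose b := T0 * d - tau_0 * t0.
have sN : smooth I (fun t => a * t + b) by exact: smooth_affine1.
have sWV : smooth I (fun t => (w t)^-1) by exact: iV.
exists a, b, g, d, (m t0); split=> //.
  have -> : a * d - b * g = tau_0 * w t0 by rewrite /a /b /w; ring.
  by rewrite w0 mulr1; exact: tau0.
move=> t It; rewrite -/(w t); split.
  apply/eqP; rewrite -subr_eq0; apply/eqP.
  have E0 : theta t0 - (a * t0 + b) * (w t0)^-1 = 0.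
    by rewrite w0 /a /b -/T0; move: w0; rewrite /w => w0; rewrite invr1 mulr1
      -[X in X - _]mulr1 -w0; ring.
  rewrite -[RHS]E0.
  apply: (zero_derive_eq (f := fun t => theta t - (a * t + b) * (w t)^-1)) => //.
    by apply: smoothB => //; exact: smoothM.
  move=> s Is; have sNw := smoothM oI sN sWV.
  rewrite (smooth_deriveD sth (smoothN oI sNw) Is) (smooth_deriveN sNw Is).
  rewrite (smooth_deriveM sN sWV Is) derive_affine1 (smooth_deriveV sw (wn0 s Is) Is) Dw.
  rewrite -/(tau s); have ws := wn0 s Is.
  have -> : tau s = tau_0 / w s ^+ 2 by rewrite -(tauw s Is) mulfK// expf_neq0.
  have -> : tau_0 = a * d - b * g.
    have -> : a * d - b * g = tau_0 * w t0 by rewrite /a /b /w; ring.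
    by rewrite w0 mulr1.
  move: ws; rewrite /w => ws; by field.
have mw s : I s -> m s * w s ^+ r.-1 = m t0.
  have swr : smooth I (fun t => w t ^+ r.-1) by exact: smoothX.
  move=> Is; have -> : m t0 = m t0 * w t0 ^+ r.-1 by rewrite w0 expr1n mulr1.
  apply: (zero_derive_eq (f := fun t => m t * w t ^+ r.-1)) => //; first exact: smoothM.
  move=> x Ix; rewrite (smooth_deriveM sm swr Ix) (smooth_deriveX oI r.-1 sw Ix) Dw Dm//.
  rewrite /g -(sigw x Ix); case: (r) r0 => [//|[|l]] _ /=.
    by rewrite !mul0r mulr0 addr0 -[1%:R]/(1 : K) subrr !mul0r.
  by rewrite exprS -(natr1 l.+1) addrK; field.
by rewrite -(mw t It) mulfK// expf_neq0// wn0.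
Qed.

End Integration.

(** * From local mapping properties to the Moebius form *)

Section MoebiusForm.
Variables (R : realType) (K : numFieldType) (crd : coordinates R K) (r : nat).
Local Notation jet := (jet K r).
Local Notation plane := (plane K).
Hypothesis r1 : (1 < r)%N.

(** The common core of both necessity statements. The pair of equations may vary with the point p,
    as it does for equivalence transformations. *)
Lemma moebius_form (U : set plane) (T X : plane -> K) :
  point_transformation T X U -> (forall p, U p -> 'D_(px K) T p = 0) ->
  (forall p, U p -> exists (E E' : equation K r) (z : jet),
    [/\ base z = p, on_equation E z & maps_near T X E E' z]) ->
  exists2 m : parameters K, valid_parameters U m &
    forall p, U p -> T p = T_of m p /\ X p = X_of r m p.
Proof.
move=> [sU sT sX J0] Tx0 loc.
have r0 : (0 < r)%N := ltnW r1.
have [oU [p0 Up0] cU fibU] := sU.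
have [theta sth Tth] := fibre_constant crd sU sT Tx0.
have oI := open_t_projection oU; have cI := connected_t_projection cU.
have Jp p : U p -> 'D_1 theta p.1 != 0 /\ 'D_(px K) X p != 0.
  move=> Up; have := J0 p Up; rewrite /plane_jacobian -/(pt K) -/(px K) Tx0//.
  have [_ ->] := derive_fibre_constant oU sth Tth Up.
  by rewrite mul0r subr0 mulf_eq0 negb_or => /andP.
have tau0 t : t_projection U t -> 'D_1 theta t != 0.
  by move=> [p Up <-]; have [] := Jp p Up.
have sXx : smooth U ('D_(px K) X) by exact: smooth_derive.
have sXt : smooth U ('D_(pt K) X) by exact: smooth_derive.
have sXxt : smooth U ('D_(pt K) ('D_(px K) X)) by exact: smooth_derive.
have sXxx : smooth U ('D_(px K) ('D_(px K) X)) by exact: smooth_derive.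
have Xxx0 p : U p -> 'D_(px K) ('D_(px K) X) p = 0.
  move=> Up; have [E [E' [z [bz Ez Mz]]]] := loc p Up.
  have Oz : over U z by rewrite /over/= bz.
  rewrite -bz; apply: (second_derivative_zero r1 oU Tth sth tau0 sX sXt sXx sXxt sXxx
    _ _ Oz Ez Mz) => y Oy.
    exact: (S1E r1 oU Tth sth tau0 sX Oy).
  exact: (smooth_td_base r1 sXx Oy).
have [m sm Xm] := fibre_constant crd sU sXx Xxx0.
have sW : smooth U (fun p => m p.1 * p.2).
  by apply: smoothM => //; [exact: smooth_t_projection|exact: smooth_snd].
have sV : smooth U (fun p => X p - m p.1 * p.2) by exact: smoothB.
have Vx0 p : U p -> 'D_(px K) (fun p => X p - m p.1 * p.2) p = 0.
  move=> Up.
  have dX := smooth_differentiable sX Up; have dW := smooth_differentiable sW Up.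
  have dm := smooth_differentiable (smooth_t_projection oU sm) Up.
  have ds := smooth_differentiable (smooth_snd oU) Up.
  rewrite (derive_fD (px K) dX (differentiableN dW)) (derive_fN (px K) dW).
  rewrite (derive_fM (px K) dm ds) Xm//.
  have Ip : t_projection U p.1 by exists p.
  rewrite (derive_fst (px K) (smooth_differentiable sm Ip)) derive0 mul0r add0r.
  have -> : 'D_(px K) (fun q : plane => q.2) p = 1.
    rewrite (@derive_lin K _ _ _ snd id p (px K))//; first by rewrite derive_id.
    by move=> q; exact: cvg_snd.
  by rewrite mulr1 subrr.
have [n0 sn0 Vn0] := fibre_constant crd sU sV Vx0.
have Xaff p : U p -> X p = m p.1 * p.2 + n0 p.1.
  by move=> Up; rewrite -(Vn0 p Up) addrC subrK.
have top j t : (r - 2 <= j)%N -> (j < r)%N -> t_projection U t -> coefs theta m r j t = 0.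
  move=> rj jr [p Up <-]; have [E [E' [z [bz Ez Mz]]]] := loc p Up.
  have Oz : over U z by rewrite /over/= bz.
  have -> : p.1 = jt z by rewrite -bz.
  exact: (coefs_top_zero r1 oU Tth sth tau0 sm sn0 Xaff Oz Ez Mz rj jr).
have top1 t : t_projection U t -> coefs theta m r r.-1 t = 0.
  by apply: top; lia.
have top2 t : t_projection U t -> coefs theta m r r.-2 t = 0.
  by apply: top; lia.
have m0 t : t_projection U t -> m t != 0.
  by move=> [p Up <-]; rewrite -Xm//; have [] := Jp p Up.
have It0 : t_projection U p0.1 by exists p0.
have Dm t : t_projection U t ->
    'D_1 m t = (r%:R - 1) / 2 * log_speed theta t * m t.
  exact: (derive_multiplier r1 oU top1).
have Ds t : t_projection U t ->
    'D_1 (log_speed theta) t = log_speed theta t ^+ 2 / 2.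
  exact: (schwarzian_zero r1 oU sth tau0 sm top1 top2 m0).
have [a [b [g [d [C [det0 CE w0 H]]]]]] :=
  moebius_integration crd oI cI sth sm tau0 Dm Ds r0 It0.
exists (MoebiusData a b g d C n0).
  by split=> //=; rewrite CE m0.
move=> p Up; have Ip : t_projection U p.1 by exists p.
by have [Hth Hm] := H _ Ip; rewrite Tth// Xaff// /T_of /X_of/= Hth Hm.
Qed.

(** The test equation is x^(r) = 0, whose arbitrary elements have the constant value 0. The covering
    condition supplies one of its jets over each point, and openness of [Om] a neighbourhood of that
    jet. *)
Lemma equivalence_form (Om : set (joint K r)) (T X : plane -> K)
    (Th : joint K r -> arbval K r) :
  equivalence_transformation T X Om Th ->
  exists2 m : parameters K, valid_parameters (plane_projection Om) m &
    forall p, plane_projection Om p -> T p = T_of m p /\ X p = X_of r m p.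
Proof.
move=> eqT; have r0 : (0 < r)%N := ltnW r1.
have [oOm ptT _ cov gen] := eqT.
apply: moebius_form => //; first exact: equivalence_derive_x eqT.
move=> p Up; have [z [bz Oz Ez]] := cov p 0 Up.
have E0 t : arb (slope_equation r p.1 0) t = 0 by rewrite arb_slope mul0r scale0r.
have [E' gE'] := gen (slope_equation r p.1 0).
exists (slope_equation r p.1 0), E', z; split=> //.
  by rewrite /on_equation E0.
have nOm : \forall y \near z, Om (joint_pt y 0).
  have cj : continuous (fun y : jet => joint_pt y 0 : joint K r).
    have lin : linear (fun y : jet => joint_pt y 0 : joint K r).
      by move=> a u v; rewrite -joint_ptZ -joint_ptD scaler0 addr0.
    pose L : {linear jet -> joint K r} := HB.pack
      (fun y : jet => joint_pt y 0 : joint K r) (GRing.isLinear.Build _ _ _ _ _ lin).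
    exact: (@row_linear_continuous K _ _ L).
  by apply: (cj z); apply: open_nbhs_nbhs.
apply: filterS nOm => y Oy Ey.
by have [|_ _ [+ _]] := gE' y I; [rewrite E0|apply].
Qed.

Lemma admissible_form (U : set plane) (T X : plane -> K) (E E' : equation K r) :
  (3 <= r)%N -> admissible T X U E E' ->
  exists2 m : parameters K, valid_parameters U m &
    forall p, U p -> T p = T_of m p /\ X p = X_of r m p.
Proof.
move=> r3 adm; have [ptT [domU eqU]] := adm.
have [[oU _ _ _] sT sX _] := ptT.
have Tx0 := admissible_derive_x r3 adm.
apply: moebius_form => // p Up.
exists E, E'; pose z := onto_equation (arb E p.1) (mkjet r p.1 (fun=> p.2)).
have r0 : (0 < r)%N := ltnW r1.
have bz : base z = p.
  rewrite [RHS]surjective_pairing /base jt_onto_equation jt_mkjet.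
  by rewrite jx_onto_equation// jx_mkjet.
exists z; split=> //.
  rewrite /on_equation (_ : jt z = p.1); last by rewrite -[jt z]/((base z).1) bz.
  exact: onto_equationP.
have Oz : over U z by rewrite /over/= bz.
have oO := @open_over K r _ oU.
apply: (open_near oO Oz) => y Oy Ey.
(* With T_x = 0 this is T_t, a factor of the Jacobian. *)
have D0 : DT T y != 0.
  rewrite (DTE r0 sT)// Tx0// mulr0 addr0.
  have [_ _ _ J0] := ptT; have := J0 _ Oy.
  rewrite /plane_jacobian -/(pt K) -/(px K) Tx0// mul0r subr0 mulf_eq0 negb_or.
  by case/andP.
exact: (eqU y Oy D0).1 Ey.
Qed.

End MoebiusForm.

(** * Moebius transformations as equivalence transformations *)

Section MoebiusSpeed.
Variables (K : numFieldType) (I : set K) (a b g d : K).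
Hypotheses (oI : open I) (det0 : a * d - b * g != 0).
Hypothesis w0 : forall t, I t -> g * t + d != 0.

Definition moebius (t : K) : K := (a * t + b) / (g * t + d).
Local Notation w := (fun t : K => g * t + d).
Local Notation Delta := (a * d - b * g).

Let sw : smooth I w := smooth_affine1 oI g d.
Let swV : smooth I (fun t => (w t)^-1) := smoothV oI w0 sw.

Lemma smooth_moebius : smooth I moebius.
Proof. by apply: smoothM => //; exact: smooth_affine1. Qed.

Lemma speed_moebius t : I t -> speed moebius t = Delta / w t ^+ 2.
Proof.
move=> It; rewrite /speed (smooth_deriveM (smooth_affine1 oI a b) swV It).
rewrite derive_affine1 (smooth_deriveV sw (w0 It) It) derive_affine1.
by have := w0 It => w0t; field.
Qed.

Lemma speed_moebius_neq0 t : I t -> 'D_1 moebius t != 0.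
Proof.
move=> It; rewrite -/(speed moebius t) speed_moebius// mulf_neq0//.
by rewrite invr_neq0// expf_neq0// w0.
Qed.

Lemma log_speed_moebius t : I t -> log_speed moebius t = - (2 * (g / w t)).
Proof.
move=> It; rewrite /log_speed (derive_eq_on oI speed_moebius It) speed_moebius//.
have sw2 : smooth I (fun t => w t ^+ 2) by exact: smoothX.
have w20 s : I s -> w s ^+ 2 != 0 by move=> Is; rewrite expf_neq0// w0.
rewrite (smooth_deriveM (smooth_cst Delta oI) (smoothV oI w20 sw2) It).
rewrite derive_cst mul0r add0r (smooth_deriveV sw2 (w20 t It) It).
rewrite (smooth_deriveX oI 2 sw It) derive_affine1 /=.
by have := w0 It => w0t; field; rewrite w0t det0.
Qed.

Variables (r : nat) (C : K).
Hypothesis r0 : (0 < r)%N.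
Definition multiplier (t : K) : K := C / (g * t + d) ^+ r.-1.
Local Notation M := multiplier.
Local Notation rho := (fun t : K => g / (g * t + d)).

Lemma smooth_multiplier : smooth I M.
Proof.
apply: smoothM => //; first exact: smooth_cst.
apply: smoothV => //; last exact: smoothX.
by move=> t It; rewrite expf_neq0// w0.
Qed.

Lemma derive_multiplier_moebius t : I t ->
  'D_1 M t = - (r%:R - 1) * rho t * M t.
Proof.
move=> It; have swr : smooth I (fun t => w t ^+ r.-1) by exact: smoothX.
have wr0 s : I s -> w s ^+ r.-1 != 0 by move=> Is; rewrite expf_neq0// w0.
rewrite /M (smooth_deriveM (smooth_cst C oI) (smoothV oI wr0 swr) It).
rewrite derive_cst mul0r add0r (smooth_deriveV swr (wr0 t It) It).
rewrite (smooth_deriveX oI r.-1 sw It) derive_affine1.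
have := w0 It; move: (g * t + d) => W W0.
case: (r) r0 => [//|[|l]] _ /=; first by rewrite !mul0r subrr oppr0 !mul0r mulr0.
rewrite -(natr1 l.+1) addrK expr2 !(exprS W l).
have := expf_neq0 l W0; move: (W ^+ l) (l.+1%:R : K) => V n V0.
by field; rewrite W0 V0.
Qed.

Lemma smooth_rho : smooth I rho.
Proof. by apply: smoothM => //; exact: smooth_cst. Qed.

Lemma derive_rho t : I t -> 'D_1 rho t = - rho t ^+ 2.
Proof.
move=> It; rewrite (smooth_deriveM (smooth_cst g oI) swV It).
rewrite derive_cst mul0r add0r (smooth_deriveV sw (w0 It) It) derive_affine1.
by have := w0 It => w0t; field.
Qed.

(* The factor i = r - 1 makes [bol r j] vanish for j < r: this is Bol's lemma. *)
Definition bol (k j : nat) : K :=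
  'C(k, j)%:R * \prod_(j <= i < k) (i%:R - (r%:R - 1)).

Lemma bol_diag k : bol k k = 1.
Proof. by rewrite /bol binn big_geq// mulr1. Qed.

Lemma bol_rec0 k : bol k.+1 0 = (k%:R - (r%:R - 1)) * bol k 0.
Proof. by rewrite /bol !bin0 big_nat_recr//= !mul1r mulrC. Qed.

Lemma bol_rec k j : (j < k)%N ->
  bol k.+1 j.+1 = (k%:R + j.+1%:R - (r%:R - 1)) * bol k j.+1 + bol k j.
Proof.
move=> jk; rewrite /bol binS natrD big_nat_recr//=.
rewrite [X in _ + _ * X](big_ltn jk)/=.
have bl : (j.+1%:R : K) * 'C(k, j.+1)%:R = (k%:R - j%:R) * 'C(k, j)%:R.
  by rewrite -natrB ?(ltnW jk)// -!natrM mul_bin_left.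
move: bl; rewrite -(natr1 j).
move: ('C(k, j.+1)%:R) ('C(k, j)%:R) (\prod_(_ <= _ < _) _) => x y P bl.
have -> : (k%:R + (j%:R + 1) - (r%:R - 1)) * (x * P) + y * ((j%:R - (r%:R - 1)) * P) =
  (k%:R - (r%:R - 1)) * x * P + ((j%:R + 1) * x) * P + y * ((j%:R - (r%:R - 1)) * P) by ring.
by rewrite bl; ring.
Qed.

Lemma bol_zero j : (j < r)%N -> bol r j = 0.
Proof.
move=> jr; rewrite /bol; have -> : r = r.-1.+1 by rewrite prednK.
rewrite big_nat_recr/=; last by rewrite -ltnS prednK.
by rewrite -[in r.-1.+1%:R](natr1 r.-1) addrK subrr !mulr0.
Qed.

Local Notation c := (coefs moebius M).

(** With rho = g/w one has sigma = -2 rho, M' = -(r-1) rho M and rho' = -rho^2. Differentiation thus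
    multiplies M rho^l by a constant times rho, and the recursion for the coefficients becomes the
    numerical one of [bol]. *)
Lemma coefs_moebius k j t : I t -> (j <= k)%N ->
  c k j t = M t * bol k j * rho t ^+ (k - j).
Proof.
elim: k j t => [|k IH] j t It jk.
  move: jk; rewrite leqn0 => /eqP ->.
  by rewrite bol_diag expr0 !mulr1.
have [->|jk'] := eqVneq j k.+1.
  by rewrite bol_diag subnn expr0 !mulr1 coefs_diag.
have {jk jk'}jk : (j <= k)%N by move: jk; rewrite leq_eqVlt (negPf jk') ltnS.
have sB : smooth I (fun _ => bol k j) by exact: smooth_cst.
have sMB := smoothM oI smooth_multiplier sB.
have srho := smoothX (k - j) oI smooth_rho.
have E s : I s -> c k j s = M s * bol k j * rho s ^+ (k - j) by move=> Is; exact: IH.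
have Dckj : 'D_1 (c k j) t = - (r%:R - 1 + (k - j)%:R) * rho t * c k j t.
  rewrite (derive_eq_on oI E It) (smooth_deriveM sMB srho It).
  rewrite (smooth_deriveM smooth_multiplier sB It) derive_cst mulr0 addr0.
  rewrite (smooth_deriveX oI (k - j) smooth_rho It) derive_rho//.
  rewrite derive_multiplier_moebius// E//.
  move: (rho t) (M t) => x y.
  case: (k - j)%N => [|l] /=; first by rewrite !expr0; ring.
  by rewrite !exprS; ring.
have Drec : c k.+1 j t = 'D_1 (c k j) t +
    (if j is i.+1 then c k i t else 0) - k%:R * log_speed moebius t * c k j t by [].
rewrite Drec Dckj log_speed_moebius// {Drec Dckj}.
have jkR : ((k - j)%:R : K) = k%:R - j%:R by rewrite natrB.
rewrite jkR (IH j t It jk) subSn// exprS.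
case: j jk {sB sMB srho E jkR} => [|j] jk.
  by rewrite bol_rec0 subn0; move: (rho t) (M t) => x y; ring.
rewrite bol_rec// (IH j t It (ltnW jk)).
have -> : (k - j = (k - j.+1).+1)%N by rewrite subnSK.
rewrite exprS; move: (rho t) (M t) => x y; ring.
Qed.

Lemma coefs_bol j t : I t -> (j < r)%N -> c r j t = 0.
Proof.
by move=> It jr; rewrite coefs_moebius ?(ltnW jr)// bol_zero// mulr0 mul0r.
Qed.

End MoebiusSpeed.

Section SmoothMatrices.
Variables (K : numFieldType) (V : normedModType K) (O : set V).
Hypothesis oO : open O.

Lemma smooth_det n (A : V -> 'M[K]_n) : (forall i j, smooth O (fun v => A v i j)) ->
  smooth O (fun v => \det (A v)).
Proof.
move=> sA; apply: smooth_sum => // s; apply: smoothM => //.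
  exact: smooth_cst.
by apply: smooth_prod => // i; exact: sA.
Qed.

Lemma smooth_invmx n (A : V -> 'M[K]_n) :
  (forall i j, smooth O (fun v => A v i j)) ->
  (forall v, O v -> A v \in unitmx) ->
  forall i j, smooth O (fun v => invmx (A v) i j).
Proof.
move=> sA uA i j.
apply: (smooth_eq oO (f := fun v => (\det (A v))^-1 * cofactor (A v) j i)).
  by move=> v /uA uAv; rewrite /invmx uAv !mxE.
apply: smoothM => //.
  apply: smoothV => //; last exact: smooth_det.
  by move=> v /uA; rewrite unitmxE unitfE.
apply: smoothM => //; first exact: smooth_cst.
apply: smooth_det => k l.
by under eq_fun do rewrite !mxE; exact: sA.
Qed.

End SmoothMatrices.

(** * The action of a Moebius transformation on the arbitrary elements *)

Section ImageEquation.
Variables (K : numFieldType) (r : nat).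
Local Notation jet := (jet K r).
Local Notation plane := (plane K).
Local Notation arbval := (arbval K r).
Local Notation joint := (joint K r).
Variables (U : set plane) (m : parameters K) (T X : plane -> K).
Hypotheses (r1 : (1 < r)%N) (oU : open U) (vm : valid_parameters U m).
Hypothesis T_m : forall p, U p -> T p = T_of m p.
Hypothesis X_m : forall p, U p -> X p = X_of r m p.
Local Notation I := (t_projection U).
Local Notation O := (@over K r U).
Local Notation theta := (moebius (alpha m) (beta m) (gamma m) (delta m)).
Local Notation M := (multiplier (gamma m) (delta m) r (C m)).
Local Notation tau := (speed theta).
Local Notation c := (coefs theta M).
Local Notation n := (offset theta (X0 m)).

Let oI : open I := open_t_projection oU.
Let det0 : alpha m * delta m - beta m * gamma m != 0. Proof. by case: vm. Qed.
Let C0 : C m != 0. Proof. by case: vm. Qed.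
Let sX0 : smooth I (X0 m). Proof. by case: vm. Qed.
Let w0 t : I t -> gamma m * t + delta m != 0. Proof. by case: vm => _ _ _; apply. Qed.
Let r0 : (0 < r)%N := ltnW r1.
Let sth : smooth I theta := smooth_moebius _ _ oI w0.
Let tau0 t : I t -> 'D_1 theta t != 0.
Proof. by move=> It; exact: (speed_moebius_neq0 oI det0 w0). Qed.
Let stau : smooth I tau := smooth_tau sth.
Let sM : smooth I M := smooth_multiplier oI w0 r (C m).
Let T_theta p : U p -> T p = theta p.1. Proof. exact: T_m. Qed.
Let X_affine p : U p -> X p = M p.1 * p.2 + X0 m p.1. Proof. exact: X_m. Qed.
Let sX : smooth U X := smooth_affineX oU sM sX0 X_affine.
Let sT : smooth U T := smooth_fibredT oU T_theta sth.
Let M0 t : I t -> M t != 0.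
Proof. by move=> It; rewrite mulf_neq0// invr_neq0// expf_neq0// w0. Qed.

Lemma prolonged_moebius k z : (k <= r)%N -> O z ->
  prolonged_derivative T X k z =
  (\sum_(j < k.+1) c k j (jt z) * jx z j + n k (jt z)) / tau (jt z) ^+ k.
Proof.
move=> kr Oz; have := S_affine oU T_theta sth tau0 sM sX0 X_affine kr Oz.
rewrite /scaled_derivative => <-; rewrite mulrAC divff ?mul1r//.
by rewrite expf_neq0//; exact/tau0/over_t.
Qed.

Definition low_matrix (t : K) : 'M[K]_(r - 2) :=
  \matrix_(k, j) (c k j t / tau t ^+ k).

Definition top_factor (t : K) : K := M t / tau t ^+ r.

(** The image equation is the original one multiplied by [top_factor], the coefficient of x_r in the
    new r-th derivative. The new coefficients a' therefore solve a' L = f a, with L the triangular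
    matrix expressing the new low derivatives through the old ones. *)
Definition image_coef (t : K) (a : 'rV[K]_(r - 2)) : 'rV[K]_(r - 2) :=
  top_factor t *: (a *m invmx (low_matrix t)).

Definition image_rhs (t : K) (th : arbval) : K :=
  top_factor t * av_b th + n r t / tau t ^+ r +
  \sum_(k < r - 2) image_coef t (lsubmx th) 0 k * (n k t / tau t ^+ k).

Definition image_arb (t : K) (th : arbval) : arbval :=
  row_mx (image_coef t (lsubmx th)) (const_mx (image_rhs t th)).

Lemma low_matrix_unit t : I t -> low_matrix t \in unitmx.
Proof.
move=> It; rewrite unitmxE unitfE det_trig.
  apply/prodf_neq0 => k _; rewrite mxE coefs_diag mulf_neq0//; first exact: M0.
  by rewrite invr_neq0// expf_neq0//; exact: tau0.
by apply/is_trig_mxP => i j ij; rewrite mxE coefs_gt// mul0r.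
Qed.

Lemma top_factor_neq0 t : I t -> top_factor t != 0.
Proof.
move=> It; rewrite mulf_neq0//; first exact: M0.
by rewrite invr_neq0// expf_neq0//; exact: tau0.
Qed.

Lemma prolonged_low (k : 'I_(r - 2)) z : O z ->
  prolonged_derivative T X k z =
  \sum_(j < r - 2) low_matrix (jt z) k j * jx z j + n k (jt z) / tau (jt z) ^+ k.
Proof.
move=> Oz; have kr := ltn_ord k; rewrite prolonged_moebius//; last by lia.
rewrite mulrDl; congr (_ + _); rewrite mulr_suml.
rewrite (big_ord_widen _ (fun j => c k j (jt z) * jx z j / tau (jt z) ^+ k) kr).
rewrite big_mkcond; apply: eq_bigr => j _; rewrite mxE.
case: ltnP => [_|kj]; first by rewrite mulrAC.
by rewrite coefs_gt// !mul0r.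
Qed.

Lemma prolonged_top z : O z -> prolonged_derivative T X r z =
  top_factor (jt z) * jx z r + n r (jt z) / tau (jt z) ^+ r.
Proof.
move=> Oz; rewrite prolonged_moebius// mulrDl; congr (_ + _).
rewrite big_ord_recr big1 /= ?add0r => [|j _].
  by rewrite coefs_diag mulrAC.
by rewrite (coefs_bol oI det0 w0 (C m) r0 (over_t Oz) (ltn_ord j)) mul0r.
Qed.

Lemma av_a_image t th k : av_a (image_arb t th) k = image_coef t (lsubmx th) 0 k.
Proof. by rewrite /av_a row_mxEl. Qed.

Lemma av_b_image t th : av_b (image_arb t th) = image_rhs t th.
Proof. by rewrite /av_b row_mxEr mxE. Qed.

(** The left-hand side of the image equation is [top_factor] times the original one plus a function
    of t and the arbitrary elements, which [image_rhs] absorbs. Bol's lemma is what keeps other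
    orders out of the r-th derivative. *)
Lemma image_arbP z th : O z ->
  Defs.eq_holds th z <-> Defs.eq_holds (image_arb (jt z) th) (prolongation T X z).
Proof.
move=> Oz; set t := jt z; have It : I t := over_t Oz.
rewrite /Defs.eq_holds jx_prolongation// av_b_image prolonged_top// -/t.
under [X in _ <-> _ + X = _]eq_bigr => k _.
  rewrite av_a_image jx_prolongation; last by have := ltn_ord k; lia.
  rewrite prolonged_low// mulrDr -/t; over.
rewrite big_split/=.
have -> : \sum_(k < r - 2) image_coef t (lsubmx th) 0 k *
     (\sum_(j < r - 2) low_matrix t k j * jx z j) =
   top_factor t * \sum_(j < r - 2) av_a th j * jx z j.
  under eq_bigr do rewrite mulr_sumr.
  rewrite exchange_big/= mulr_sumr; apply: eq_bigr => j _.
  under eq_bigr do rewrite mulrA.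
  rewrite -mulr_suml mulrA; congr (_ * _).
  transitivity ((image_coef t (lsubmx th) *m low_matrix t) 0 j); first by rewrite mxE.
  rewrite /image_coef -scalemxAl mulmxKV ?low_matrix_unit// !mxE.
  by [].
rewrite /image_rhs; set s := \sum_(k < r - 2) _ * (n _ _ / _).
set x := jx z r; set y := \sum_(j < _) _; set N := n r t / _.
have f0 := top_factor_neq0 It; set f := top_factor t in f0 *.
split=> [<-|H]; first by ring.
apply: (mulfI f0); apply: (addIr (N + s)).
by transitivity (f * x + N + (f * y + s)); [ring|rewrite H; ring].
Qed.

Let ssmooth_c k j : smooth I (c k j) := smooth_coefs oU sth tau0 sM k j.
Let ssmooth_n k : smooth I (n k) := smooth_offset oU sth tau0 sX0 k.
Let stauV k : smooth I (fun t => (tau t ^+ k)^-1).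
Proof.
apply: smoothV => //; last exact: smoothX.
by move=> t It; rewrite expf_neq0//; exact: tau0.
Qed.

Section SmoothImage.
Variables (V : normedModType K) (B : set V) (t : V -> K) (th : V -> arbval).
Hypotheses (oB : open B) (BI : forall v, B v -> I (t v)) (st : smooth B t).
Hypothesis sthc : forall j, smooth B (fun v => th v 0 j).

Let sI (f : K -> K) : smooth I f -> smooth B (fun v => f (t v)).
Proof. exact: smooth_comp1. Qed.

Lemma smooth_image_coef k : smooth B (fun v => image_coef (t v) (lsubmx (th v)) 0 k).
Proof.
have slow i j : smooth B (fun v => low_matrix (t v) i j).
  under eq_fun do rewrite mxE.
  by apply: (sI (f := fun t => c i j t / tau t ^+ i)); exact: smoothM.
have sf : smooth B (fun v => top_factor (t v)).
  by apply: sI; exact: smoothM.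
under eq_fun do rewrite !mxE; apply: smoothM => //.
apply: smooth_sum => // i; apply: smoothM => //.
  by under eq_fun do rewrite mxE; exact: sthc.
by apply: smooth_invmx => // v Bv; apply: low_matrix_unit; exact: BI.
Qed.

Lemma smooth_image_arb j : smooth B (fun v => image_arb (t v) (th v) 0 j).
Proof.
rewrite /image_arb; case: (split_ordP j) => k ->.
  by under eq_fun do rewrite row_mxEl; exact: smooth_image_coef.
under eq_fun do rewrite row_mxEr mxE; rewrite /image_rhs.
apply: smoothD => //.
  apply: smoothD => //; last by apply: (sI (f := fun t => n r t / tau t ^+ r)); exact: smoothM.
  apply: smoothM => //; last exact: sthc.
  by apply: sI; exact: smoothM.
apply: smooth_sum => // i; apply: smoothM => //; first exact: smooth_image_coef.
by apply: (sI (f := fun t => n i t / tau t ^+ i)); exact: smoothM.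
Qed.

End SmoothImage.

Definition theta_inv (s : K) : K := (delta m * s - beta m) / (alpha m - gamma m * s).

Lemma theta_invK t : I t ->
  alpha m - gamma m * theta t != 0 /\ theta_inv (theta t) = t.
Proof.
move=> It; have W0 := w0 It.
have E1 : alpha m - gamma m * theta t =
    (alpha m * delta m - beta m * gamma m) / (gamma m * t + delta m).
  by rewrite /moebius; field.
have n1 : alpha m - gamma m * theta t != 0.
  by rewrite E1 mulf_neq0// invr_neq0.
split=> //; rewrite /theta_inv E1 /moebius.
by field; rewrite W0 det0.
Qed.

Section Image.
Variable E : equation K r.

(** At a zero of its denominator [theta_inv] has the default value 0, which may lie in the domain of
    E; such points have to be excluded explicitly. *)
Definition image_dom : set K :=
  (setT `&` [set s | alpha m - gamma m * s != 0]) `&`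
  (theta_inv @^-1` (I `&` dom E)).

Let smooth_den (A : set K) : open A -> smooth A (fun s => alpha m - gamma m * s).
Proof.
move=> oA; apply: (smooth_eq oA (f := fun s => (- gamma m) * s + alpha m)).
  by move=> s _; rewrite mulNr addrC.
exact: smooth_affine1.
Qed.

Let oA : open ((setT : set K) `&` [set s | alpha m - gamma m * s != 0]).
Proof. by apply: open_neq0; [exact: openT|apply: smooth_den; exact: openT]. Qed.

Let smooth_theta_inv : smooth ((setT : set K) `&` [set s | alpha m - gamma m * s != 0]) theta_inv.
Proof.
apply: smoothM => //; last by apply: smoothV => //; [move=> s []|exact: smooth_den].
exact: smooth_affine1.
Qed.

Lemma open_image_dom : open image_dom.
Proof.
have oE : open (I `&` dom E) by apply: openI => //; exact: dom_open.
rewrite openE => s [As Is]; apply: filterI; first exact: open_nbhs_nbhs.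
by apply: (smooth_continuous smooth_theta_inv As); exact: open_nbhs_nbhs.
Qed.

Lemma smooth_image_equation j :
  smooth image_dom (fun s => image_arb (theta_inv s) (arb E (theta_inv s)) 0 j).
Proof.
have oD := open_image_dom.
have st : smooth image_dom theta_inv by apply: smooth_sub smooth_theta_inv => s [].
apply: smooth_image_arb => //; first by move=> s [_ []].
move=> i; apply: (smooth_comp1 oD (A := dom E) (f := theta_inv)
  (g := fun t => arb E t 0 i)) => //; first by move=> s [_ []].
rewrite /arb; case: (split_ordP i) => k ->.
  by under eq_fun do rewrite row_mxEl mxE; exact: coef_smooth.
by under eq_fun do rewrite row_mxEr mxE; exact: rhs_smooth.
Qed.

Definition image_equation : equation K r :=
  @Equation K r image_dom
    (fun k s => image_arb (theta_inv s) (arb E (theta_inv s)) 0 (lshift 1 k))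
    (fun s => image_arb (theta_inv s) (arb E (theta_inv s)) 0 (rshift (r - 2) ord0))
    open_image_dom (fun k => smooth_image_equation (lshift 1 k))
    (smooth_image_equation (rshift (r - 2) ord0)).

Lemma arb_image t : I t -> arb image_equation (theta t) = image_arb t (arb E t).
Proof.
move=> It; have [_ tK] := theta_invK It.
apply/rowP => j; rewrite {1}/arb; case: (split_ordP j) => k ->.
  by rewrite row_mxEl mxE /= tK.
by rewrite row_mxEr mxE /= tK (ord1 k).
Qed.

Lemma image_domP t : I t -> dom E t -> dom image_equation (theta t).
Proof. by move=> It Et; have [n1 tK] := theta_invK It; split; [split|rewrite /= tK]. Qed.

End Image.

Definition image_joint (w : joint) : arbval :=
  image_arb (jt (joint_jet w)) (joint_arb w).

Lemma plane_projection_cylinder : plane_projection (@cylinder K r U) = U.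
Proof.
apply/seteqP; split=> [p [w Uw <-]//|p Up].
exists (joint_pt (mkjet r p.1 (fun=> p.2)) 0).
  by rewrite /cylinder/= joint_ptK /base jt_mkjet jx_mkjet// -surjective_pairing.
by rewrite joint_ptK /base jt_mkjet jx_mkjet// -surjective_pairing.
Qed.

Lemma open_cylinder : open (@cylinder K r U).
Proof.
have -> : @cylinder K r U = @joint_jet K r @^-1` O by [].
by apply: open_comp => [w _|]; [exact: joint_jet_continuous|exact: open_over].
Qed.

Lemma smooth_image_joint : smooth (@cylinder K r U) image_joint.
Proof.
have oC := open_cylinder.
apply: row_smooth => // j; apply: smooth_image_arb => //.
- by move=> w Cw; exact: over_t.
- by apply: (smooth_joint_jet (O := O)); [exact: open_over|apply: smooth_jt; exact: open_over].
move=> i; rewrite /joint_arb; under eq_fun do rewrite mxE.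
exact: smooth_coord.
Qed.

Lemma image_generates E : generates T X (@cylinder K r U) image_joint E (image_equation E).
Proof.
move=> z Ez Cz; have Oz : O z by move: Cz; rewrite /cylinder/= joint_ptK.
have It := over_t Oz; have Tz : T (base z) = theta (jt z) by rewrite T_theta.
rewrite Tz; split; first exact: image_domP.
  by rewrite /image_joint joint_ptK /joint_arb row_mxKr arb_image.
rewrite /on_equation jt_prolongation Tz arb_image//.
exact: image_arbP.
Qed.

Lemma derive_along (V W : normedModType K) (f : V -> W) (p v : V) (g : W) :
  (\forall h \near (0 : K), f (h *: v + p) = f p + h *: g) -> 'D_v f p = g.
Proof.
move=> H; apply: cvg_lim => //; apply: cvg_near_cst; near=> h.
have h0 : h != 0 by near: h; exact: nbhs_dnbhs_neq.
have E : f (h *: v + p) = f p + h *: g by near: h; exact: nbhs_dnbhs.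
by rewrite /= E addrC addKr scalerA mulVf// scale1r.
Unshelve. all: by end_near. Qed.

Lemma image_coef_linear t : linear (image_coef t).
Proof.
move=> a x y; rewrite /image_coef mulmxDl scalerDr -scalemxAl.
by rewrite !scalerA mulrC.
Qed.

Lemma joint_jet_linear (h : K) (v w : joint) :
  joint_jet (h *: v + w) = h *: joint_jet v + joint_jet w.
Proof. by rewrite /joint_jet linearP. Qed.

Lemma jt_joint_jet (w : joint) : jt (joint_jet w) = w 0 (lshift _ ord0).
Proof. by rewrite /jt mxE. Qed.

Lemma regular_cylinder w : @cylinder K r U w -> regular U T (joint_jet w).
Proof. by move=> Cw; exact: regular_over T_theta sth tau0 _ Cw. Qed.

(** The Jacobian is block triangular, and a kernel vector is killed one component at a time: t by
    theta', then x_k in increasing order by the diagonal entry M/theta'^k, then the coefficients by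
    the invertible low matrix, and finally the right-hand side by [top_factor]. *)
Lemma image_joint_nondegenerate w : @cylinder K r U w ->
  \det (jacobian (joint_map T X image_joint) w) != 0.
Proof.
move=> Cw; apply/negP => /det0P[v /eqP vn0 vJ]; apply: vn0.
have dJ : differentiable (joint_map T X image_joint) w.
  have sJ := smooth_joint_map oU sT sX open_cylinder regular_cylinder smooth_image_joint.
  exact: smooth_differentiable sJ Cw.
have DJ : 'D_v (joint_map T X image_joint) w = 0 by rewrite deriveEjacobian.
have Dj j : 'D_v (fun w => joint_map T X image_joint w 0 j) w = 0.
  by rewrite (derive_row_coord v j dJ) DJ mxE.
pose z := joint_jet w; pose vz := joint_jet v; pose vth := joint_arb v.
have Oz : O z by [].
have It : I (jt z) := over_t Oz.
have Dl i : 'D_v (fun w => prolongation T X (joint_jet w) 0 i) w = 0.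
  rewrite -[RHS](Dj (lshift _ i)).
  have -> // : (fun w => joint_map T X image_joint w 0 (lshift (r - 2 + 1) i)) =
    (fun w => prolongation T X (joint_jet w) 0 i).
  by apply/funext => w'; rewrite /joint_map /joint_pt row_mxEl.
have tv : jt vz = 0.
  have := Dl ord0.
  have N : \forall w' \near w, prolongation T X (joint_jet w') 0 ord0 =
      theta (w' 0 (lshift _ ord0)).
    apply: (open_near open_cylinder Cw) => w' Cw'.
    by rewrite -[LHS]/(jt _) jt_prolongation T_theta// -jt_joint_jet.
  rewrite (near_eq_derive _ N).
  have It' : I (w 0 (lshift _ ord0)) by rewrite -jt_joint_jet.
  rewrite (derive_comp1 v (@differentiable_coord _ _ _ w 0 (lshift _ ord0))
    (smooth_differentiable sth It')) derive_coord -!jt_joint_jet.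
  move/eqP; rewrite scaler_eq0 => /orP[/eqP//|].
  by rewrite (negPf (tau0 It)).
have nO : \forall h \near (0 : K), O (h *: vz + z).
  have := line_near vz (open_near (open_over oU) Oz (fun y Oy => Oy)).
  by apply: filterS => h; rewrite addrC.
have xv k : (k <= r)%N -> jx vz k = 0.
  elim/ltn_ind: k => k IH kr.
  have := Dl (inord k.+1).
  rewrite (derive_along (g := (\sum_(j < k.+1) c k j (jt z) * jx vz j) / tau (jt z) ^+ k)).
    move/eqP; rewrite mulf_eq0 invr_eq0 expf_eq0 (negPf (tau0 It)) andbF orbF.
    rewrite big_ord_recr big1 /= ?add0r => [|j _]; last first.
      by rewrite IH ?mulr0//; exact: leq_trans (ltnW (ltn_ord j)) kr.
    by rewrite coefs_diag mulf_eq0 (negPf (M0 It)) => /eqP.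
  apply: filterS nO => h Oh; rewrite joint_jet_linear.
  rewrite -![prolongation _ _ _ _ _]/(jx (prolongation _ _ _) k) !jx_prolongation//.
  rewrite !prolonged_moebius// jtD jtZ tv mulr0 add0r.
  rewrite [in RHS]/GRing.scale/= mulrA -mulrDl; congr (_ / _).
  rewrite addrAC; congr (_ + _); rewrite mulr_sumr -big_split/=.
  by apply: eq_bigr => j _; rewrite jxD jxZ; ring.
have vz0 : vz = 0.
  by apply: jetP => [|k kr]; [rewrite tv /jt mxE|rewrite xv// /jx mxE].
have vE : v = joint_pt 0 vth.
  by rewrite -vz0 /vth /vz /joint_pt /joint_jet /joint_arb hsubmxK.
have Dr i : 'D_v (fun w => image_joint w 0 i) w = 0.
  rewrite -[RHS](Dj (rshift _ i)).
  have -> // : (fun w => joint_map T X image_joint w 0 (rshift r.+2 i)) =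
    (fun w => image_joint w 0 i).
  by apply/funext => w'; rewrite /joint_map /joint_pt row_mxEr.
have jtw h : jt (joint_jet (h *: v + w)) = jt z.
  by rewrite joint_jet_linear -/vz vz0 scaler0 add0r.
have arbw h : joint_arb (h *: v + w) = h *: vth + joint_arb w.
  by rewrite /joint_arb linearP.
have coefw h : image_coef (jt z) (lsubmx (h *: vth + joint_arb w)) =
    h *: image_coef (jt z) (lsubmx vth) + image_coef (jt z) (lsubmx (joint_arb w)).
  by rewrite linearP image_coef_linear.
have a0 : image_coef (jt z) (lsubmx vth) = 0.
  apply/rowP => k; rewrite [RHS]mxE -[RHS](Dr (lshift 1 k)).
  apply/esym/derive_along; apply: filterE => h.
  rewrite /image_joint /image_arb !row_mxEl jtw arbw coefw !mxE.
  by rewrite addrC.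
have lth0 : lsubmx vth = 0.
  move/eqP: a0; rewrite /image_coef scaler_eq0 (negPf (top_factor_neq0 It))/= => /eqP a0.
  by rewrite -(mulmxKV (low_matrix_unit It) (lsubmx vth)) a0 mul0mx.
have b0 : av_b vth = 0.
  have := Dr (rshift (r - 2) ord0).
  rewrite (derive_along (g := top_factor (jt z) * av_b vth)).
    by move/eqP; rewrite mulf_eq0 (negPf (top_factor_neq0 It)) => /eqP.
  apply: filterE => h; rewrite /image_joint /image_arb !row_mxEr !mxE jtw arbw.
  rewrite /image_rhs coefw a0 scaler0 add0r /av_b !mxE /GRing.scale/=; ring.
rewrite vE; have -> : vth = 0.
  apply/rowP => j; case: (split_ordP j) => k ->.
    by have := congr1 (fun N : 'rV[K]_(r - 2) => N 0 k) lth0; rewrite !mxE.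
  by rewrite (ord1 k) [LHS]b0 mxE.
by rewrite /joint_pt row_mx0.
Qed.

Lemma moebius_point_transformation : suitable_domain U -> point_transformation T X U.
Proof.
move=> sU; split=> // p Up; rewrite /plane_jacobian -/(pt K) -/(px K).
have [-> ->] := derive_fibre_constant oU sth T_theta Up.
have Ip : I p.1 by exists p.
rewrite mul0r subr0 mulf_neq0//; first exact: tau0.
have N : \forall q \near p, X q = M q.1 * q.2 + X0 m q.1.
  exact: open_near Up X_affine.
have dM := smooth_differentiable (smooth_t_projection oU sM) Up.
have d0 := smooth_differentiable (smooth_t_projection oU sX0) Up.
have ds := smooth_differentiable (smooth_snd oU) Up.
rewrite (near_eq_derive _ N) (derive_fD (px K) (differentiableM dM ds) d0).
rewrite (derive_fM (px K) dM ds).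
rewrite (derive_fst (px K) (smooth_differentiable sM Ip)) derive0 mul0r add0r.
rewrite (derive_fst (px K) (smooth_differentiable sX0 Ip)) derive0 addr0.
have -> : 'D_(px K) (fun q : plane => q.2) p = 1.
  rewrite (@derive_lin K _ _ _ snd id p (px K))//; first by rewrite derive_id.
  by move=> q; exact: cvg_snd.
by rewrite mulr1; exact: M0.
Qed.

Lemma moebius_equivalence : suitable_domain U ->
  equivalence_transformation T X (@cylinder K r U) image_joint.
Proof.
move=> sU; split.
- exact: open_cylinder.
- rewrite plane_projection_cylinder; exact: moebius_point_transformation.
- split; first exact: smooth_image_joint.
  move=> w Cw; split; last exact: image_joint_nondegenerate.
  by have [] := regular_cylinder Cw.
- move=> p th; rewrite plane_projection_cylinder => Up.
  exists (onto_equation th (mkjet r p.1 (fun=> p.2))).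
  have bz : base (onto_equation th (mkjet r p.1 (fun=> p.2))) = p.
    rewrite [RHS]surjective_pairing /base jt_onto_equation jt_mkjet.
    by rewrite jx_onto_equation// jx_mkjet.
  split=> //; last exact: onto_equationP.
  by rewrite /cylinder/= joint_ptK bz.
- by move=> E; exists (image_equation E); exact: image_generates.
Qed.

End ImageEquation.

(** * Normalization and rescaling *)

Section Uniqueness.
Variables (K : numFieldType) (r : nat).
Local Notation jet := (jet K r).
Local Notation plane := (plane K).
Local Notation arbval := (arbval K r).
Hypothesis r1 : (1 < r)%N.

Lemma linear_part_e_low (th : arbval) (k : 'I_(r - 2)) :
  linear_part th (e_x K r k) = av_a th k.
Proof.
have kr := ltn_ord k; rewrite /linear_part jx_e_x//; last by lia.
rewrite (_ : (r == k) = false) ?add0r; last by lia.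
rewrite (bigD1 k)//= jx_e_x ?eqxx ?mulr1; [|lia|lia].
rewrite big1 ?addr0// => j jk; have jr := ltn_ord j.
by rewrite jx_e_x; [move: jk; rewrite -val_eqE/= => /negPf ->; rewrite mulr0|lia|lia].
Qed.

(** Small moves in the directions x_k with k < r - 2, corrected in x_r to stay on the first
    equation, read off the coefficients of the second; the right-hand sides then agree at [z]. *)
Lemma equation_unique (O : set jet) (th th' : arbval) (z : jet) : open O -> O z ->
  Defs.eq_holds th z ->
  (forall y, O y -> jt y = jt z -> Defs.eq_holds th y -> Defs.eq_holds th' y) ->
  th = th'.
Proof.
move=> oO Oz Ez H; have r0 : (0 < r)%N := ltnW r1.
have Ez' : linear_part th' z = av_b th' by exact: H Ez.
have coefE k : av_a th' k = av_a th k.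
  have kr := ltn_ord k.
  pose v := tangent th (e_x K r k).
  have tv : jt v = 0 by rewrite jt_tangent jt_e_x//; lia.
  have [s s0 Os] := line_point v (open_near oO Oz (fun y Oy => Oy)).
  have := H _ Os (jt_line z s tv) (tangentP _ _ Ez).
  rewrite /Defs.eq_holds -/(linear_part th' _) linear_partD linear_partZ Ez'.
  rewrite -[RHS]addr0 => /addrI/eqP; rewrite mulf_eq0 (negPf s0)/= => /eqP.
  rewrite /v /tangent -scaleNr linear_partD linear_partZ linear_part_e_top mulr1.
  by rewrite !linear_part_e_low => /eqP; rewrite subr_eq0 => /eqP.
apply/rowP => j; case: (split_ordP j) => k ->; first exact/esym/coefE.
rewrite (ord1 k) -[LHS]/(av_b th) -[RHS]/(av_b th') -Ez' -Ez /linear_part.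
by congr (_ + _); apply: eq_bigr => i _; rewrite coefE.
Qed.

End Uniqueness.

Section Normalized.
Variables (R : realType) (K : numFieldType) (crd : coordinates R K) (r : nat).
Local Notation jet := (jet K r).
Local Notation plane := (plane K).
Local Notation arbval := (arbval K r).
Hypothesis r1 : (1 < r)%N.

(** Allows the arbitrary elements of a target equation to be pulled back, so that equations are
    compared in the source, where the jets form an open set. *)
Lemma image_arb_surjective (U : set plane) (m : parameters K) (t : K) (th' : arbval) :
  open U -> valid_parameters U m -> t_projection U t ->
  exists th : arbval, image_arb m t th = th'.
Proof.
move=> oU vm It.
have f0 := top_factor_neq0 r oU vm It; have uL := low_matrix_unit r oU vm It.
pose a := (top_factor r m t)^-1 *: (lsubmx th' *m low_matrix r m t).
have Ea : image_coef m t a = lsubmx th'.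
  by rewrite /image_coef /a -scalemxAl scalerA divff// scale1r mulmxK.
set s := \sum_(k < r - 2) lsubmx th' 0 k *
  (offset (moebius (alpha m) (beta m) (gamma m) (delta m)) (X0 m) k t /
   speed (moebius (alpha m) (beta m) (gamma m) (delta m)) t ^+ k).
set N := offset (moebius (alpha m) (beta m) (gamma m) (delta m)) (X0 m) r t /
   speed (moebius (alpha m) (beta m) (gamma m) (delta m)) t ^+ r.
exists (row_mx a (const_mx ((av_b th' - N - s) / top_factor r m t))).
apply/rowP => j; rewrite /image_arb row_mxKl Ea; case: (split_ordP j) => k ->.
  by rewrite row_mxEl mxE.
rewrite row_mxEr mxE (ord1 k) -[RHS]/(av_b th') /image_rhs row_mxKl Ea.
rewrite [av_b (row_mx _ _)]/av_b row_mxEr mxE -/s -/N mulrC divfK//.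
by ring.
Qed.

Lemma normalized_ge3 : (3 <= r)%N -> normalized K r.
Proof.
move=> r3 E E' U T X adm p Up.
have [m vm Hm] := admissible_form crd r1 r3 adm.
have [[sU sT sX J0] [domU eqU]] := adm; have [oU _ _ _] := sU.
have Tm q : U q -> T q = T_of m q by move=> /Hm[].
have Xm q : U q -> X q = X_of r m q by move=> /Hm[].
exists (@cylinder K r U), (image_joint m).
have PU := plane_projection_cylinder r U.
split; rewrite ?PU//; first exact: moebius_equivalence.
move=> z Ez Cz; have Oz : over U z by move: Cz; rewrite /cylinder/= joint_ptK.
have [_ domE'] := domU _ Oz.
have Dn0 (y : jet) : over U y -> DT T y != 0.
  move=> Oy; have Cy : (@cylinder K r U) (joint_pt y 0) by rewrite /cylinder/= joint_ptK.
  by have [_] := regular_cylinder oU vm Tm Cy; rewrite joint_ptK.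
split=> //; last by apply: eqU => //; exact: Dn0.
rewrite /image_joint joint_ptK /joint_arb row_mxKr.
have It : t_projection U (jt z) := over_t Oz.
(* The pulled-back values [th2] define an equation containing every jet of [E] over U at this t; by
   uniqueness they are the values of [E]. *)
have [th2 E2] := image_arb_surjective (arb E' (T (base z))) oU vm It.
rewrite -E2; congr image_arb.
have oO := @open_over K r _ oU.
pose y := onto_equation (arb E (jt z)) z.
have ty : jt y = jt z by exact: jt_onto_equation.
have by' : base y = base z.
  by rewrite /base ty jx_onto_equation//; exact: ltnW.
apply: (@equation_unique K r r1 (over U) _ _ y) => //.
- by rewrite /over/= by'.
- exact: onto_equationP.
move=> x Ox; rewrite ty => tx Ex.
apply/(image_arbP r1 oU vm Tm Xm th2 Ox); rewrite tx E2.
have Tx : T (base x) = T (base z).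
  by rewrite !Tm// /T_of -![(base _).1]/(jt _) tx.
have Exx : on_equation E x by rewrite /on_equation tx.
have := (eqU x Ox (Dn0 x Ox)).1 Exx.
by rewrite /on_equation jt_prolongation Tx.
Qed.

End Normalized.

(** * Parameters up to rescaling *)

Section Rescaling.
Variables (K : numFieldType) (r : nat).
Local Notation plane := (plane K).

Lemma open_ball_sub (V : normedModType K) (A : set V) p : open A -> A p ->
  exists2 e : K, 0 < e & ball p e `<=` A.
Proof.
move=> oA Ap; have /nbhs_ballP[e e0 eA] : nbhs p A by exact: open_nbhs_nbhs.
by exists e.
Qed.

(** Three points t0 and t0 + h, t0 - h suffice: their second difference is 2 h^2 [q2]. *)
Lemma quadratic_zero (A : set K) (t0 q2 q1 q0 : K) : open A -> A t0 ->
  (forall t, A t -> q2 * t ^+ 2 + q1 * t + q0 = 0) -> [/\ q2 = 0, q1 = 0 & q0 = 0].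
Proof.
move=> oA At0 H; have [e e0 eA] := open_ball_sub oA At0.
pose h := e / 2; have h0 : h != 0 by rewrite lt0r_neq0// divr_gt0.
have he : `|h| < e by rewrite gtr0_norm ?divr_gt0// ltr_pdivrMr// ltr_pMr// ltr1n.
have Hp : A (t0 + h).
  by apply: eA; rewrite -ball_normE/= opprD addNKr normrN.
have Hm : A (t0 - h).
  by apply: eA; rewrite -ball_normE/= opprB addrC subrK.
have P0 := H _ At0; have P1 := H _ Hp; have P2 := H _ Hm.
have E2 : q2 = 0.
  have h2 : 2 * h ^+ 2 != 0 by rewrite mulf_neq0 ?pnatr_eq0// expf_neq0.
  apply: (mulfI h2); rewrite mulr0.
  transitivity ((q2 * (t0 + h) ^+ 2 + q1 * (t0 + h) + q0) +
    (q2 * (t0 - h) ^+ 2 + q1 * (t0 - h) + q0) - 2 * (q2 * t0 ^+ 2 + q1 * t0 + q0)).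
    by ring.
  by rewrite P0 P1 P2 mulr0 addr0 subr0.
have E1 : q1 = 0.
  apply: (mulfI h0); rewrite mulr0.
  transitivity ((q2 * (t0 + h) ^+ 2 + q1 * (t0 + h) + q0) -
    (q2 * t0 ^+ 2 + q1 * t0 + q0)); first by rewrite E2; ring.
  by rewrite P0 P1 subr0.
by split=> //; move: P0; rewrite E2 E1 !mul0r !add0r.
Qed.

(** The hypotheses are the coefficients of (a t + b)(g' t + d') - (a' t + b')(g t + d). Multiplied
    by the determinant, the minors [p1], [p2] and [e0] are combinations of these; the factor l is a
    diagonal entry of the second matrix times the inverse of the first. *)
Lemma proportional_moebius (a b g d a' b' g' d' : K) : a * d - b * g != 0 ->
  a * g' - a' * g = 0 -> a * d' + b * g' - a' * d - b' * g = 0 ->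
  b * d' - b' * d = 0 ->
  exists l : K, [/\ a' = l * a, b' = l * b, g' = l * g & d' = l * d].
Proof.
set D := a * d - b * g => D0 q2 q1 q0.
have p1 : a * b' - a' * b = 0.
  apply: (mulfI D0); rewrite mulr0.
  transitivity (- (a ^+ 2 * (b * d' - b' * d) -
    a * b * (a * d' + b * g' - a' * d - b' * g) + b ^+ 2 * (a * g' - a' * g))).
    by rewrite /D; ring.
  by rewrite q0 q1 q2; ring.
have p2 : d * g' - g * d' = 0.
  apply: (mulfI D0); rewrite mulr0.
  transitivity (g ^+ 2 * (b * d' - b' * d) -
    g * d * (a * d' + b * g' - a' * d - b' * g) + d ^+ 2 * (a * g' - a' * g)).
    by rewrite /D; ring.
  by rewrite q0 q1 q2; ring.
have e0 : b * g' - b' * g = 0.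
  apply: (mulfI D0); rewrite mulr0.
  transitivity (d * b * (a * g' - a' * g) - d * g * (a * b' - a' * b) -
    (b * g * (a * d' + b * g' - a' * d - b' * g) -
     (b * d * (a * g' - a' * g) - a * b * (d * g' - g * d')))).
    by rewrite /D; ring.
  by rewrite q1 q2 p1 p2; ring.
exists ((a' * d - b' * g) / D); split; apply: (mulIf D0); rewrite mulrAC divfK//;
  apply/eqP; rewrite -subr_eq0; apply/eqP.
- by transitivity (g * (a * b' - a' * b)); [rewrite /D; ring|rewrite p1 mulr0].
- by transitivity (d * (a * b' - a' * b)); [rewrite /D; ring|rewrite p1 mulr0].
- transitivity (d * (a * g' - a' * g) - g * (b * g' - b' * g)); first by rewrite /D; ring.
  by rewrite q2 e0 !mulr0 subr0.
- transitivity (d * (a * d' + b * g' - a' * d - b' * g) - d * (b * g' - b' * g) -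
     g * (b * d' - b' * d)); first by rewrite /D; ring.
  by rewrite q1 e0 q0 !mulr0 !subr0.
Qed.

Lemma rescaling (U : set plane) (m m' : parameters K) :
  suitable_domain U -> valid_parameters U m -> valid_parameters U m' ->
  ((forall p, U p -> T_of m p = T_of m' p /\ X_of r m p = X_of r m' p)
    <-> rescaled r U m m').
Proof.
move=> [oU [p0 Up0] _ _] [D0 C0 sX w0] [D0' C0' sX' w0'].
have Ip p : U p -> t_projection U p.1 by move=> Up; exists p.
split=> [H|[l l0 [[Ea Eb] [Eg Ed] EC EX]] p Up]; last first.
  have W := w0 _ (Ip p Up); rewrite /T_of /X_of Ea Eb Eg Ed EC EX; last exact: Ip.
  have -> : l * gamma m * p.1 + l * delta m = l * (gamma m * p.1 + delta m) by ring.
  split; first by field; rewrite W l0.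
  rewrite exprMn; have := expf_neq0 r.-1 W; have := expf_neq0 r.-1 l0.
  move: (_ ^+ r.-1) (l ^+ _) => y x x0 y0; congr (_ + _); by field; rewrite x0 y0.
have oI := open_t_projection oU.
have Tq t : t_projection U t -> (alpha m * gamma m' - alpha m' * gamma m) * t ^+ 2 +
    (alpha m * delta m' + beta m * gamma m' - alpha m' * delta m - beta m' * gamma m) * t +
    (beta m * delta m' - beta m' * delta m) = 0.
  move=> It; have W := w0 t It; have W' := w0' t It; move: It => [p Up tE].
  have [+ _] := H p Up; rewrite /T_of tE => /eqP; rewrite eqr_div// => /eqP E.
  transitivity ((alpha m * t + beta m) * (gamma m' * t + delta m') -
    (alpha m' * t + beta m') * (gamma m * t + delta m)); first by ring.
  by rewrite E subrr.
have It0 := Ip _ Up0; have [q2 q1 q0] := quadratic_zero oI It0 Tq.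
have [l [Ea Eb Eg Ed]] := proportional_moebius D0 q2 q1 q0.
have l0 : l != 0 by apply: contraNneq D0' => l0; rewrite Ea Ed Eb Eg l0 !mul0r subrr.
have EW t : gamma m' * t + delta m' = l * (gamma m * t + delta m).
  by rewrite Eg Ed; ring.
have CE : C m' = l ^+ r.-1 * C m.
  have [e e0 eU] := open_ball_sub oU Up0.
  have h0 : e / 2 != 0 by rewrite lt0r_neq0// divr_gt0.
  (* Two points on one fibre are subtracted to eliminate [X0] and isolate the coefficient of x. *)
  have Up1 : U (p0.1, p0.2 + e / 2).
    apply: eU; split => /=; first exact: ballxx.
    rewrite -ball_normE/= opprD addNKr normrN gtr0_norm ?divr_gt0//.
    by rewrite ltr_pdivrMr// ltr_pMr// ltr1n.
  have [_ X0e] := H _ Up0; have [_ X1e] := H _ Up1.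
  have W := w0 _ It0; apply: (mulIf h0).
  move: X0e X1e; rewrite /X_of/= EW exprMn.
  have := expf_neq0 r.-1 W; have := expf_neq0 r.-1 l0.
  move: (_ ^+ r.-1) (l ^+ _) => b a a0 b0 X0e X1e.
  have : C m / b * (e / 2) = C m' / (a * b) * (e / 2).
    transitivity ((C m / b * (p0.2 + e / 2) + X0 m p0.1) -
      (C m / b * p0.2 + X0 m p0.1)); first by ring.
    by rewrite X1e X0e; ring.
  move=> /(mulIf h0) CE; congr (_ * _).
  have -> : C m = C m / b * b by rewrite divfK.
  by rewrite CE; field; rewrite a0 b0.
exists l => //; split=> // t It; move: (It) => [p Up tE].
have [_] := H p Up; rewrite /X_of tE EW exprMn CE.
have := expf_neq0 r.-1 (w0 t It); have := expf_neq0 r.-1 l0.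
move: (_ ^+ r.-1) (l ^+ _) => b a a0 b0.
have -> : a * C m / (a * b) = C m / b by field; rewrite a0 b0.
by move=> /addrI.
Qed.

End Rescaling.

(** * Second-order equations *)

Section SecondOrder.
Variables (R : realType) (K : numFieldType) (crd : coordinates R K).
Local Notation plane := (plane K).
Local Notation jet := (jet K 2).

Let r0 : (0 < 2)%N := isT.

(** Real segments serve over both fields, so balls and the whole field are handled alike in the
    construction of suitable domains. *)
Definition star (A : set K) (a : K) :=
  forall z s, A z -> s \in `[0, 1]%R -> A (a + ofR crd s * (z - a)).

Lemma suitable_box (A B : set K) (a b : K) : open A -> open B -> A a -> B b ->
  star A a -> star B b -> suitable_domain ((A `*` B) : set plane).
Proof.
move=> oA oB Aa Bb sA sB; split.
- have -> : A `*` B = (fst @^-1` A) `&` (snd @^-1` B) :> set plane by [].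
  by apply: openI; apply: open_comp => // q _; [exact: cvg_fst|exact: cvg_snd].
- by exists (a, b).
- apply: (@star_connected R K crd plane _ (a, b)) => -[t x] s [/= At Bx] sI.
  by split; [exact: sA|exact: sB].
- move=> t; apply: (@star_connected R K crd K _ b) => x s [/= At Bx] sI.
  by split=> //; exact: sB.
Qed.

Lemma ball_star (t0 rho : K) : star (ball t0 rho) t0.
Proof. by move=> z s; exact: ball_segment. Qed.

Lemma eq_holds2 (th : arbval K 2) (z : jet) : Defs.eq_holds th z <-> jx z 2 = av_b th.
Proof. by rewrite /Defs.eq_holds big_ord0 addr0. Qed.

Lemma on_equation2 (E : equation K 2) (z : jet) :
  on_equation E z <-> jx z 2 = rhs E (jt z).
Proof. by rewrite /on_equation eq_holds2 /av_b row_mxEr mxE. Qed.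

Lemma on_equation_prolongation2 (E : equation K 2) (T X : plane -> K) (z : jet) :
  on_equation E (prolongation T X z) <->
  prolonged_derivative T X 2 z = rhs E (T (base z)).
Proof. by rewrite on_equation2 jx_prolongation// jt_prolongation. Qed.

Lemma derive_fst_id (p v : plane) : 'D_v (fst : plane -> K) p = v.1.
Proof. by apply: (@derive_linear K plane K fst) => q; exact: cvg_fst. Qed.

Lemma derive_snd_id (p v : plane) : 'D_v (snd : plane -> K) p = v.2.
Proof. by apply: (@derive_linear K plane K snd) => q; exact: cvg_snd. Qed.

(* The hodograph transformation (t, x) -> (x, t) preserves x'' = 0. *)
Lemma hodograph_admissible :
  admissible (snd : plane -> K) (fst : plane -> K) (setT `*` setT)
    (slope_equation 2 0 0) (slope_equation 2 0 0).
Proof.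
have sT : star setT 0 by [].
have sU := suitable_box openT openT I I sT sT; have [oU _ _ _] := sU.
split; first split=> //; [exact: smooth_snd|exact: smooth_fst| |].
  move=> p _; rewrite /plane_jacobian.
  by rewrite !derive_fst_id !derive_snd_id/= mul0r mul1r sub0r oppr_eq0 oner_eq0.
split=> // z _ Dz.
have D (y : jet) : DT (snd : plane -> K) y = jx y 1 by exact: td_jx.
have P1 : prolonged_derivative snd fst 1 = (fun y : jet => (jx y 1)^-1).
  apply/funext => y; rewrite prolonged_derivativeS D.
  suff -> : total_derivative (prolonged_derivative snd fst 0) y = 1 by rewrite mul1r.
  by rewrite [LHS](@td_jt K 2 id)// derive_id.
have x0 : jx z 1 != 0 by rewrite -D.
(* The second prolonged derivative is -x_2/x_1^3, which vanishes exactly when x_2 does. *)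
rewrite on_equation2 on_equation_prolongation2 prolonged_derivativeS D P1 tdV//;
  last exact: differentiable_jx.
rewrite td_jx//= /slope_rhs !mul0r; split=> [->|/eqP]; first by rewrite !mul0r oppr0 mul0r.
rewrite mulf_eq0 oppr_eq0 mulf_eq0 !invr_eq0 expf_eq0/= (negPf x0) !orbF.
by move/eqP.
Qed.

Lemma td_along (U : set plane) (T : plane -> K) (A : set K) (g : K -> K) (a : K) (z : jet) :
  open U -> smooth U T -> smooth A g -> (forall p, U p -> A (T p - a)) -> over U z ->
  total_derivative (fun y : jet => g (T (base y) - a)) z =
  'D_1 g (T (base z) - a) * DT T z.
Proof.
move=> oU sT sg UA Uz; pose S p := T p - a.
have sS : smooth U S by apply: smoothB => //; exact: smooth_cst.
have dS := smooth_differentiable sS Uz.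
have dg := smooth_differentiable sg (UA _ Uz).
have dgS : differentiable (fun y : jet => g (S (base y))) z.
  have sgS : smooth U (fun q => g (S q)) by exact: smooth_comp1 sS sg.
  exact: smooth_differentiable (smooth_base 2 oU sgS) Uz.
rewrite tdE// (@derive_comp1 K _ _ (fun y : jet => S (base y)) g)//; last first.
  exact: differentiable_base.
rewrite -tdE; last exact: differentiable_base.
rewrite -[_ *: _]/(_ * _) mulrC; congr (_ * _).
rewrite -[LHS]/(DT S z) (DTE r0 sS Uz) (DTE r0 sT Uz) /S.
by rewrite !derive_fD ?derive_cst ?addr0//; exact: smooth_differentiable sT Uz.
Qed.

(** An equivalence transformation generating the hodograph transformation would have T = x, against
    the vanishing of T_x. *)
Lemma not_normalized2 : ~ normalized K 2.
Proof.
move=> /(_ _ _ _ _ _ hodograph_admissible (0, 0) (conj I I)).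
move=> [Om [Th [_ P0 eqT _]]].
have := equivalence_derive_x eqT P0.
by rewrite derive_snd_id => /eqP; rewrite oner_eq0.
Qed.

(* The shift t + a followed by x + F2(t), where F2'' = f is the difference of the
   right-hand sides, sends E to E' near p; undoing it after (T, X) leaves a
   symmetry of E. *)
Lemma semi_normalized2 : semi_normalized K 2.
Proof.
move=> E E' U T X adm p Up.
have [[sU sT sX J0] [domU eqU]] := adm; have [oU _ _ _] := sU.
(* The shift is chosen so that T - a takes the value [t0] at p; the symmetry to be found then keeps
   the t-coordinate of p, near which E is defined. *)
pose t0 := p.1; pose a := T p - t0; have Tp : T p - a = t0 by rewrite /a; ring.
have cadd : continuous (fun t : K => t + a).
  by move=> t; apply: (@continuousD K K K id (cst a) t); [exact: cvg_id|exact: cst_continuous].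
pose A := dom E `&` ((fun t : K => t + a) @^-1` dom E').
have oA : open A.
  by apply: openI; [exact: dom_open|apply: open_comp => //; exact: dom_open].
have At0 : A t0.
  by have [d d'] := domU p Up; split=> //=; rewrite -Tp subrK.
have [rho rho0 BA] := open_ball_sub oA At0.
pose B := ball t0 rho; have oB : open B by exact: ball_open.
have Bt0 : B t0 by exact: ballxx.
pose f t := rhs E' (t + a) - rhs E t.
have sf : smooth B f.
  apply: smoothB => //; last by apply: (smooth_sub _ (rhs_smooth E)) => t /BA[].
  apply: (@smooth_comp1 K K K B (dom E') (fun t => t + a)) => //; last exact: rhs_smooth.
    by move=> t /BA[].
  by apply: smoothD => //; [exact: smooth_id|exact: smooth_cst].
have [F1 [sF1 DF1]] := smooth_primitive crd sf.
have [F2 [sF2 DF2]] := smooth_primitive crd sF1.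
pose m := MoebiusData 1 a 0 1 1 F2.
pose S q := T q - a; pose Y q := X q - F2 (S q).
have sS : smooth U S by apply: smoothB => //; exact: smooth_cst.
have [e e0 eV] : exists2 e : K, 0 < e & ball p e `<=` U `&` [set q | B (S q)].
  have nV : nbhs p (U `&` [set q | B (S q)]).
    apply: filterI; first exact: open_nbhs_nbhs.
    apply: (smooth_continuous sS Up); rewrite /S Tp; exact: open_nbhs_nbhs.
  by move/nbhs_ballP: nV => -[e e0 He]; exists e.
(* This product is the ball around p in the plane; written as a box it is visibly a suitable
   domain. *)
pose V : set plane := ball p.1 e `*` ball p.2 e.
have VU q : V q -> U q by move=> /eV[].
have VB q : V q -> B (S q) by move=> /eV[].
have Vp : V p by split; exact: ballxx.
have sV : suitable_domain V.
  by apply: suitable_box (ballxx _ e0) (ballxx _ e0) (@ball_star _ _) (@ball_star _ _);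
    exact: ball_open.
have [oV _ _ _] := sV.
have sTV := smooth_sub VU sT; have sXV := smooth_sub VU sX.
have sSV := smooth_sub VU sS.
have sF2S : smooth V (fun q => F2 (S q)) by exact: smooth_comp1 sSV sF2.
have sYV : smooth V Y by exact: smoothB.
have DS q v : V q -> 'D_v S q = 'D_v T q.
  move=> Vq; rewrite derive_fD ?derive_cst ?addr0//.
  exact: smooth_differentiable sTV Vq.
have DY q v : V q -> 'D_v Y q = 'D_v X q - 'D_v T q * F1 (S q).
  move=> Vq; have dX := smooth_differentiable sXV Vq.
  have dF := smooth_differentiable sF2S Vq.
  rewrite derive_fD//; last exact: differentiableN.
  rewrite derive_fN// derive_comp1; [|exact: smooth_differentiable sSV Vq|].
    by rewrite DS// (DF2 _ (VB _ Vq)).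
  exact: smooth_differentiable sF2 (VB _ Vq).
have DTS (y : jet) : over V y -> DT S y = DT T y.
  by move=> Vy; rewrite (DTE r0 sSV Vy) (DTE r0 sTV Vy) !DS.
have oR : open (@regular K 2 V T) by exact: open_regular oV sTV.
have P1 (y : jet) : regular V T y -> prolonged_derivative S Y 1 y =
    prolonged_derivative T X 1 y - F1 (S (base y)).
  move=> [Vy D0]; rewrite !prolonged_derivativeS (DTS _ Vy).
  have dX := smooth_differentiable (smooth_base 2 oV sXV) Vy.
  have dF := smooth_differentiable (smooth_base 2 oV sF2S) Vy.
  have -> : total_derivative (prolonged_derivative S Y 0) y =
      total_derivative (prolonged_derivative T X 0) y - F1 (S (base y)) * DT T y.
    rewrite -(DF2 _ (VB _ Vy)) -(td_along oV sTV sF2 VB Vy).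
    by rewrite -tdN// -tdD//; exact: differentiableN.
  by rewrite mulrBl mulfK.
(* Since D(F(S)) = F'(S) [DT], each division by [DT] replaces the subtracted primitive by its
   derivative, so after two steps exactly the difference of the right-hand sides is removed. *)
have P2 (z : jet) : regular V T z -> prolonged_derivative S Y 2 z =
    prolonged_derivative T X 2 z - f (S (base z)).
  move=> Rz; have [Vz D0] := Rz.
  rewrite (prolonged_derivativeS S) (prolonged_derivativeS T) (DTS _ Vz).
  have sF1S : smooth V (fun q => F1 (S q)) by exact: smooth_comp1 sSV sF1.
  have dX := smooth_differentiable (smooth_prolonged_derivative 2 oV sTV sXV 1) Rz.
  have dF := smooth_differentiable (smooth_base 2 oV sF1S) Vz.
  have -> : total_derivative (prolonged_derivative S Y 1) z =
      total_derivative (prolonged_derivative T X 1) z - f (S (base z)) * DT T z.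
    rewrite (td_eq oR Rz P1) -(DF1 _ (VB _ Vz)) -(td_along oV sTV sF1 VB Vz).
    by rewrite -tdN// -tdD//; exact: differentiableN.
  by rewrite mulrBl mulfK.
have sU' : suitable_domain (B `*` setT : set plane).
  by apply: (@suitable_box _ _ t0 0) => //; [exact: openT|exact: ball_star].
have [oU' _ _ _] := sU'.
have vm : valid_parameters (B `*` setT) m.
  split=> /=; rewrite ?mulr0 ?mul0r ?subr0 ?mulr1 ?oner_neq0//.
    by apply: (smooth_sub _ sF2) => t [q [Bq _] <-].
  by move=> t _; rewrite mul0r add0r oner_neq0.
exists V, S, Y, (@cylinder K 2 (B `*` setT)), (T_of m), (X_of 2 m), (image_joint m).
split=> //.
- split; first split=> // q Vq.
    rewrite /plane_jacobian !DS// !DY//; move: (J0 q (VU q Vq)); rewrite /plane_jacobian.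
    move: ('D_(1, 0) T q) ('D_(0, 1) T q) ('D_(1, 0) X q) ('D_(0, 1) X q) => ? ? ? ? J.
    by move: J; congr (_ != _); ring.
  split=> [q Vq|z Vz]; first by split; [have [] := domU _ (VU _ Vq)|have [] := BA _ (VB _ Vq)].
  rewrite (DTS _ Vz) => D0; have Rz : regular V T z by split.
  apply: (iff_trans (eqU z (VU _ Vz) D0)).
  rewrite !on_equation_prolongation2 (P2 _ Rz) /f /S subrK.
  by split=> [->|/eqP]; [ring|rewrite opprB addrA subr_eq addrC => /eqP /addrI].
- exact: moebius_equivalence.
- move=> q Vq; split.
  + by rewrite plane_projection_cylinder; split=> //; exact: VB.
  + by rewrite /T_of/= mul1r mul0r add0r divr1 subrK.
  + by rewrite /X_of/= mul0r add0r expr1 divr1 mul1r subrK.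
Qed.

End SecondOrder.

Theorem proposition12 (R : realType) (F : ground_field) (r : nat)
    (hr : (2 <= r)%N) :
  let K := scalars R F in
  [/\ (* every equivalence transformation projects to the stated form *)
      forall (Om : set (joint K r)) (T X : plane K -> K)
             (Th : joint K r -> arbval K r),
        equivalence_transformation T X Om Th ->
        exists2 m : parameters K,
          valid_parameters (plane_projection Om) m &
          forall p, plane_projection Om p ->
            T p = T_of m p /\ X p = X_of r m p,
      (* every transformation of the stated form is such a projection *)
      forall (U : set (plane K)) (m : parameters K),
        suitable_domain U -> valid_parameters U m ->
        exists Th : joint K r -> arbval K r,
          equivalence_transformation (T_of m) (X_of r m) (cylinder U) Th,
      (* the parameters are defined exactly up to rescaling *)
      forall (U : set (plane K)) (m m' : parameters K),
        suitable_domain U -> valid_parameters U m -> valid_parameters U m' ->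
        ((forall p, U p -> T_of m p = T_of m' p /\ X_of r m p = X_of r m' p)
          <-> rescaled r U m m'),
      r = 2%N -> semi_normalized K r /\ ~ normalized K r &
      (3 <= r)%N -> normalized K r].
Proof.
move=> K; pose crd : coordinates R K := scalars_coordinates R F; split.
- by move=> Om T X Th; exact: (equivalence_form crd hr).
- move=> U m sU vm; exists (image_joint m); have [oU _ _ _] := sU.
  exact: moebius_equivalence.
- by move=> U m m'; exact: rescaling.
- by move=> ->; split; [exact: (semi_normalized2 crd)|exact: (not_normalized2 crd)].
- exact: (normalized_ge3 crd hr).
Qed.
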